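(* Let $\mathcal T,\mathcal X$ be complete separable metric spaces, $\mathcal X$ being equipped with a scaling and an origin $0$, and let $E=\mathcal T\times\mathcal X$, $F=\mathcal T\times\{0\}$, $\mathcal N=\mathcal N(E\setminus F)$. Let $\Psi=\sum_{i=1}^N\varepsilon_{T_i}$ be a finite point process on $\mathcal T$ and, independently of $\Psi$, let $X_1,X_2,\ldots$ be i.i.d. random variables on $\mathcal X\setminus\{0\}$ with distribution $\nu\in\mathrm{RV}(\mathcal X\setminus\{0\},(a_n),\mu)$. Let $\Pi=\sum_{i=1}^N\varepsilon_{(T_i,X_i)}$. Assume that, for $k\ge0$, $\Psi$ has a finite and non-null $(k+1)$-th factorial moment measure $M_{k+1}$. Then, as $n\to\infty$, $$n^{k+1}\,\mathbb P(a_n^{-1}\Pi\in\cdot)\longrightarrow\mu^*_{k+1}(\cdot)\quad\text{in }\mathbb M(\mathcal N\setminus\mathcal N_k),$$ with non-null limit measure defined, for $B\in\mathcal B(\mathcal N\setminus\mathcal N_k)$, by $$\mu^*_{k+1}(B)=\frac1{(k+1)!}\int_{E^{k+1}}\mathbf 1_{\{\sum_{i=1}^{k+1}\varepsilon_{(t_i,x_i)}\in B\}}\,M_{k+1}(dt_1,\ldots,dt_{k+1})\otimes_{i=1}^{k+1}\mu(dx_i).$$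
   Context: For a closed subset $F$ of a complete separable metric space $(E,d_E)$, $F^r=\{x\in E: d_E(x,y)<r \text{ for some } y\in F\}$; a set $B$ is bounded away from $F$ if $B\cap F^r=\emptyset$ for some $r>0$. $\mathbb M(E\setminus F)$ is the set of Borel measures $\mu$ on $E\setminus F$ with $\mu(E\setminus F^r)<\infty$ for all $r>0$; $\mu_n\to\mu$ in $\mathbb M(E\setminus F)$ means $\int f\,d\mu_n\to\int f\,d\mu$ for all bounded continuous $f:E\to\mathbb R$ with support bounded away from $F$. This is metrized by $\rho(\mu_1,\mu_2)=\int_0^\infty\{\rho_r(\mu_1^r,\mu_2^r)\wedge1\}e^{-r}dr$, with $\mu^r$ the restriction of $\mu$ to $E\setminus F^r$ and $\rho_r$ the Prohorov metric on finite measures on $E\setminus F^r$. Laws of random elements of $E$ are understood as restricted to $E\setminus F$. A scaling on a metric space $\mathcal X$ is a continuous map $(0,\infty)\times\mathcal X\to\mathcal X$, $(u,x)\mapsto ux$, with $1x=x$ and $u_1(u_2x)=(u_1u_2)x$. The origin $0\in\mathcal X$ satisfies $u0=0$ for all $u>0$, and $d_{\mathcal X}(0,x)<d_{\mathcal X}(0,ux)$ for $u>1$, $x\neq0$. $\nu\in\mathrm{RV}(\mathcal X\setminus\{0\},(a_n),\mu)$ means that $(a_n)$ is a positive sequence with $a_n\to\infty$, $\mu\in\mathbb M(\mathcal X\setminus\{0\})$ is non-null, and $n\nu(a_n\,\cdot)\to\mu(\cdot)$ in $\mathbb M(\mathcal X\setminus\{0\})$. $E=\mathcal T\times\mathcal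 X$ has metric $d_E((t,x),(t',x'))=d_{\mathcal T}(t,t')+d_{\mathcal X}(x,x')$ and scaling $u(t,x)=(t,ux)$. $\mathcal N=\mathcal N(E\setminus F)\subset\mathbb M(E\setminus F)$ is the closed subset of integer-valued (point) measures $\pi=\sum_{i\in I}\varepsilon_{z_i}$, with metric $\rho$ and scaling $u\pi=\sum_{i\in I}\varepsilon_{uz_i}$ ($\varepsilon_z$ is the Dirac mass). $\mathcal N_k\subset\mathcal N$ is the closed cone of point measures with at most $k$ points ($\mathcal N_0=\{0\}$). For $r>0$ let $\mathcal N_k^r=\{\pi\in\mathcal N:\rho(\pi,\psi)<r\text{ for some }\psi\in\mathcal N_k\}$. $\mathbb M(\mathcal N\setminus\mathcal N_k)$ is the set of Borel measures $\mu^*$ on $\mathcal N\setminus\mathcal N_k$ with $\mu^*(\mathcal N\setminus\mathcal N_k^r)<\infty$ for all $r>0$; $\mu_n^*\to\mu^*$ in $\mathbb M(\mathcal N\setminus\mathcal N_k)$ means $\int g\,d\mu_n^*\to\int g\,d\mu^*$ for all bounded continuous $g:\mathcal N\to\mathbb R$ (continuity being with respect to $\rho$) whose support is disjoint from $\mathcal N_k^r$ for some $r>0$. Laws of random elements of $\mathcal N$ are understood as restricted to $\mathcal N\setminus\mathcal N_k$. For $k\ge1$ the $k$-th factorial moment measure of $\Psi$ is $M_k(A)=\mathbb E[\Psi^{(k)}(A)]$, $A\in\mathcal B(\mathcal T^k)$, where $\Psi^{(k)}=\sum\varepsilon_{(T_{i_1},\ldots,T_{i_k})}$, the sum running over $k$-tuples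 of pairwise distinct indices $i_1,\ldots,i_k\in\{1,\ldots,N\}$. *)

(* Defs.v *)
From HB Require Import structures.
From mathcomp Require Import all_boot all_order all_algebra.
From mathcomp Require Import all_classical all_reals all_analysis.
Import Order.TTheory GRing.Theory Num.Theory.
Import numFieldTopology.Exports numFieldNormedType.Exports.

Set Implicit Arguments.
Unset Strict Implicit.
Unset Printing Implicit Defensive.

Local Open Scope classical_set_scope.
Local Open Scope ring_scope.

#[short(type="completeMetricType")]
HB.structure Definition CompleteMetric (R : numDomainType) :=
  {T of Complete T & PseudoPointedMetric R T & PseudoMetric_isMetric R T}.

(** The library does not declare products of pointed topological spaces as
    pointed topological spaces. *)
HB.instance Definition _ (T X : ptopologicalType) := Pointed.on (T * X)%type.

Definition separable_space (S : topologicalType) : Prop :=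
  exists2 D : set S, countable D & dense D.

Definition borel (S : ptopologicalType) := g_sigma_algebraType (@open S).

(** A measure on [S \ F] is represented by a measure (or, where no
    measure axiom is needed to state something, a set function) on the Borel
    sets of [S], of which only the values on Borel subsets of [~` F] are used:
    integrals are taken over [~` F].  The topology of [S] and the distance [d]
    are separate parameters because the topology of a product [T * X] comes
    from the library whereas the distance used on it is the sum distance. *)
Section away.
Context {R : realType} {S : ptopologicalType} (d : S -> S -> R) (F : set S).

Definition fattening (r : R) : set S := [set x | exists2 y, F y & d x y < r].

Definition bounded_away (B : set S) : Prop :=
  exists2 r : R, 0 < r & B `&` fattening r = set0.

Definition away_finite (mu : set (borel S) -> \bar R) : Prop :=
  forall r : R, 0 < r -> (mu (~` fattening r) < +oo)%E.

Definition away_nonnull (mu : set (borel S) -> \bar R) : Prop :=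
  mu (~` F) <> 0%E.

Definition away_cvg (mus : nat -> set (borel S) -> \bar R)
    (mu : set (borel S) -> \bar R) : Prop :=
  forall f : S -> R,
    continuous f ->
    (exists M : R, forall x, `|f x| <= M) ->
    bounded_away (closure [set x | f x != 0]) ->
    (\int[mus n]_(x in ~` F) (f x)%:E)%E @[n --> \oo] -->
    (\int[mu]_(x in ~` F) (f x)%:E)%E.

End away.

Section point_measures.
Context {R : realType} {S : ptopologicalType}.
Implicit Types (d : S -> S -> R) (F : set S).

(** The sum of Dirac masses is required to give the value on every set, not
    only on the Borel ones, so that an element of [pointMeasure d F] has no
    arbitrary values and is determined by the measure it represents.  The index
    set may be taken inside [nat], as point measures that are finite away from
    a closed [F] in a separable space have countably many atoms. *)
Definition is_point_measure d F (m : set (borel S) -> \bar R) : Prop :=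
  away_finite d F m /\
  exists (I : set nat) (z : nat -> borel S),
    (forall i, I i -> ~ F (z i)) /\
    (forall A, m A = \esum_(i in I) \d_(z i) A).

Record pointMeasure d F := PointMeasure {
  pm_fun :> set (borel S) -> \bar R ;
  pm_funP : is_point_measure d F pm_fun }.

(** Prohorov distance between the restrictions of [m1] and [m2] to the
    metric subspace [D]. *)
Definition prohorov d (D : set S) (m1 m2 : set (borel S) -> \bar R) : R :=
  inf [set e : R | 0 < e /\
    forall A : set (borel S), measurable A -> A `<=` D ->
      (m1 A <= m2 (fattening d A e `&` D) + e%:E)%E /\
      (m2 A <= m1 (fattening d A e `&` D) + e%:E)%E].

Definition rho d F (m1 m2 : set (borel S) -> \bar R) : R :=
  \int[lebesgue_measure]_(r in `[0, +oo[)
    (Num.min (prohorov d (~` fattening d F r) m1 m2) 1 * expR (- r)).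

Definition pm_dist d F (p q : pointMeasure d F) : R := rho d F p q.

End point_measures.

Section point_measure_topology.
Context {R : realType} {S : ptopologicalType} (d : S -> S -> R) (F : set S).

Lemma zero_is_point_measure : is_point_measure d F (fun=> 0%E).
Proof.
split; first by move=> r _; rewrite ltry.
exists set0, (fun=> point); split=> // A.
by rewrite esum_set0.
Qed.

HB.instance Definition _ := gen_eqMixin (pointMeasure d F).
HB.instance Definition _ := gen_choiceMixin (pointMeasure d F).
HB.instance Definition _ := isPointed.Build (pointMeasure d F)
  (PointMeasure zero_is_point_measure).

(** The topology of the distance [pm_dist]; defining it by its open sets does
    not need a proof that [pm_dist] satisfies the axioms of a distance. *)
Definition pm_open : set_system (pointMeasure d F) := [set U | forall p, U p ->
  exists2 e : R, 0 < e & forall q, pm_dist p q < e -> U q].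

Lemma pm_openT : pm_open setT.
Proof. by move=> p _; exists 1. Qed.

Lemma pm_openI : setI_closed pm_open.
Proof.
move=> U V oU oV p [Up Vp].
have [e e0 eU] := oU _ Up; have [f f0 fV] := oV _ Vp.
exists (Num.min e f); first by rewrite lt_min e0.
by move=> q; rewrite lt_min => /andP[? ?]; split; [exact: eU|exact: fV].
Qed.

Lemma pm_open_bigU (I : Type) (f : I -> set (pointMeasure d F)) :
  (forall i, pm_open (f i)) -> pm_open (\bigcup_i f i).
Proof.
move=> of_ p [i _ fip]; have [e e0 ef] := of_ i p fip.
by exists e => // q /ef fiq; exists i.
Qed.

HB.instance Definition _ := isOpenTopological.Build (pointMeasure d F)
  pm_openT pm_openI pm_open_bigU.

(** Counted with multiplicity. *)
Definition at_most (k : nat) : set (pointMeasure d F) :=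
  [set p | (p setT <= k%:R%:E)%E].

(** The measure on [S \ F] given by the sum of the Dirac masses at the entries
    of [s]; entries lying in [F] do not contribute. *)
Definition sum_dirac (s : seq S) (A : set (borel S)) : \bar R :=
  (\sum_(z <- s | z \notin F) \d_(z : borel S) A)%E.

Lemma sum_dirac_is_point_measure (s : seq S) :
  is_point_measure d F (sum_dirac s).
Proof.
split.
  move=> r _; rewrite /sum_dirac; apply: lte_sum_pinfty => z _.
  by rewrite /dirac ltry.
pose s' := [seq z <- s | z \notin F].
exists `I_(size s'), (nth point s'); split.
  move=> i /= si; have := mem_nth point si; rewrite mem_filter => /andP[/negP nF _].
  by move=> Fz; apply: nF; exact: mem_set.
move=> A; rewrite /sum_dirac -big_filter -/s' (big_nth point) big_mkord.
rewrite esum_fset; last 2 first.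
- exact: finite_II.
- by move=> i _; rewrite /dirac lee_fin.
by rewrite -fsbig_ord.
Qed.

Definition pm_of_seq (s : seq S) : pointMeasure d F :=
  PointMeasure (sum_dirac_is_point_measure s).

End point_measure_topology.

(** [act u] is only meaningful for [0 < u]. *)
Record scaling {R : realType} (X : completeMetricType R) := Scaling {
  act : R -> X -> X ;
  origin : X ;
  act_continuous : {within [set p : R * X | 0 < p.1],
    continuous (fun p : R * X => act p.1 p.2)} ;
  act1 : forall x, act 1 x = x ;
  actM : forall u1 u2 x, 0 < u1 -> 0 < u2 ->
    act u1 (act u2 x) = act (u1 * u2) x ;
  act_origin : forall u, 0 < u -> act u origin = origin ;
  act_lt : forall u x, 1 < u -> x <> origin ->
    mdist origin x < mdist origin (act u x) }.

Definition regularly_varying {R : realType} {X : completeMetricType R}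
    (s : scaling X) (nu : set (borel X) -> \bar R) (a : nat -> {posnum R})
    (mu : set (borel X) -> \bar R) : Prop :=
  [/\ (a n)%:num @[n --> \oo] --> +oo,
      away_finite mdist [set origin s] mu,
      away_nonnull [set origin s] mu &
      away_cvg mdist [set origin s]
        (fun n A => (n%:R%:E * nu (act s (a n)%:num @` A))%E) mu].

Section marked_space.
Context {R : realType} (T X : completeMetricType R) (s : scaling X).

Definition dE (z w : T * X) : R := mdist z.1 w.1 + mdist z.2 w.2.

Definition axis : set (T * X) := setT `*` [set origin s].

Definition scaleE (u : R) (z : T * X) : T * X := (z.1, act s u z.2).

End marked_space.

Notation pointMeasureE T s := (pointMeasure (@dE _ T _) (axis s)).

Section marked.
Context {R : realType} {T X : completeMetricType R} (s : scaling X).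

Lemma scale_is_point_measure (u : {posnum R}) (p : pointMeasureE T s) :
  is_point_measure (@dE R T X) (axis s) (fun A => p (scaleE s u%:num @^-1` A)).
Proof.
have u0 : 0 < u%:num :> R by [].
have [pfin [I [z [zF pE]]]] := pm_funP p.
have dEaxis r (y : T * X) :
    fattening (@dE R T X) (axis s) r y <-> mdist y.2 (origin s) < r.
  split=> [[[t x] /= [_ /= ->]]|yr].
    by apply: le_lt_trans; rewrite /dE/= lerDr mdist_ge0.
  exists (y.1, origin s) => //.
  by rewrite /dE/= mdistxx add0r.
split; last first.
  exists I, (scaleE s u%:num \o z); split.
    move=> i /zF nzi [_ /= uo]; apply: nzi; split => //=.
    have := congr1 (act s u%:num^-1) uo.
    by rewrite actM ?invr_gt0// mulVf ?gt_eqF// act1 act_origin ?invr_gt0.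
  by move=> A; rewrite pE.
move=> r r0.
have cu : (fun q : R * X => act s q.1 q.2) q @[q --> (u%:num, origin s)] -->
    act s u%:num (origin s).
  have := @act_continuous _ _ s.
  rewrite continuous_open_subspace; last first.
    have -> : [set q : R * X | 0 < q.1] = fst @^-1` [set x : R | 0 < x].
      by [].
    by apply: open_comp; [move=> q _; exact: cvg_fst|exact: open_gt].
  by move=> /(_ (u%:num, origin s)); apply; rewrite inE.
have : nbhs (origin s) [set x | mdist (act s u%:num x) (origin s) < r].
  have : nbhs (act s u%:num (origin s)) (ball (origin s) r).
    by rewrite act_origin//; exact: nbhsx_ballx.
  move=> /cu [[A B] /= [nA nB] AB]; apply: filterS nB => x Bx /=.
  have := AB (u%:num, x); rewrite /= ballEmdist/= metric_sym; apply.
  by split => //=; exact: nbhs_singleton.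
rewrite -nbhs_ballE => -[e /= e0 eB].
apply: le_lt_trans (pfin _ e0).
rewrite !pE; apply: le_esum => i _; rewrite /dirac lee_fin.
rewrite !indicE ler_nat; case: (boolP (_ \in _)) => //= H.
rewrite mem_set//= => /dEaxis ziE; move/set_mem : H; apply.
apply/dEaxis; apply: eB; rewrite ballEmdist/= metric_sym//.
Qed.

Definition pm_scale (u : {posnum R}) (p : pointMeasureE T s) : pointMeasureE T s :=
  PointMeasure (scale_is_point_measure u p).

End marked.

Section random.
Context {d : measure_display} {Omega : measurableType d} {R : realType}.
Variable P : probability Omega R.

Definition independent_systems (G H : set (set Omega)) : Prop :=
  forall A B, G A -> H B -> P (A `&` B) = (P A * P B)%E.

Definition mutually_independent {S : ptopologicalType}
    (X : nat -> Omega -> S) : Prop :=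
  forall (J : seq nat) (A : nat -> set (borel S)), uniq J ->
    (forall j, measurable (A j)) ->
    P (\bigcap_(j in [set` J]) (X j @^-1` A j)) =
    \big[*%E/1%E]_(j <- J) P (X j @^-1` A j).

Definition iid {S : ptopologicalType} (X : nat -> Omega -> S)
    (nu : probability (borel S) R) : Prop :=
  [/\ forall j, measurable_fun [set: Omega] (X j : Omega -> borel S),
      forall j (A : set (borel S)), measurable A -> P (X j @^-1` A) = nu A &
      mutually_independent X].

(** Events generating the information carried by a finite sequence of random
    points [t 0, ..., t (N - 1)] of random length [N]: [t i] is only looked at
    where [i < N]. *)
Definition point_events {S : ptopologicalType} (N : Omega -> nat)
    (t : nat -> Omega -> S) : set (set Omega) :=
  [set E | (exists n, E = [set w | N w = n]) \/
           (exists i (A : set (borel S)), measurable A /\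
              E = [set w | (i < N w)%N /\ A (t i w)])].

Definition sequence_events {S : ptopologicalType} (X : nat -> Omega -> S) :
    set (set Omega) :=
  [set E | exists j (A : set (borel S)), measurable A /\ E = X j @^-1` A].

(** A tuple of pairwise distinct indices in [{0, ..., N w - 1}] is a
    duplicate-free tuple over ['I_(N w)]; the sigma-algebra on [k.-tuple _] is
    the product one, i.e. the Borel one when [S] is separable. *)
Definition factorial_power {S : ptopologicalType} (N : Omega -> nat)
    (t : nat -> Omega -> S) (k : nat) (w : Omega)
    (A : set (k.-tuple (borel S))) : \bar R :=
  (\sum_(i : k.-tuple 'I_(N w) | uniq i)
     \d_([tuple (t (tnth i j) w : borel S) | j < k]) A)%E.

Definition factorial_moment {S : ptopologicalType} (N : Omega -> nat)
    (t : nat -> Omega -> S) (k : nat) (A : set (k.-tuple (borel S))) : \bar R :=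
  (\int[P]_w factorial_power N t w A)%E.

End random.

Arguments factorial_moment {d Omega R} P {S} N t k A.

(** [iter_integral mu D k f] is the integral of [f [:: x_1; ...; x_k]] with
    respect to [mu(dx_1) ... mu(dx_k)] over [D ^ k]. *)
Fixpoint iter_integral {R : realType} {S : ptopologicalType}
    (mu : set (borel S) -> \bar R) (D : set S) (k : nat)
    (f : seq S -> \bar R) : \bar R :=
  if k is k'.+1 then
    (\int[mu]_(x in D) iter_integral mu D k' (fun xs => f (x :: xs)))%E
  else f [::].

Section limit.
Context {R : realType} {T X : completeMetricType R} (s : scaling X).

Definition marked_pm {d : measure_display} {Omega : measurableType d}
    (N : Omega -> nat) (t : nat -> Omega -> T) (x : nat -> Omega -> X)
    (w : Omega) : pointMeasureE T s :=
  pm_of_seq (@dE R T X) (axis s) [seq (t i w, x i w) | i <- iota 0 (N w)].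

Definition scaled_law {d : measure_display} {Omega : measurableType d}
    (P : probability Omega R) (N : Omega -> nat) (t : nat -> Omega -> T)
    (x : nat -> Omega -> X) (a : {posnum R})
    (B : set (borel (pointMeasureE T s))) : \bar R :=
  P [set w | B (pm_scale a%:num^-1%:pos (marked_pm N t x w))].

(** The coordinates [xs] range over [X \ {0}], so that no entry of [zip ts xs]
    is discarded by [pm_of_seq]. *)
Definition limit_measure (k : nat) (M : set (k.-tuple (borel T)) -> \bar R)
    (mu : set (borel X) -> \bar R)
    (B : set (borel (pointMeasureE T s))) : \bar R :=
  (((k`!)%:R^-1)%:E *
   \int[M]_ts iter_integral mu (~` [set origin s]) k (fun xs =>
     (\1_B (pm_of_seq (@dE R T X) (axis s) (zip ts xs)))%:E))%E.

End limit.

(* Main.v *)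
Require Import Defs.
From HB Require Import structures.
From mathcomp Require Import all_boot all_order all_algebra.
From mathcomp Require Import all_classical all_reals all_analysis measurable_realfun.
Import Order.TTheory GRing.Theory Num.Theory.
Import numFieldTopology.Exports numFieldNormedType.Exports.
From mathcomp Require Import ring lra.

Set Implicit Arguments.
Unset Strict Implicit.
Unset Printing Implicit Defensive.

Local Open Scope classical_set_scope.
Local Open Scope ring_scope.

(** Conditionally on [Psi] the marks are i.i.d., so for [f] vanishing near the
    point measures with at most [k] points, [n ^ (k+1) E f (a_n^-1 Pi)] is the
    mean of [n ^ (k+1)] times an [N]-fold integral of [f] over the scaled marks.
    At least [k+1] scaled marks must be away from [0] for [f] not to vanish; each
    is so with probability of order [1/n], and the others collapse to [0].  For
    fixed points the limit is therefore the sum, over the [k+1]-subsets of the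
    points, of the [k+1]-fold [mu]-integrals of [f].  These expressions are bounded
    by a constant times ['C(N, k+1)], whose mean is [M_(k+1) / (k+1)!], so dominated
    convergence applies; summing over ordered tuples instead of subsets turns the
    mean of the limit into the integral against [M_(k+1) / (k+1)!].

    The limit for fixed points is obtained one coordinate at a time.  The inner
    integrals converge only continuously ([H_n y_n --> H y] when [y_n --> y]) and
    are not known to be continuous, so one-dimensional limits are taken under
    continuous convergence, with Lipschitz minorants of the integrands. *)

(** * Measures as positive functionals *)

(** An induction on the coordinates must know how many of the [K] required far entries remain after
    the first one, and this number jumps with the distance of that entry from [o]. The continuous
    partition of unity into [cutoff] and its complement resolves this: under [cutoff] one factor [b]
    is spent on the first entry and [K - 1] far entries remain, while under the complement all [K]
    lie in the tail and the first entry collapses to [o]. The induction hypothesis is applied along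
    arbitrary index sequences and moving first entries, and this yields the continuous convergence
    of the inner integrals.

    The metric [rho] enters through upper bounds between finite configurations: deleting points near
    the axis costs little, and so does moving points slightly. The Prohorov distance as a function
    of the radius and the sets [at_most k] are not shown to be measurable, which is why some
    integrals are compared without measurability and why measures are built from functionals
    evaluated on all indicators. Since [mu] is unconstrained at the origin, it is first replaced by
    a sigma-finite restriction. *)

Section measure_functional.
Local Open Scope ereal_scope.

(** The Daniell-type properties of integration. They are stable under mixing
    ([integral_measure_functional]), so iterated integrals, factorial moments and the limit law all
    become measures through one representation. *)
Definition measure_functional d (Y : measurableType d) (R : realType)
    (Phi : (Y -> \bar R) -> \bar R) :=
  [/\ forall f : Y -> \bar R, (forall y, 0 <= f y) -> 0 <= Phi f,
      forall f g : Y -> \bar R, (forall y, 0 <= f y) -> (forall y, f y <= g y) ->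
        measurable_fun setT f -> measurable_fun setT g -> Phi f <= Phi g,
      forall f g : Y -> \bar R, (forall y, 0 <= f y) -> (forall y, 0 <= g y) ->
        measurable_fun setT f -> measurable_fun setT g ->
        Phi (fun y => f y + g y) = Phi f + Phi g,
      forall k (f : Y -> \bar R), (0 <= k)%R -> (forall y, 0 <= f y) -> measurable_fun setT f ->
        Phi (fun y => k%:E * f y) = k%:E * Phi f &
      forall g : nat -> Y -> \bar R, (forall n y, 0 <= g n y) ->
        (forall n, measurable_fun setT (g n)) ->
        (forall y, {homo g ^~ y : n m / (n <= m)%N >-> n <= m}) ->
        Phi (g n) @[n --> \oo] --> Phi (fun y => limn (g ^~ y))].

Import HBNNSimple.

(** The measure is the functional on indicators, and sigma-additivity is [PhiM] for partial sums of
    indicators of disjoint sets. Both sides agree on simple functions and are continuous along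
    increasing limits. The formula on indicators is asserted for every set, measurable or not, which
    later permits estimates on fattenings of [at_most k]. *)
Lemma measure_functional_rep d (Y : measurableType d) (R : realType)
    (Phi : (Y -> \bar R) -> \bar R) : measure_functional Phi ->
  exists m : {measure set Y -> \bar R},
    (forall A, m A = Phi (fun y => (\1_A y)%:E)) /\
    (forall f, (forall y, 0 <= f y) -> measurable_fun setT f ->
       \int[m]_y f y = Phi f).
Proof.
move=> [Phi0 _ PhiD PhiZ PhiM].
have Phi_0 : Phi (cst 0) = 0.
  have := PhiZ 0%R (cst 0) (lexx _) (fun=> lexx _) (measurable_cst _).
  by rewrite mul0e; under eq_fun do rewrite mul0e.
pose m A := Phi (fun y => (\1_A y)%:E).
have m0 : m set0 = 0.
  by rewrite /m -Phi_0; congr Phi; apply/funext => y; rewrite indic0.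
have mge0 A : 0 <= m A by apply: Phi0 => y; rewrite lee_fin.
have mI A : measurable A -> measurable_fun setT (fun y : Y => (\1_A y)%:E : \bar R).
  by move=> mA; apply/measurable_EFinP/measurable_indic.
have Phi_sum I (s : seq I) (f : I -> Y -> \bar R) : (forall i y, 0 <= f i y) ->
    (forall i, measurable_fun setT (f i)) ->
    Phi (fun y => \sum_(i <- s) f i y) = \sum_(i <- s) Phi (f i).
  move=> f0 mf; elim: s => [|i s IH].
    by rewrite big_nil -Phi_0; congr Phi; apply/funext => y; rewrite big_nil.
  rewrite big_cons -IH -PhiD//; last 2 first.
  - by move=> y; apply: sume_ge0.
  - exact: emeasurable_sum.
  by congr Phi; apply/funext => y; rewrite big_cons.
have msig : semi_sigma_additive m.
  move=> F mF tF mUF.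
  rewrite (_ : (fun _ => _) = (fun n => Phi (fun y => \sum_(0 <= i < n) (\1_(F i) y)%:E))).
    rewrite /m [X in _ --> Phi X](_ : _ =
        (fun y => limn (fun n => \sum_(0 <= i < n) (\1_(F i) y)%:E))); last first.
      apply/funext => y; apply/esym/cvg_lim => //.
      exact: (@measure_semi_sigma_additive _ _ _ (@dirac _ Y y R) F mF tF mUF).
    apply: (PhiM (fun n y => \sum_(0 <= i < n) (\1_(F i) y)%:E)).
    - by move=> n y; apply: sume_ge0 => i _; rewrite lee_fin.
    - by move=> n; apply: emeasurable_sum => i; exact: mI.
    - move=> y n k nk; apply: lee_sum_nneg_natr => // i _ _.
  rewrite funeqE => n; rewrite Phi_sum//.
  by move=> i; exact: mI.
pose mm := isMeasure.Build _ _ _ m m0 mge0 msig.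
have [M ME] : exists M : {measure set Y -> \bar R}, forall A, M A = m A.
  by exists (HB.pack m mm : {measure set Y -> \bar R}).
exists M; split => // f f0 mf.
pose g := nnsfun_approx measurableT mf.
have fE : f = (fun y => limn (fun n => (g n y)%:E)).
  by apply/funext => y; apply/esym/cvg_lim => //; exact: cvg_nnsfun_approx.
have gE n : \int[M]_y (g n y)%:E = Phi (fun y => (g n y)%:E).
  have gsum y : (g n y)%:E =
      \sum_(x <- finmap.enum_fset (fset_set (range (g n)))) x%:E * (\1_(g n @^-1` [set x]) y)%:E.
    by rewrite -fsbig_finite//= fsumEFin//= -fimfunE.
  rewrite integralT_nnsfun sintegralE fsbig_finite//=.
  under [in RHS]eq_fun do rewrite gsum.
  (* A negative [x] is not a value of [g n]: its level set is empty and its term vanishes, so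
     homogeneity is only invoked for nonnegative factors. *)
  have x0 x y : 0 <= x%:E * (\1_(g n @^-1` [set x]) y)%:E.
    have [?|xlt0] := leP 0%R x; first by rewrite mule_ge0// lee_fin.
    by rewrite preimage_nnfun0// indic0 mule0.
  rewrite Phi_sum//; last first.
    by move=> x; apply: emeasurable_funM => //; exact: mI.
  apply: eq_bigr => x _; have [x_ge0|xlt0] := leP 0%R x.
    by rewrite ME PhiZ//; exact: mI.
  rewrite preimage_nnfun0// measure0 mule0 -[LHS]Phi_0; congr Phi.
  by apply/funext => y; rewrite indic0 mule0.
have mg n : measurable_fun setT (fun y => (g n y)%:E : \bar R).
  exact/measurable_EFinP.
have g0 n y : 0 <= (g n y)%:E by rewrite lee_fin.
have ndg y : {homo (fun n => (g n y)%:E) : n k / (n <= k)%N >-> n <= k}.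
  by move=> n k nk; rewrite lee_fin; exact/lefP/nd_nnsfun_approx.
have cPhi : Phi (fun y => (g n y)%:E) @[n --> \oo] --> Phi f.
  by rewrite [X in _ --> Phi X]fE; exact: (PhiM (fun n y => (g n y)%:E)).
have cint : \int[M]_y (g n y)%:E @[n --> \oo] --> \int[M]_y f y.
  rewrite [X in _ --> integral _ _ X]fE.
  exact: (cvg_monotone_convergence measurableT (g' := fun n y => (g n y)%:E)).
by rewrite -(cvg_lim _ cPhi)// -(cvg_lim _ cint)//; under eq_fun do rewrite gE.
Qed.

End measure_functional.

(** * Iterated integrals *)

Section iterated.
Local Open Scope ereal_scope.
Context {R : realType} {S : ptopologicalType}.

(** Measurability of a function of the first [n] entries of a sequence, tested
    along all measurable families, which avoids a sigma-algebra on [seq S]. *)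
Definition plot_measurable d (Z : measurableType d) d2 (Y : measurableType d2)
    (n : nat) (F : Z -> seq S -> Y) : Prop :=
  forall d' (Z' : measurableType d') (p : Z' -> Z) (v : nat -> Z' -> borel S),
    measurable_fun setT p -> (forall i, measurable_fun setT (v i)) ->
    measurable_fun setT (fun z => F (p z) (mkseq (fun i => v i z : S) n)).

(** Moves the first integration variable into the parameter; the family [w] of the proof is [v]
    shifted by one, with the head as entry 0. Every induction on the number of integrations rests on
    this. *)
Lemma plot_measurable_cons d (Z : measurableType d) d2 (Y : measurableType d2)
    n (F : Z -> seq S -> Y) : plot_measurable n.+1 F ->
  plot_measurable n (fun (zx : Z * borel S) xs => F zx.1 ((zx.2 : S) :: xs)).
Proof.
move=> mF d' Z' p v mp mv.
have mp1 : measurable_fun setT (fun z => (p z).1) by exact: measurableT_comp mp.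
have mp2 : measurable_fun setT (fun z => (p z).2) by exact: measurableT_comp mp.
pose w i : Z' -> borel S := if i is j.+1 then v j else (fun z => (p z).2).
have := mF _ _ _ w mp1 (fun i => _); rewrite /mkseq/=.
under eq_fun do rewrite -[in iota 1 n](addn0 1%N) iotaDl -map_comp.
by apply => -[].
Qed.

Lemma plot_measurable_comp d (Z : measurableType d) d2 (Y : measurableType d2)
    d3 (W : measurableType d3) n (F : Z -> seq S -> Y) (q : W -> Z) :
  measurable_fun setT q -> plot_measurable n F ->
  plot_measurable n (fun w => F (q w)).
Proof.
move=> mq mF d' Z' p v mp mv.
by apply: (mF _ _ (q \o p)) => //; exact: measurableT_comp.
Qed.

Lemma plot_measurable_post d (Z : measurableType d) d2 (Y : measurableType d2)
    d3 (W : measurableType d3) n (F : Z -> seq S -> Y) (g : Y -> W) :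
  measurable_fun setT g -> plot_measurable n F ->
  plot_measurable n (fun z xs => g (F z xs)).
Proof.
move=> mg mF d' Z' p v mp mv.
by apply: measurableT_comp mg _; exact: mF.
Qed.

Lemma iter_integral_ge0 (m : {measure set (borel S) -> \bar R}) D n (f : seq S -> \bar R) :
  (forall xs, 0 <= f xs) -> 0 <= iter_integral m D n f.
Proof.
elim: n f => [|n IH] f f0 //=.
by apply: integral_ge0 => x _; exact: IH.
Qed.

Variable m : {sigma_finite_measure set (borel S) -> \bar R}.

(** The inner integral is measurable in the enlarged parameter [(z, x)], so Tonelli's theorem gives
    measurability after integrating [x] out; sigma-finiteness of [m] enters here. *)
Lemma measurable_iter_integral d (Z : measurableType d) n
    (F : Z -> seq S -> \bar R) :
  (forall z xs, 0 <= F z xs) -> plot_measurable n F ->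
  measurable_fun setT (fun z => iter_integral m setT n (F z)).
Proof.
elim: n d Z F => [|n IH] d Z F F0 mF /=.
  by have := mF _ _ id (fun _ => cst point); apply.
have /= := IH _ _ _ (fun zx xs => F0 zx.1 _) (plot_measurable_cons mF).
move/measurable_fun_fubini_tonelli_F; apply => zx.
exact: iter_integral_ge0.
Qed.

(** Each clause passes under the outer integral, the last one by monotone convergence of
    [Psi z (g n)] in [z]. *)
Lemma integral_measure_functional d (Z : measurableType d)
    (M : {measure set Z -> \bar R}) d2 (Y : measurableType d2)
    (Psi : Z -> (Y -> \bar R) -> \bar R) :
  (forall z, measure_functional (Psi z)) ->
  (forall f : Y -> \bar R, (forall y, 0 <= f y) -> measurable_fun setT f ->
     measurable_fun setT (fun z => Psi z f)) ->
  measure_functional (fun f => \int[M]_z Psi z f).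
Proof.
move=> mPsi mf.
have P0 z := let: And5 P0 _ _ _ _ := mPsi z in P0.
have Pl z := let: And5 _ Pl _ _ _ := mPsi z in Pl.
have PD z := let: And5 _ _ PD _ _ := mPsi z in PD.
have PZ z := let: And5 _ _ _ PZ _ := mPsi z in PZ.
have PM z := let: And5 _ _ _ _ PM := mPsi z in PM.
split.
- by move=> f f0; apply: integral_ge0 => z _; exact: P0.
- move=> f g f0 fg mf' mg; apply: ge0_le_integral => //.
  + by move=> z _; exact: P0.
  + exact: mf.
  + by apply: mf => // y; exact: le_trans (fg y).
  + by move=> z _; exact: Pl.
- move=> f g f0 g0 mf' mg; rewrite -ge0_integralD//.
  + by apply: eq_integral => z _; exact: PD.
  + by move=> z _; exact: P0.
  + exact: mf.
  + by move=> z _; exact: P0.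
  + exact: mf.
- move=> k f k0 f0 mf'; rewrite -ge0_integralZl_EFin//.
  + by apply: eq_integral => z _; exact: PZ.
  + by move=> z _; exact: P0.
  + exact: mf.
- move=> g g0 mg ndg.
  under [X in _ --> X]eq_integral => z _ do rewrite -(cvg_lim _ (PM z g g0 mg ndg))//.
  apply: (cvg_monotone_convergence measurableT (g' := fun n z => Psi z (g n))).
  + by move=> n; exact: mf.
  + by move=> n z _; exact: P0.
  + by move=> z _ n k nk; apply: Pl => // y; exact: ndg.
Qed.

Lemma measurable_iter_section d (Z : measurableType d) n
    (F : Z -> seq S -> \bar R) (z : Z) :
  (forall z xs, 0 <= F z xs) -> plot_measurable n.+1 F ->
  measurable_fun setT
    (fun x : borel S => iter_integral m setT n (fun xs => F z ((x : S) :: xs))).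
Proof.
move=> F0 mF.
apply: (measurable_iter_integral (F := fun (x : borel S) xs => F z ((x : S) :: xs))) => //.
have mz : measurable_fun setT (fun x : borel S => (z, x)) by exact: measurable_pair1.
exact: (plot_measurable_comp mz (plot_measurable_cons mF)).
Qed.

Lemma iter_integral_measure_functional d (Z : measurableType d) d2
    (Y : measurableType d2) n (F : Z -> seq S -> Y) (z : Z) :
  plot_measurable n F ->
  measure_functional (fun f : Y -> \bar R =>
    iter_integral m setT n (fun xs => f (F z xs))).
Proof.
elim: n d Z F z => [|n IH] d Z F z mF /=.
  split => // g _ _ ndg.
  exact: ereal_nondecreasing_is_cvgn.
apply: (@integral_measure_functional _ (borel S) m _ Y (fun x (f : Y -> \bar R) =>
    iter_integral m setT n (fun xs => f (F z ((x : S) :: xs))))).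
- by move=> x; exact: (IH _ _ _ (z, x) (plot_measurable_cons mF)).
- move=> f f0 mf.
  apply: (@measurable_iter_section _ Z n (fun z xs => f (F z xs)) z) => //.
  exact: plot_measurable_post.
Qed.

Lemma eq_iter_integral n (D : set S) (f g : seq S -> \bar R)
    (mu : {measure set (borel S) -> \bar R}) :
  (forall xs, size xs = n -> (forall x, x \in xs -> D x) -> f xs = g xs) ->
  iter_integral mu D n f = iter_integral mu D n g.
Proof.
elim: n f g => [|n IH] f g fg /=; first exact: fg.
apply: eq_integral => x /set_mem Dx; apply: IH => xs sxs Dxs; apply: fg => /=.
  by rewrite sxs.
by move=> y; rewrite inE => /predU1P[->//|/Dxs].
Qed.

Lemma le_iter_integral d (Z : measurableType d) n
    (F G : Z -> seq S -> \bar R) (z : Z) :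
  (forall z xs, 0 <= F z xs) -> (forall z xs, 0 <= G z xs) ->
  (forall z xs, size xs = n -> F z xs <= G z xs) ->
  plot_measurable n F -> plot_measurable n G ->
  iter_integral m setT n (F z) <= iter_integral m setT n (G z).
Proof.
elim: n d Z F G z => [|n IH] d Z F G z F0 G0 FG mF mG /=; first exact: FG.
apply: ge0_le_integral => //.
- by move=> x _; exact: iter_integral_ge0.
- exact: measurable_iter_section.
- exact: measurable_iter_section.
- move=> x _; apply: (IH _ _ _ _ (z, x) _ _ _ (plot_measurable_cons mF) (plot_measurable_cons mG)) => //=.
  by move=> zx xs sxs; apply: FG => /=; rewrite sxs.
Qed.

Lemma iter_integralZ d (Z : measurableType d) n
    (F : Z -> seq S -> \bar R) (z : Z) (k : R) :
  (0 <= k)%R -> (forall z xs, 0 <= F z xs) -> plot_measurable n F ->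
  iter_integral m setT n (fun xs => k%:E * F z xs) =
  k%:E * iter_integral m setT n (F z).
Proof.
move=> k0; elim: n d Z F z => [|n IH] d Z F z F0 mF //=.
rewrite -ge0_integralZl_EFin//.
- by apply: eq_integral => x _; rewrite (IH _ _ _ (z, x) _ (plot_measurable_cons mF)).
- by move=> x _; exact: iter_integral_ge0.
- exact: measurable_iter_section.
Qed.

End iterated.

(** Trades, one coordinate at a time, the integrals of the theorem over the complement of the origin
    for integrals of a sigma-finite measure over the whole space. *)
Lemma iter_integral_setT (R : realType) (S : ptopologicalType)
    (mu : {measure set (borel S) -> \bar R}) (D : set S)
    (m : {sigma_finite_measure set (borel S) -> \bar R}) d (Z : measurableType d)
    n (F : Z -> seq S -> \bar R) (z : Z) :
  (forall f : borel S -> \bar R, (forall x, 0 <= f x)%E -> measurable_fun setT f ->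
     \int[mu]_(x in D) f x = \int[m]_x f x)%E ->
  (forall z xs, 0 <= F z xs)%E -> plot_measurable n F ->
  iter_integral mu D n (F z) = iter_integral m setT n (F z).
Proof.
move=> muE; elim: n d Z F z => [|n IH] d Z F z F0 mF //=.
rewrite -muE; last 2 first.
- by move=> x; exact: iter_integral_ge0.
- exact: measurable_iter_section.
apply: eq_integral => x _.
by rewrite (IH _ _ _ (z, x) _ (plot_measurable_cons mF)).
Qed.

(** * Vague limits under continuous convergence *)

Lemma continuous_borel_measurable (R : realType) (S : ptopologicalType) (f : S -> R) :
  continuous f -> measurable_fun setT (f : borel S -> R).
Proof.
move=> /continuousP cf; apply: (measurability _ (RGenOpens.measurableE R)).
move=> _ [_ [a [b ->] <-]]; rewrite setTI.
by apply: sub_sigma_algebra; apply: cf; exact: interval_open.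
Qed.

Section lipschitz_envelope.
Context {R : realType} {X : completeMetricType R}.
Variable H : nat -> X -> R.
Hypothesis H0 : forall n x, 0 <= H n x.

(** The Lipschitz minorant of all [H n] with [k <= n]. *)
Definition lip_env (k : nat) (x : X) : R :=
  inf [set r | exists n y, (k <= n)%N /\ r = H n y + k%:R * mdist x y].

Let lip_set k x := [set r | exists n y, (k <= n)%N /\ r = H n y + k%:R * mdist x y].

Let lip_set0 k x : lip_set k x !=set0.
Proof. by exists (H k x + k%:R * mdist x x); exists k, x. Qed.

Let lip_set_ge0 k x : lbound (lip_set k x) 0.
Proof. by move=> _ [n [y [_ ->]]]; rewrite addr_ge0// mulr_ge0// mdist_ge0. Qed.

Let lip_env_lb k x r : lip_set k x r -> lip_env k x <= r.
Proof. by move=> ?; apply: ge_inf => //; exists 0; exact: lip_set_ge0. Qed.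

Lemma lip_env_le k n x : (k <= n)%N -> lip_env k x <= H n x.
Proof.
by move=> kn; apply: lip_env_lb; exists n, x; rewrite mdistxx mulr0 addr0.
Qed.

Lemma lip_env_ge0 k x : 0 <= lip_env k x.
Proof. by apply: lb_le_inf; [exact: lip_set0|exact: lip_set_ge0]. Qed.

Lemma lip_env_lip k x x' : lip_env k x <= lip_env k x' + k%:R * mdist x x'.
Proof.
rewrite -lerBlDr; apply: lb_le_inf => [|_ [n [y [kn ->]]]]; first exact: lip_set0.
rewrite lerBlDr; apply: (@le_trans _ _ (H n y + k%:R * mdist x y)).
  by apply: lip_env_lb; exists n, y.
by rewrite -addrA -mulrDr lerD2l ler_wpM2l// addrC metric_triangle.
Qed.

Lemma lip_env_continuous k : continuous (lip_env k).
Proof.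
move=> x; apply/cvgrPdist_lt => e e0.
(* [k.+1] in place of the Lipschitz constant [k] keeps the radius positive at [k = 0]. *)
have d0 : 0 < e / k.+1%:R by rewrite divr_gt0.
have : nbhs x (ball x (e / k.+1%:R)) by exact: nbhsx_ballx.
apply: filterS => y; rewrite ballEmdist/= => xy.
have kxy : k%:R * mdist x y < e.
  apply: (@le_lt_trans _ _ (k.+1%:R * mdist x y)).
    by rewrite ler_wpM2r ?mdist_ge0// ler_nat.
  by rewrite mulrC -ltr_pdivlMr.
rewrite ltr_distl; apply/andP; split.
  by rewrite ltrBlDr (le_lt_trans (lip_env_lip k y x))// ltrD2l metric_sym.
by rewrite (le_lt_trans (lip_env_lip k x y))// ltrD2l.
Qed.

(** Raising [k] removes functions from the family and steepens the slope; both raise the infimum. *)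
Lemma lip_env_nd x : {homo lip_env^~ x : n m / (n <= m)%N >-> n <= m}.
Proof.
move=> k k' kk'; apply: lb_le_inf => [|_ [n [y [kn ->]]]]; first exact: lip_set0.
apply: (@le_trans _ _ (H n y + k%:R * mdist x y)).
  by apply: lip_env_lb; exists n, y; split => //; exact: leq_trans kn.
by rewrite lerD2l ler_wpM2r ?mdist_ge0// ler_nat.
Qed.

End lipschitz_envelope.

(** The indices [u j] only have to tend to infinity. This makes the property applicable to the
    sequences of counterexamples chosen below and lets the induction on coordinates reindex
    freely. *)
Definition continuously_converges (R : realType) (X : completeMetricType R)
    (Hn : nat -> X -> R) (H : X -> R) :=
  forall (u : nat -> nat) (y_ : nat -> X) y, u @ \oo --> \oo -> y_ @ \oo --> y ->
    Hn (u j) (y_ j) @[j --> \oo] --> H y.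

Section lipschitz_envelope_cvg.
Context {R : realType} {X : completeMetricType R}.
Variables (Hn : nat -> X -> R) (H : X -> R).
Hypothesis H0 : forall n x, 0 <= Hn n x.
Hypothesis HnH : continuously_converges Hn H.

Let HnHx x : Hn n x @[n --> \oo] --> H x.
Proof. by apply: (HnH (u := id) (y_ := fun=> x)) => //; exact: cvg_cst. Qed.

Lemma cvg_ge0 x : 0 <= H x.
Proof. by apply: (cvgr_to_ge (@HnHx x)); exact: nearW. Qed.

Lemma lip_env_le_lim k x : lip_env Hn k x <= H x.
Proof.
apply: (cvgr_to_ge (@HnHx x)).
by near=> n; apply: lip_env_le => //; near: n; exact: nbhs_infty_ge.
Unshelve. all: by end_near. Qed.

(** If the minorants stayed below [H x - e], near-minimisers [(n, y)] with [k <= n] would satisfy a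
    bound on [k%:R * mdist x y] uniform in [k]. Hence these [y] tend to [x], and continuous
    convergence along them contradicts the smallness of [Hn n y]. *)
Lemma lip_env_cvg x : lip_env Hn k x @[k --> \oo] --> H x.
Proof.
suff ev e : 0 < e -> exists k, H x - e < lip_env Hn k x.
  apply/cvgrPdist_lt => e /ev[k kP]; near=> n.
  rewrite ger0_norm ?subr_ge0 ?lip_env_le_lim// ltrBlDl -ltrBlDr.
  apply: (lt_le_trans kP); apply: lip_env_nd => //.
  by near: n; exact: nbhs_infty_ge.
move=> e0; apply: contrapT => /forallNP noP.
(* Half of [e] is given up to make the bound on the infimum strict, so that some member of the
   family lies below it. *)
have {}noP k : exists ny : nat * X, (k <= ny.1)%N /\
    Hn ny.1 ny.2 + k%:R * mdist x ny.2 < H x - e / 2.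
  have : lip_env Hn k x < H x - e / 2.
    apply: (@le_lt_trans _ _ (H x - e)); first by rewrite leNgt; apply/negP.
    by rewrite ltrD2l ltrN2 ltr_pdivrMr// mulr2n mulrDr mulr1 ltrDl.
  move=> /inf_lt; case.
    by exists (Hn k x + k%:R * mdist x x); exists k, x.
  by move=> _ [n [y [kn ->]]] lt; exists (n, y).
have [ny nyP] := choice noP.
have uoo : (fun k => (ny k).1) @ \oo --> \oo.
  by apply/cvgnyPge => A; near=> k; apply: leq_trans (nyP k).1; near: k; exact: nbhs_infty_ge.
have yx : (fun k => (ny k).2) @ \oo --> x.
  apply/metricType_numDomainType.cvgrPdist_lt => d d0; near=> k.
  have [_ kP] := nyP k.
  have k0 : (0 < k%:R :> R) by rewrite ltr0n; near: k; exact: nbhs_infty_gt.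
  have : k%:R * mdist x (ny k).2 < H x + 1.
    apply: (@le_lt_trans _ _ (Hn (ny k).1 (ny k).2 + k%:R * mdist x (ny k).2)).
      by rewrite lerDr.
    apply: (lt_trans kP); rewrite ltrD2l (@lt_trans _ _ 0)// oppr_lt0 divr_gt0//.
  rewrite mulrC -ltr_pdivlMr// => /lt_le_trans; apply.
  rewrite ler_pdivrMr// mulrC -ler_pdivrMr//.
  near: k; exact: nbhs_infty_ger.
have := HnH uoo yx => /cvgrPdist_lt /(_ (e / 2)).
rewrite divr_gt0// => /(_ isT)[k _ /(_ k (leqnn _))].
rewrite /= ltNge => /negP; apply.
have [_ kP] := nyP k.
rewrite ger0_norm.
  rewrite lerBrDr addrC -lerBrDr ltW//; apply: le_lt_trans kP.
  by rewrite lerDl mulr_ge0// mdist_ge0.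
rewrite subr_ge0 ltW//; apply: (@le_lt_trans _ _ (Hn (ny k).1 (ny k).2 + k%:R * mdist x (ny k).2)).
  by rewrite lerDl mulr_ge0// mdist_ge0.
by apply: (lt_trans kP); rewrite ltrBlDr ltrDl divr_gt0.
Unshelve. all: by end_near. Qed.

Lemma cvg_measurable : measurable_fun setT (H : borel X -> R).
Proof.
apply: (measurable_fun_cvg (h := fun k => lip_env Hn k : borel X -> R)).
  by move=> k; apply: continuous_borel_measurable; exact: lip_env_continuous.
by move=> x _; exact: lip_env_cvg.
Qed.

End lipschitz_envelope_cvg.

Section vague.
Context {R : realType} {X : completeMetricType R}.
Variable o : X.

Lemma mdist_continuous : continuous (mdist o : X -> R).
Proof.
move=> x; apply/cvgrPdist_lt => e e0.
have : nbhs x (ball x e) by exact: nbhsx_ballx.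
apply: filterS => y; rewrite ballEmdist/= => xy.
rewrite ltr_distl; apply/andP; split.
  rewrite ltrBlDr (le_lt_trans (metric_triangle o x y))// ltrD2l//.
by rewrite (le_lt_trans (metric_triangle o y x))// ltrD2l metric_sym.
Qed.

(** A ramp in the distance from [o]: 0 up to [delta / 2], 1 from [delta] on. It is a continuous
    substitute for the indicator of [far delta]. *)
Definition cutoff (delta : R) (x : X) : R :=
  Num.min 1 (Num.max 0 (2 * mdist o x / delta - 1)).

Lemma cutoff_continuous delta : continuous (cutoff delta).
Proof.
move=> x.
have lin : {for x, continuous (fun y => 2 * mdist o y / delta - 1)}.
  apply: cvgB; last exact: cvg_cst.
  by apply: cvgMl; apply: cvgMr; exact: mdist_continuous.
have max_cont := @continuous_max R X (cst 0) _ x (@cst_continuous _ _ _ _) lin.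
exact: (@continuous_min R X (cst 1) _ x (@cst_continuous _ _ _ _) max_cont).
Qed.

Lemma cutoff_ge0 delta x : 0 <= cutoff delta x.
Proof. by rewrite /cutoff le_min ler01 le_max lexx. Qed.

Lemma cutoff_le1 delta x : cutoff delta x <= 1.
Proof. by rewrite /cutoff ge_min lexx. Qed.

Lemma cutoff_eq1 delta x : 0 < delta -> delta <= mdist o x -> cutoff delta x = 1.
Proof.
move=> d0 dx; apply/min_idPl; rewrite le_max; apply/orP; right.
by rewrite lerBrDr ler_pdivlMr// -natr1 mulrDl !mul1r; nra.
Qed.

Lemma cutoff_eq0 delta x : 0 < delta -> mdist o x < delta / 2 -> cutoff delta x = 0.
Proof.
move=> d0 dx; rewrite /cutoff; have /max_idPl -> : 2 * mdist o x / delta - 1 <= 0.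
  by rewrite lerBlDr add0r ler_pdivrMr// mul1r; lra.
by apply/min_idPr.
Qed.

Definition test_function (E : X -> R) := [/\ continuous E,
  exists M : R, forall y, 0 <= E y <= M &
  exists2 delta : R, 0 < delta & forall y, mdist o y < delta -> E y = 0].

Lemma cutoff_test delta (M : R) : 0 < delta -> 0 <= M ->
  test_function (fun y => M * cutoff delta y).
Proof.
move=> d0 M0; split.
- by move=> x; apply: cvgMr; exact: cutoff_continuous.
- by exists M => y; rewrite mulr_ge0 ?cutoff_ge0//= ler_piMr// cutoff_le1.
- exists (delta / 2); first by rewrite divr_gt0.
  by move=> y yd; rewrite cutoff_eq0// mulr0.
Qed.

Variable m : {measure set (borel X) -> \bar R}.

(** The rate [b] is an arbitrary sequence, not [n], so that the property survives the reindexing of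
    [vague_cvg_sub]. *)
Definition vague_cvg (b : nat -> R) (law : nat -> probability (borel X) R) :=
  [/\ forall j, 0 <= b j, b @ \oo --> +oo &
      forall E, test_function E ->
       ((b j)%:E * \int[law j]_y (E y)%:E)%E @[j --> \oo] --> (\int[m]_y (E y)%:E)%E].

Lemma vague_cvg_sub b law (u : nat -> nat) : u @ \oo --> \oo ->
  vague_cvg b law -> vague_cvg (b \o u) (law \o u).
Proof.
move=> uoo [b0 boo blaw]; split.
- by move=> j; exact: b0.
- exact: (cvg_comp _ _ uoo boo).
- move=> E /blaw c; exact: (cvg_comp _ _ uoo c).
Qed.

Definition far (delta : R) : set (borel X) := [set y | delta <= mdist o (y : X)].

Lemma measurable_far delta : measurable (far delta).
Proof.
rewrite [X in measurable X](_ : _ = (mdist o : borel X -> R) @^-1` `[delta, +oo[%classic).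
  rewrite -[X in measurable X]setTI.
  apply: (continuous_borel_measurable mdist_continuous) => //.
by apply/seteqP; split => y /=; rewrite in_itv/= andbT.
Qed.

Hypothesis m_far : forall delta, 0 < delta -> (m (far delta) < +oo)%E.

Lemma test_measurable E : test_function E -> measurable_fun setT (EFin \o E : borel X -> \bar R).
Proof. by move=> [cE _ _]; apply/measurable_EFinP; exact: continuous_borel_measurable. Qed.

Lemma test_integral_fin E : test_function E -> (\int[m]_y (E y)%:E)%E \is a fin_num.
Proof.
move=> tE; have mE := test_measurable tE; case: tE => [cE [M EM] [delta d0 Ed]].
have M0 : 0 <= M by have /andP[+ ] := EM point; exact: le_trans.
rewrite ge0_fin_numE; last by apply: integral_ge0 => y _; rewrite lee_fin; case/andP: (EM y).
apply: (@le_lt_trans _ _ (\int[m]_y (M%:E * (\1_(far delta) y)%:E))%E).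
  apply: ge0_le_integral => //.
  - by move=> y _; rewrite lee_fin; case/andP: (EM y).
  - apply: measurable_funeM; apply/measurable_EFinP/measurable_indic.
    exact: measurable_far.
  - move=> y _; rewrite -EFinM lee_fin indicE.
    have [yd|yd] := ltP (mdist o y) delta.
      by rewrite Ed// mulr_ge0.
    by rewrite mem_set//= mulr1; case/andP: (EM y).
rewrite ge0_integralZl_EFin//; last first.
  by apply/measurable_EFinP/measurable_indic; exact: measurable_far.
rewrite integral_indic ?setIT//; last exact: measurable_far.
by rewrite lte_mul_pinfty// ?lee_fin ?m_far.
Qed.

Lemma prob_integral_fin (P : probability (borel X) R) (f : X -> R) (M : R) :
  (forall y, 0 <= f y <= M) -> measurable_fun setT (f : borel X -> R) ->
  (0 <= \int[P]_y (f y)%:E <= M%:E)%E /\ (\int[P]_y (f y)%:E)%E \is a fin_num.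
Proof.
move=> fM mf.
have i0 : (0 <= \int[P]_y (f y)%:E)%E.
  by apply: integral_ge0 => y _; rewrite lee_fin; case/andP: (fM y).
have iM : (\int[P]_y (f y)%:E <= M%:E)%E.
  rewrite -[leRHS]mule1 -(@probability_setT _ _ _ P) -integral_cst//.
  apply: ge0_le_integral => //.
  - by move=> y _; rewrite lee_fin; case/andP: (fM y).
  - exact/measurable_EFinP.
  - by move=> y _; rewrite lee_fin; case/andP: (fM y).
rewrite i0 iM; split => //; rewrite ge0_fin_numE//.
by rewrite (le_lt_trans iM)// ltry.
Qed.

End vague.

Section vague_lower_bound.
Context {R : realType} {X : completeMetricType R}.
Variables (o : X) (m : {measure set (borel X) -> \bar R}).
Hypothesis m_far : forall delta, 0 < delta -> (m (far o delta) < +oo)%E.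
Variables (b : nat -> R) (law : nat -> probability (borel X) R).
Hypothesis blaw : vague_cvg o m b law.

Variables (Hn : nat -> X -> R) (H : X -> R).
Hypothesis H0 : forall n x, 0 <= Hn n x.
Hypothesis mHn : forall n, measurable_fun setT (Hn n : borel X -> R).
Hypothesis HnH : continuously_converges Hn H.

Let b0 j : 0 <= b j. Proof. by have [+ _ _] := blaw; exact. Qed.

(** The minorants [lip_env Hn k] are test functions, because [E] forces them to vanish near [o].
    Their [m]-integrals increase to that of [H], so one of them already exceeds [r]; convergence
    applies to this one, and it lies below [Hn j] as soon as [k <= j]. *)
Lemma vague_liminf E r : test_function o E -> (forall n x, Hn n x <= E x) ->
  (r%:E < \int[m]_y (H y)%:E)%E ->
  \forall j \near \oo, (r%:E < (b j)%:E * \int[law j]_y (Hn j y)%:E)%E.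
Proof.
move=> [cE [M EM] [delta d0 Ed]] HE rH.
have mphi k : measurable_fun setT (lip_env Hn k : borel X -> R).
  by apply: continuous_borel_measurable; exact: lip_env_continuous.
have tphi k : test_function o (lip_env Hn k).
  split; first exact: lip_env_continuous.
  - exists M => y; rewrite lip_env_ge0//= (le_trans (lip_env_le H0 y (leqnn k)))//.
    by rewrite (le_trans (HE k y))//; case/andP: (EM y).
  - exists delta => // y yd; apply/eqP; rewrite eq_le lip_env_ge0// andbT.
    by rewrite (le_trans (lip_env_le H0 y (leqnn k)))// (le_trans (HE k y))// Ed.
have HE' : (fun y => (H y)%:E) = (fun y => limn (fun k => (lip_env Hn k y)%:E)).
  apply/funext => y; apply/esym/cvg_lim => //.
  by apply: cvg_EFin; [exact: nearW|exact: lip_env_cvg].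
have cphi : (\int[m]_y (lip_env Hn k y)%:E)%E @[k --> \oo] --> (\int[m]_y (H y)%:E)%E.
  rewrite [X in _ --> integral _ _ X]HE'.
  apply: (cvg_monotone_convergence measurableT (g' := fun k (y : borel X) => (lip_env Hn k y)%:E)).
  - by move=> k; apply/measurable_EFinP.
  - by move=> k y _; rewrite lee_fin lip_env_ge0.
  - by move=> y _ k k' kk'; rewrite lee_fin; exact: lip_env_nd.
have [k rk] : exists k, (r%:E < \int[m]_y (lip_env Hn k y)%:E)%E.
  by have [k _ /(_ k (leqnn k))] := cphi _ (open_ereal_gt' rH); exists k.
have [_ _ /(_ _ (tphi k)) cj] := blaw.
have : \forall j \near \oo, (r%:E < (b j)%:E * \int[law j]_y (lip_env Hn k y)%:E)%E.
  exact: cj _ (open_ereal_gt' rk).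
move=> nr; near=> j; apply: (@lt_le_trans _ _ ((b j)%:E * \int[law j]_y (lip_env Hn k y)%:E)%E).
  by near: j.
rewrite lee_wpmul2l ?lee_fin//; apply: ge0_le_integral => //.
- by move=> y _; rewrite lee_fin lip_env_ge0.
- exact/measurable_EFinP.
- exact/measurable_EFinP.
- move=> y _; rewrite lee_fin lip_env_le//.
  by near: j; exact: nbhs_infty_ge.
Unshelve. all: by end_near. Qed.

End vague_lower_bound.

Section continuous_vague_limits.
Context {R : realType} {X : completeMetricType R}.
Variables (o : X) (m : {measure set (borel X) -> \bar R}).
Hypothesis m_far : forall delta, 0 < delta -> (m (far o delta) < +oo)%E.
Variables (b : nat -> R) (law : nat -> probability (borel X) R).
Hypothesis blaw : vague_cvg o m b law.

Let b0 j : 0 <= b j. Proof. by have [+ _ _] := blaw; exact. Qed.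

Lemma real_squeeze_sum (a c : nat -> R) (A C : R) :
  a j + c j @[j --> \oo] --> A + C ->
  (forall e, 0 < e -> \forall j \near \oo, A - e < a j) ->
  (forall e, 0 < e -> \forall j \near \oo, C - e < c j) ->
  a @ \oo --> A.
Proof.
move=> /cvgrPdist_lt ac Aa Cc; apply/cvgrPdist_lt => e e0.
have e20 : 0 < e / 2 by rewrite divr_gt0.
near=> j; rewrite ltr_distlC.
have h1 : A - e / 2 < a j by near: j; exact: Aa.
have h2 : C - e / 2 < c j by near: j; exact: Cc.
have : `|A + C - (a j + c j)| < e / 2 by near: j; exact: ac.
by rewrite ltr_norml => /andP[h3 h4]; apply/andP; split; lra.
Unshelve. all: by end_near. Qed.

(** The lower bound [vague_liminf] is applied to [Hn] and to [E - Hn]; since their sum [E] has a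
    converging integral, neither part can exceed its lower bound in the limit. *)
Lemma vague_cvg_dominated (Hn : nat -> X -> R) (H : X -> R) E :
  (forall n x, 0 <= Hn n x) ->
  (forall n, measurable_fun setT (Hn n : borel X -> R)) ->
  continuously_converges Hn H ->
  test_function o E -> (forall n x, Hn n x <= E x) ->
  (\int[m]_y (H y)%:E)%E \is a fin_num /\
  b j * fine (\int[law j]_y (Hn j y)%:E)%E @[j --> \oo] --> fine (\int[m]_y (H y)%:E)%E.
Proof.
move=> H0 mHn HnH tE HE.
have HnHx x : Hn n x @[n --> \oo] --> H x.
  by apply: (HnH id (fun=> x)) => //; exact: cvg_cst.
have Hge0 x : 0 <= H x by exact: (cvg_ge0 H0 HnH).
have HlE x : H x <= E x by apply: (cvgr_to_le (@HnHx x)); exact: nearW.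
have mE := test_measurable tE; have mER := mE; move/measurable_EFinP in mER.
have mH := cvg_measurable H0 HnH.
have fE := test_integral_fin m_far tE.
have iH0 : (0 <= \int[m]_y (H y)%:E)%E by apply: integral_ge0 => y _; rewrite lee_fin.
have [cE [M EM] [delta d0 Ed]] := tE.
have HEint : (\int[m]_y (H y)%:E + \int[m]_y (E y - H y)%:E = \int[m]_y (E y)%:E)%E.
  rewrite -ge0_integralD//.
  - by apply: eq_integral => y _; rewrite -EFinD addrC subrK.
  - by move=> y _; rewrite lee_fin.
  - exact/measurable_EFinP.
  - by move=> y _; rewrite lee_fin subr_ge0.
  - by apply/measurable_EFinP; exact: measurable_funB.
have iEH0 : (0 <= \int[m]_y (E y - H y)%:E)%E.
  by apply: integral_ge0 => y _; rewrite lee_fin subr_ge0.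
have fH : (\int[m]_y (H y)%:E)%E \is a fin_num.
  rewrite ge0_fin_numE//; apply: le_lt_trans (_ : \int[m]_y (E y)%:E < +oo)%E.
    by rewrite -HEint leeDl.
  by rewrite ltey_eq fE.
have fEH : (\int[m]_y (E y - H y)%:E)%E \is a fin_num.
  rewrite ge0_fin_numE//; apply: le_lt_trans (_ : \int[m]_y (E y)%:E < +oo)%E.
    by rewrite -HEint leeDr.
  by rewrite ltey_eq fE.
have EH0 n x : 0 <= E x - Hn n x by rewrite subr_ge0.
have mEH n : measurable_fun setT (fun y : borel X => E y - Hn n y).
  exact: measurable_funB.
have EHle n x : E x - Hn n x <= E x by rewrite lerBlDr lerDl.
have EHcvg : continuously_converges (fun n x => E x - Hn n x) (fun x => E x - H x).
  move=> u y_ y uoo yy; apply: cvgB; last exact: HnH.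
  exact: (cvg_comp _ _ yy (cE y)).
have finH j : (\int[law j]_y (Hn j y)%:E)%E \is a fin_num.
  apply: (prob_integral_fin (M := M) (law j) _ (mHn j)).2 => y.
  by rewrite H0/= (le_trans (HE j y))//; case/andP: (EM y).
have finEH j : (\int[law j]_y (E y - Hn j y)%:E)%E \is a fin_num.
  apply: (prob_integral_fin (M := M) (law j) _ (mEH j)).2 => y.
  by rewrite EH0/= (le_trans (EHle j y))//; case/andP: (EM y).
split => //.
apply: (@real_squeeze_sum _ (fun j => b j * fine (\int[law j]_y (E y - Hn j y)%:E)%E)
   _ (fine (\int[m]_y (E y - H y)%:E)%E)).
- have [_ _ /(_ _ tE)] := blaw.
  rewrite -fineD// HEint -{1}(fineK fE) => /fine_cvgP[_].
  apply: cvg_trans; apply: near_eq_cvg; apply: nearW => j /=.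
  rewrite -mulrDr -fineD// -ge0_integralD//.
  + rewrite fineM//; first by congr (_ * fine _); apply: eq_integral => y _; rewrite -EFinD addrC subrK.
    exact: (prob_integral_fin (law j) EM mER).2.
  + by move=> y _; rewrite lee_fin.
  + exact/measurable_EFinP.
  + by move=> y _; rewrite lee_fin.
  + exact/measurable_EFinP.
- move=> e e0; have := @vague_liminf _ _ _ _ _ _ blaw _ _ H0 mHn HnH E (fine (\int[m]_y (H y)%:E)%E - e) tE HE.
  rewrite EFinB fineK// lteBlDr// lteDl// lte_fin => /(_ e0).
  by apply: filterS => j; rewrite -(fineK (finH j)) -EFinM -[X in (X - _)%E](fineK fH) -EFinB lte_fin.
- move=> e e0; have := @vague_liminf _ _ _ _ _ _ blaw _ _ EH0 mEH EHcvg E (fine (\int[m]_y (E y - H y)%:E)%E - e) tE EHle.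
  rewrite EFinB fineK// lteBlDr// lteDl// lte_fin => /(_ e0).
  by apply: filterS => j; rewrite -(fineK (finEH j)) -EFinM -[X in (X - _)%E](fineK fEH) -EFinB lte_fin.
Qed.

(** [cutoff] is a test function above the indicator of the far set, and a convergent sequence is
    bounded. The bound holds for all [j], not just eventually, and so can serve in a dominating
    function. *)
Lemma far_mass_bound delta : 0 < delta ->
  exists2 C : R, 0 <= C & forall j, b j * fine (law j (far o delta)) <= C.
Proof.
move=> d0; have tE := cutoff_test o d0 ler01.
have mE := test_measurable tE; move/measurable_EFinP in mE.
have E01 y : 0 <= 1 * cutoff o delta y <= 1 by rewrite mul1r cutoff_ge0 cutoff_le1.
have finE j := (prob_integral_fin (law j) E01 mE).2.
have [_ _ /(_ _ tE)] := blaw.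
rewrite -(fineK (test_integral_fin m_far tE)) => /fine_cvgP[_ /= c].
have /cvg_seq_bounded : cvgn (fun j => fine ((b j)%:E * \int[law j]_y (1 * cutoff o delta y)%:E)%E).
  by apply/cvg_ex; eexists; exact: c.
move=> /pinfty_ex_gt0[C C0 bC]; exists C; first exact: ltW.
move=> j; apply: le_trans (bC j I); apply: le_trans (ler_norm _).
have mfar := measurable_far o delta.
rewrite fineM//= ler_wpM2l// fine_le//; first by apply: fin_num_measure.
rewrite -[X in law j X]setIT -[leLHS]integral_indic//.
apply: ge0_le_integral => //.
- by apply/measurable_EFinP/measurable_indic.
- exact/measurable_EFinP.
- move=> y _; rewrite lee_fin mul1r indicE.
  case: (boolP (y \in _)) => [/set_mem yd|_]; last exact: cutoff_ge0.
  by rewrite cutoff_eq1.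
Qed.

Lemma far_mass_cvg0 delta : 0 < delta ->
  fine (law j (far o delta)) @[j --> \oo] --> 0.
Proof.
move=> d0; have [C C0 bC] := far_mass_bound d0.
have [_ boo _] := blaw.
apply/cvgrPdist_lt => e e0; near=> j.
rewrite sub0r normrN ger0_norm ?fine_ge0//.
have bj : (C + 1) / e <= b j by near: j; move/cvgryPge : boo; exact.
have bj0 : 0 < b j by rewrite (lt_le_trans _ bj)// divr_gt0// ltr_wpDl.
rewrite -(ltr_pM2l bj0); apply: (le_lt_trans (bC j)).
rewrite (@lt_le_trans _ _ (C + 1))// ?ltrDl// -ler_pdivrMr//.
Unshelve. all: by end_near. Qed.

(** The far mass tends to 0 because [b] times it stays bounded, and continuous convergence is
    uniform on a small enough ball around [o]. *)
Lemma cvg_concentrated (Hn : nat -> X -> R) (H : X -> R) (M : R) :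
  (forall n x, 0 <= Hn n x <= M) ->
  (forall n, measurable_fun setT (Hn n : borel X -> R)) ->
  continuously_converges Hn H ->
  fine (\int[law j]_y (Hn j y)%:E)%E @[j --> \oo] --> H o.
Proof.
move=> HM mHn HnH.
have H0 n x : 0 <= Hn n x by case/andP: (HM n x).
have HMx n x : Hn n x <= M by case/andP: (HM n x).
have M0 : 0 <= M by exact: le_trans (H0 0%N o) (HMx _ _).
(* Local uniformity at [o]: otherwise, for each [k], some index at least [k] and some point within
   [1 / (k + 1)] of [o] violate the bound, against continuous convergence along these choices. *)
have near_o e : 0 < e -> exists2 delta, 0 < delta & \forall n \near \oo, forall y,
    mdist o y < delta -> `|H o - Hn n y| < e.
  move=> e0; apply: contrapT => /forall2NP noP.
  have {}noP (k : nat) : exists ny : nat * X, (k <= ny.1)%N /\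
      mdist o ny.2 < k.+1%:R^-1 /\ e <= `|H o - Hn ny.1 ny.2|.
    have [|] := noP (k.+1%:R^-1); first by rewrite invr_gt0.
    apply: contra_notP => /forallNP no; exists k => // n /= kn y yk.
    by rewrite ltNge; apply/negP => ?; apply: (no (n, y)).
  have [ny nyP] := choice noP.
  have uoo : (fun k => (ny k).1) @ \oo --> \oo.
    by apply/cvgnyPge => A; near=> k; apply: leq_trans (nyP k).1; near: k; exact: nbhs_infty_ge.
  have yo : (fun k => (ny k).2) @ \oo --> o.
    apply/metricType_numDomainType.cvgrPdist_lt => d d0; near=> k.
    have [_ [kP _]] := nyP k; apply: (lt_trans kP).
    by near: k; exact: near_infty_natSinv_lt (PosNum d0).
  have := HnH _ _ _ uoo yo => /cvgrPdist_lt /(_ _ e0)[k _ /(_ k (leqnn _))]/=.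
  by rewrite ltNge; have [_ [_ ->]] := nyP k.
have mfar := measurable_far o.
have mind delta j : measurable_fun setT (\1_(far o delta) : borel X -> R).
  exact: measurable_indic.
have HoM : 0 <= H o <= M.
  have c : Hn n o @[n --> \oo] --> H o by apply: (HnH id (fun=> o)) => //; exact: cvg_cst.
  by rewrite (cvgr_to_ge c) ?(cvgr_to_le c)//; exact: nearW.
apply/cvgrPdist_le => e e0.
have e30 : 0 < e / 2 by rewrite divr_gt0.
have [delta d0 nd] := near_o _ e30.
(* With this threshold the far set contributes at most [e / 2]; the divisor [M + 1] is positive even
   if [M = 0]. *)
have c1 : \forall j \near \oo, `|0 - fine (law j (far o delta))| < e / 2 / (M + 1).
  by have /cvgrPdist_lt := far_mass_cvg0 d0; apply; rewrite divr_gt0 ?ltr_wpDl.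
near=> j.
have close y : mdist o y < delta -> `|H o - Hn j y| < e / 2.
  by move: y; near: j; exact: nd.
have pj : (M + 1) * fine (law j (far o delta)) <= e / 2.
  rewrite mulrC -ler_pdivlMr ?ltr_wpDl// ltW//.
  have : `|0 - fine (law j (far o delta))| < e / 2 / (M + 1) by near: j; exact: c1.
  by rewrite sub0r normrN ger0_norm// fine_ge0.
have [_ finj] := prob_integral_fin (law j) (HM j) (mHn j).
have ifar : (\int[law j]_y ((M + 1) * \1_(far o delta) (y : borel X))%:E =
   ((M + 1) * fine (law j (far o delta)))%:E)%E.
  under eq_integral do rewrite EFinM.
  rewrite ge0_integralZl_EFin//.
  - rewrite integral_indic// setIT EFinM fineK//; exact: fin_num_measure.
  - by apply/measurable_EFinP.
  - by rewrite addr_ge0.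
have cstint r : (\int[law j]_y r%:E = r%:E)%E.
  rewrite integral_cst// [X in (_ * X)%E](_ : _ = 1%E) ?mule1//.
  exact: probability_setT.
have mf1 : measurable_fun setT (fun y : borel X => ((M + 1) * \1_(far o delta) y)%:E : \bar R).
  by apply/measurable_EFinP; apply: measurable_funM.
have mHj : measurable_fun setT (fun y : borel X => (Hn j y)%:E : \bar R).
  exact/measurable_EFinP.
(* Two one-sided bounds instead of an absolute value, so that only nonnegative functions are
   integrated. On the far set they hold because both values lie between 0 and [M]. *)
have pointwise y : H o <= Hn j y + (e / 2 + (M + 1) * \1_(far o delta) (y : borel X)) /\
    Hn j y <= (H o + e / 2) + (M + 1) * \1_(far o delta) (y : borel X).
  rewrite indicE; have [yd|yd] := ltP (mdist o y) delta.
    have /ltW := close y yd; rewrite ler_norml => /andP[h1 h2].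
    by case: (_ \in _); rewrite ?mulr1 ?mulr0; split; lra.
  have -> : ((y : borel X) \in far o delta) = true by rewrite mem_set.
  have := HM j y; move: HoM => /andP[h1 h2] /andP[h3 h4]; rewrite mulr1; split; lra.
have fe r : (0 <= r)%R -> (\int[law j]_y (r%:E + ((M + 1) * \1_(far o delta) (y : borel X))%:E) =
    (r + (M + 1) * fine (law j (far o delta)))%:E)%E.
  move=> r0; rewrite ge0_integralD//; first by rewrite cstint ifar EFinD.
  by move=> y _; rewrite lee_fin mulr_ge0// addr_ge0.
have ind_ge0 y : 0 <= (M + 1) * \1_(far o delta) (y : borel X).
  by rewrite mulr_ge0// addr_ge0.
rewrite ler_distl; apply/andP; split.
- rewrite lerBlDr; apply: (@le_trans _ _ (H o + e / 2 + (M + 1) * fine (law j (far o delta)))); last by lra.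
  rewrite -lee_fin fineK// -fe; last by lra.
  apply: ge0_le_integral => //.
  + by move=> y _; rewrite lee_fin.
  + by apply/measurable_EFinP; apply: measurable_funD => //; exact: measurable_funM.
  + by move=> y _; rewrite -EFinD lee_fin; have [_] := pointwise y.
- apply: (@le_trans _ _ (fine (\int[law j]_y (Hn j y)%:E)%E + (e / 2 + (M + 1) * fine (law j (far o delta))))); last by lra.
  rewrite -lee_fin EFinD fineK// -fe; last by lra.
  rewrite -ge0_integralD//; last 3 first.
  + by move=> y _; rewrite lee_fin.
  + by move=> y _; rewrite -EFinD lee_fin addr_ge0// ltW.
  + by apply/measurable_EFinP; apply: measurable_funD => //; exact: measurable_funM.
  rewrite -(cstint (H o)); apply: ge0_le_integral => //.
  + by move=> y _; rewrite lee_fin; case/andP: HoM.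
  + apply/measurable_EFinP; apply: measurable_funD => //.
    by apply: measurable_funD => //; exact: measurable_funM.
  + by move=> y _; rewrite -!EFinD lee_fin; have [+ _] := pointwise y.
Unshelve. all: by end_near. Qed.

End continuous_vague_limits.

(** * Iterated integrals of concentrating laws *)

Section real_iterated.
Context {R : realType} {X : completeMetricType R}.
Variable P : probability (borel X) R.

Definition riter (n : nat) (G : seq X -> R) : R :=
  fine (iter_integral P setT n (fun ys => (G ys)%:E)).

Lemma riter_bounds n (G : seq X -> R) (M : R) : (forall ys, 0 <= G ys <= M) ->
  plot_measurable n (fun _ : unit => G) ->
  [/\ (riter n G)%:E = iter_integral P setT n (fun ys => (G ys)%:E),
      0 <= riter n G & riter n G <= M].
Proof.
move=> GM mG.
have G0 ys : (0 <= (G ys)%:E)%E by rewrite lee_fin; case/andP: (GM ys).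
have M0 : 0 <= M by have /andP[+ ] := GM [::]; exact: le_trans.
have mGE : plot_measurable n (fun (_ : unit) ys => (G ys)%:E : \bar R).
  by apply: plot_measurable_post mG; apply/measurable_EFinP.
have ge0 : (0 <= iter_integral P setT n (fun ys => (G ys)%:E))%E.
  exact: iter_integral_ge0.
have cstM k : iter_integral P setT k (fun=> M%:E) = M%:E.
  elim: k => [|k IH] //=; rewrite IH integral_cst// [X in (_ * X)%E](_ : _ = 1%E) ?mule1//.
  exact: probability_setT.
have leM : (iter_integral P setT n (fun ys => (G ys)%:E) <= M%:E)%E.
  rewrite -(cstM n).
  apply: (@le_iter_integral _ _ P _ unit n (fun _ ys => (G ys)%:E) (fun _ _ => M%:E) tt) => //.
  by move=> _ ys _; rewrite lee_fin; case/andP: (GM ys).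
have fin : iter_integral P setT n (fun ys => (G ys)%:E) \is a fin_num.
  by rewrite ge0_fin_numE// (le_lt_trans leM)// ltry.
by rewrite /riter fineK//; split => //; rewrite -lee_fin fineK.
Qed.

Lemma plot_measurable_tail n (G : seq X -> R) (y : X) :
  plot_measurable n.+1 (fun _ : unit => G) ->
  plot_measurable n (fun _ : unit => fun ys => G (y :: ys)).
Proof.
move=> /plot_measurable_cons mG; apply: (plot_measurable_comp (q := fun=> (tt, y : borel X)) _ mG).
exact: measurable_cst.
Qed.

Lemma measurable_riter_tail n (G : seq X -> R) (M : R) : (forall ys, 0 <= G ys <= M) ->
  plot_measurable n.+1 (fun _ : unit => G) ->
  measurable_fun setT (fun y : borel X => riter n (fun ys => G ((y : X) :: ys))).
Proof.
move=> GM mG; apply/measurable_EFinP.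
rewrite (_ : EFin \o _ = fun y : borel X => iter_integral P setT n (fun ys => (G ((y : X) :: ys))%:E)).
  apply: (@measurable_iter_section _ _ P _ unit n (fun _ ys => (G ys)%:E) tt).
    by move=> _ ys; rewrite lee_fin; case/andP: (GM ys).
  by apply: plot_measurable_post mG; apply/measurable_EFinP.
apply/funext => y /=.
by have [] := @riter_bounds n (fun ys => G ((y : X) :: ys)) M (fun ys => GM _) (plot_measurable_tail _ mG).
Qed.

Lemma riterS n (G : seq X -> R) (M : R) : (forall ys, 0 <= G ys <= M) ->
  plot_measurable n.+1 (fun _ : unit => G) ->
  riter n.+1 G = fine (\int[P]_y (riter n (fun ys => G ((y : X) :: ys)))%:E)%E.
Proof.
move=> GM mG; rewrite {1}/riter /=; congr fine; apply: eq_integral => y _.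
by have [] := @riter_bounds n (fun ys => G ((y : X) :: ys)) M (fun ys => GM _) (plot_measurable_tail _ mG).
Qed.

Variables (o : X) (delta : R).

Definition vanishes_below (K n : nat) (G : seq X -> R) :=
  forall ys, size ys = n ->
    (count (fun y : X => (delta <= mdist o y)%R) ys < K)%N -> G ys = 0.

Lemma riter_le K n (G : seq X -> R) (M : R) : (forall ys, 0 <= G ys <= M) ->
  plot_measurable n (fun _ : unit => G) -> vanishes_below K n G ->
  riter n G <= M * 'C(n, K)%:R * fine (P (far o delta)) ^+ K.
Proof.
elim: n K G => [|n IH] K G GM mG vG.
  case: K vG => [|K] vG.
    by rewrite expr0 !mulr1 /riter/=; case/andP: (GM [::]).
  by rewrite bin0n mulr0 mul0r /riter/= vG.
have M0 : 0 <= M by have /andP[+ ] := GM [::]; exact: le_trans.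
case: K vG => [|K] vG.
  by rewrite bin0 expr0 !mulr1; have [] := riter_bounds GM mG.
set p := fine _; have p0 : 0 <= p by exact: fine_ge0.
have mfar := measurable_far o delta.
rewrite (riterS GM mG).
(* [c1] bounds the tail integral when the first entry is far, so that [K] far entries remain to be
   found; [c2] bounds it when the first entry is near and [K.+1] remain. *)
pose c1 := M * 'C(n, K)%:R * p ^+ K; pose c2 := M * 'C(n, K.+1)%:R * p ^+ K.+1.
have c10 : 0 <= c1 by rewrite !mulr_ge0// exprn_ge0.
have c20 : 0 <= c2 by rewrite !mulr_ge0// exprn_ge0.
have -> : M * 'C(n.+1, K.+1)%:R * p ^+ K.+1 = c2 + c1 * p.
  by rewrite binS natrD /c1 /c2 exprS; ring.
have -> : c2 + c1 * p = fine (\int[P]_y (c2%:E + (c1 * \1_(far o delta) y)%:E))%E.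
  rewrite ge0_integralD//; last 2 first.
  - by move=> y _; rewrite lee_fin mulr_ge0.
  - by apply/measurable_EFinP; exact: measurable_funM.
  rewrite integral_cst// [X in (_ * X)%E](_ : _ = 1%E); last exact: probability_setT.
  rewrite mule1; under eq_integral do rewrite EFinM.
  rewrite ge0_integralZl_EFin//; last by apply/measurable_EFinP.
  have fp : P (far o delta) = p%:E by rewrite fineK//; exact: fin_num_measure.
  by rewrite integral_indic// setIT [X in (_ * X)%E](_ : _ = p%:E)// -EFinM -EFinD.
have GyM y ys : 0 <= G (y :: ys) <= M by exact: GM.
have mGy y := plot_measurable_tail y mG.
have ry y := riter_bounds (GyM y) (mGy y).
have mr := measurable_riter_tail GM mG.
have r0 y : 0 <= riter n (fun ys => G (y :: ys)) by case: (ry y).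
have m1 : measurable_fun setT (fun y : borel X => c2 + c1 * \1_(far o delta) y).
  by apply: measurable_funD => //; exact: measurable_funM.
apply: fine_le.
- by apply: (prob_integral_fin (M := M) P _ mr).2 => y; rewrite r0; case: (ry y).
- under eq_integral do rewrite -EFinD.
  apply: (prob_integral_fin (M := c2 + c1) P _ m1).2 => y.
  by rewrite indicE; case: (_ \in _); rewrite /= ?mulr1 ?mulr0; lra.
- apply: ge0_le_integral => //.
  + by move=> y _; rewrite lee_fin.
  + exact/measurable_EFinP.
  + exact/measurable_EFinP.
  + move=> y _; rewrite -EFinD lee_fin indicE.
    have [yd|yd] := ltP (mdist o y) delta.
      apply: (@le_trans _ _ c2); last by rewrite lerDl; exact: mulr_ge0.
      apply: IH => // ys sys c; apply: vG => /=; first by rewrite sys.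
      by rewrite leNgt yd.
    rewrite mem_set//= mulr1; apply: (@le_trans _ _ c1); last by rewrite lerDr.
    apply: IH => // ys sys c; apply: vG => /=; first by rewrite sys.
    by rewrite yd add1n ltnS.
Qed.

End real_iterated.

(** Coordinatewise convergence at a fixed length stands in for a topology on [seq X]. *)
Definition seq_continuously_converges (R : realType) (X : completeMetricType R)
    (n : nat) (Gn : nat -> seq X -> R) (g : seq X -> R) :=
  forall (u : nat -> nat) (ys_ : nat -> seq X) ys, u @ \oo --> \oo ->
    (forall j, size (ys_ j) = n) -> size ys = n ->
    (forall i, (i < n)%N -> nth point (ys_ j) i @[j --> \oo] --> nth point ys i) ->
    Gn (u j) (ys_ j) @[j --> \oo] --> g ys.

(** The limit of [b j ^+ K] times the [n]-fold integral of [g] against the law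
    [law j], when [b j * law j] converges to [m] away from [o] and [g] vanishes if
    fewer than [K] entries are away from [o]: [K] entries are integrated against
    [m] and the others are equal to [o]. *)
Fixpoint lim_iter (R : realType) (X : completeMetricType R)
    (m : set (borel X) -> \bar R) (o : X) (K n : nat) (g : seq X -> R) : \bar R :=
  match n, K with
  | 0%N, 0%N => (g [::])%:E
  | 0%N, _.+1 => 0%E
  | n'.+1, 0%N => lim_iter m o 0 n' (fun ys => g (o :: ys))
  | n'.+1, K'.+1 => (\int[m]_x lim_iter m o K' n' (fun ys => g (x :: ys)) +
                     lim_iter m o K n' (fun ys => g (o :: ys)))%E
  end.

(** * Induction on the number of coordinates *)

Section limit_theorem.
Context {R : realType} {X : completeMetricType R}.
Variables (o : X) (m : {measure set (borel X) -> \bar R}).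
Hypothesis m_far : forall delta, 0 < delta -> (m (far o delta) < +oo)%E.
Variables (delta M : R).
Hypothesis d0 : 0 < delta.

(** The properties of an integrand that persist when its first entry is frozen along a convergent
    sequence; [delta] and [M] stay the same throughout the induction. *)
Definition admissible K n (Gn : nat -> seq X -> R) (g : seq X -> R) :=
  [/\ forall j ys, 0 <= Gn j ys <= M,
      forall j, vanishes_below o delta K n (Gn j),
      forall j, plot_measurable n (fun _ : unit => Gn j) &
      seq_continuously_converges n Gn g].

Lemma admissible_tail K n Gn g (u : nat -> nat) (y_ : nat -> X) (y : X) :
  u @ \oo --> \oo -> y_ @ \oo --> y ->
  admissible K n.+1 Gn g ->
  admissible K.-1 n (fun j ys => Gn (u j) (y_ j :: ys)) (fun ys => g (y :: ys)).
Proof.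
move=> uoo yy [GM vG mG cG]; split.
- by move=> j ys; exact: GM.
- move=> j ys sys; case: K vG => //= K vG c; apply: vG => /=; first by rewrite sys.
  by case: (_ <= _)%R; rewrite ?add1n ?add0n ?ltnS// ltnW.
- by move=> j; exact: plot_measurable_tail.
- move=> v ys_ ys voo sys_ sys cys; apply: cG.
  + exact: (cvg_comp _ _ voo uoo).
  + by move=> j /=; rewrite sys_.
  + by rewrite /= sys.
  + by move=> [_|i] /=; [exact: (cvg_comp _ _ voo yy)|rewrite ltnS; exact: cys].
Qed.

(** The factor [1 - cutoff] is zero for heads at distance at least [delta]. The surviving heads are
    not far, so all [K] far entries must lie in the tail and [K] does not drop. *)
Lemma damped_tail K n (G : seq X -> R) y : (forall ys, 0 <= G ys <= M) ->
  vanishes_below o delta K n.+1 G -> plot_measurable n.+1 (fun _ : unit => G) ->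
  [/\ forall ys, 0 <= (1 - cutoff o delta y) * G (y :: ys) <= M,
    vanishes_below o delta K n (fun ys => (1 - cutoff o delta y) * G (y :: ys)) &
    plot_measurable n (fun _ : unit => fun ys => (1 - cutoff o delta y) * G (y :: ys))].
Proof.
move=> GM vG mG; have c01 z : 0 <= 1 - cutoff o delta z <= 1.
  by rewrite subr_ge0 cutoff_le1 lerBlDr lerDl cutoff_ge0.
split.
- move=> ys; have := c01 y; have := GM (y :: ys).
  by move=> /andP[? ?] /andP[? ?]; rewrite mulr_ge0//= -[leRHS]mul1r ler_pM.
- move=> ys sys c; have [yd|yd] := leP delta (mdist o y).
    by rewrite cutoff_eq1// subrr mul0r.
  rewrite vG ?mulr0//=; first by rewrite sys.
  by rewrite leNgt yd add0n.
- have mt := plot_measurable_tail y mG.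
  apply: (plot_measurable_post (g := fun r => (1 - cutoff o delta y) * r)) mt.
  exact: measurable_funM.
Qed.

Lemma admissible_damped_tail K n Gn g (u : nat -> nat) (y_ : nat -> X) (y : X) :
  u @ \oo --> \oo -> y_ @ \oo --> y ->
  admissible K n.+1 Gn g ->
  admissible K n (fun j ys => (1 - cutoff o delta (y_ j)) * Gn (u j) (y_ j :: ys))
    (fun ys => (1 - cutoff o delta y) * g (y :: ys)).
Proof.
move=> uoo yy [GM vG mG cG].
have c01 z : 0 <= 1 - cutoff o delta z <= 1.
  by rewrite subr_ge0 cutoff_le1 lerBlDr lerDl cutoff_ge0.
have damp j := damped_tail (y_ j) (GM (u j)) (vG (u j)) (mG (u j)).
split; try by move=> j; case: (damp j).
- move=> v ys_ ys voo sys_ sys cys; apply: cvgM.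
    apply: cvgB; first exact: cvg_cst.
    have := cvg_comp _ _ voo yy.
    by move=> /cvg_comp; apply; exact: cutoff_continuous.
  apply: cG.
  + exact: (cvg_comp _ _ voo uoo).
  + by move=> j /=; rewrite sys_.
  + by rewrite /= sys.
  + by move=> [_|i] /=; [exact: (cvg_comp _ _ voo yy)|rewrite ltnS; exact: cys].
Qed.

Let M0 K n Gn g : admissible K n Gn g -> 0 <= M.
Proof. by move=> [GM _ _ _]; have /andP[+ ] := GM 0%N [::]; exact: le_trans. Qed.

(** Multiplying [riter_le] by [bj ^+ K] pairs each factor of far mass with one [bj], which leaves a
    bound independent of the law. *)
Lemma scaled_riter_bound (bj Cf : R) (P : probability (borel X) R) K n G :
  0 <= M -> 0 <= bj -> bj * fine (P (far o delta)) <= Cf ->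
  (forall ys, 0 <= G ys <= M) -> plot_measurable n (fun _ : unit => G) ->
  vanishes_below o delta K n G ->
  0 <= bj ^+ K * riter P n G <= M * 'C(n, K)%:R * Cf ^+ K.
Proof.
move=> M_ge0 bj0 bC GM mG vG.
have [_ r0 _] := riter_bounds P GM mG.
have p0 : 0 <= fine (P (far o delta)) by exact: fine_ge0.
rewrite mulr_ge0 ?exprn_ge0//=.
apply: (@le_trans _ _ (bj ^+ K * (M * 'C(n, K)%:R * fine (P (far o delta)) ^+ K))).
  by rewrite ler_wpM2l ?exprn_ge0//; exact: riter_le.
rewrite mulrCA -exprMn ler_wpM2l ?mulr_ge0// lerXn2r// nnegrE ?mulr_ge0//.
by rewrite (le_trans _ bC)// mulr_ge0.
Qed.

Lemma riterZ (P : probability (borel X) R) n G c : 0 <= c ->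
  (forall ys, 0 <= G ys <= M) -> plot_measurable n (fun _ : unit => G) ->
  riter P n (fun ys => c * G ys) = c * riter P n G.
Proof.
move=> c0 GM mG; have [rE _ _] := riter_bounds P GM mG.
rewrite {1}/riter; under eq_fun do rewrite EFinM.
rewrite (@iter_integralZ _ _ P _ unit n (fun _ ys => (G ys)%:E) tt c c0).
- by rewrite -rE -EFinM.
- by move=> _ ys; rewrite lee_fin; case/andP: (GM ys).
- by apply: plot_measurable_post mG; apply/measurable_EFinP.
Qed.

Lemma fine_integral_lin (P : probability (borel X) R) (f g : X -> R) (A B c : R) :
  0 <= c -> (forall y, 0 <= f y <= A) -> (forall y, 0 <= g y <= B) ->
  measurable_fun setT (f : borel X -> R) -> measurable_fun setT (g : borel X -> R) ->
  fine (\int[P]_y (c * f y + g y)%:E)%E =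
  c * fine (\int[P]_y (f y)%:E)%E + fine (\int[P]_y (g y)%:E)%E.
Proof.
move=> c0 fA gB mf mg.
have [_ ff] := prob_integral_fin P fA mf; have [_ fg] := prob_integral_fin P gB mg.
have f0 y : 0 <= f y by case/andP: (fA y).
have g0 y : 0 <= g y by case/andP: (gB y).
under eq_integral do rewrite EFinD EFinM.
rewrite ge0_integralD//.
- rewrite ge0_integralZl_EFin//.
  + by rewrite fineD ?fin_numM// fineM.
  + by move=> y _; rewrite lee_fin.
  + exact/measurable_EFinP.
- by move=> y _; rewrite -EFinM lee_fin mulr_ge0.
- by apply: measurable_funeM; exact/measurable_EFinP.
- by move=> y _; rewrite lee_fin.
- exact/measurable_EFinP.
Qed.

(** For [K = 0] the tail integrals converge continuously by induction and the first entry
    concentrates at [o]. For [K.+1] the first entry is split by [psi] and [1 - psi]: the first part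
    carries a factor [b j] and has a vague limit with [K] far entries left, giving the [m]-integral;
    the second keeps [K.+1] for the tail and is evaluated at [o], where [psi] is 0. *)
Lemma riter_cvg K n Gn g b law : vague_cvg o m b law -> admissible K n Gn g ->
  lim_iter m o K n g \is a fin_num /\
  b j ^+ K * riter (law j) n (Gn j) @[j --> \oo] --> fine (lim_iter m o K n g).
Proof.
elim: n K Gn g b law => [|n IH] K Gn g b law blaw adm.
  have [GM vG mG cG] := adm.
  case: K vG adm => [|K] vG adm /=.
    split => //; rewrite /riter/=; under eq_fun do rewrite mul1r.
    by apply: (cG id (fun=> [::]) [::]).
  split => //; under eq_fun do rewrite /riter/= vG// mulr0.
  exact: cvg_cst.
have M_ge0 := M0 adm.
have [GM vG mG cG] := adm.
have [b0 boo _] := blaw.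
have mtail j := measurable_riter_tail (law j) (GM j) (mG j).
(* The induction hypothesis for the reindexed laws, with a moving head: this is the continuous
   convergence of the inner integrals. *)
have IHtail u y_ y : u @ \oo --> \oo -> y_ @ \oo --> y ->
    lim_iter m o K.-1 n (fun ys => g (y :: ys)) \is a fin_num /\
    b (u j) ^+ K.-1 * riter (law (u j)) n (fun ys => Gn (u j) (y_ j :: ys)) @[j --> \oo] -->
    fine (lim_iter m o K.-1 n (fun ys => g (y :: ys))).
  move=> uoo yy.
  exact: (IH _ _ _ _ _ (vague_cvg_sub uoo blaw) (admissible_tail uoo yy adm)).
have GyM j y ys : 0 <= Gn j (y :: ys) <= M by exact: GM.
have mGy j y := plot_measurable_tail y (mG j).
have fin_lim y : lim_iter m o K.-1 n (fun ys => g (y :: ys)) \is a fin_num.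
  by have [] := IHtail id (fun=> y) y (@cvg_id _ _) (cvg_cst _).
case: K adm vG IHtail fin_lim => [|K] adm vG IHtail fin_lim.
  split; first exact: fin_lim.
  under eq_fun do rewrite mul1r (riterS _ (GM _) (mG _)).
  apply: (@cvg_concentrated _ _ o m m_far b law blaw
    (fun j y => riter (law j) n (fun ys => Gn j (y :: ys)))
    (fun y => fine (lim_iter m o 0 n (fun ys => g (y :: ys)))) M).
  - by move=> j y; have [_ -> ->] := riter_bounds (law j) (GyM j y) (mGy j y).
  - exact: mtail.
  - move=> u y_ y uoo yy; have [_] := IHtail _ _ _ uoo yy.
    by under eq_fun do rewrite mul1r.
rewrite /= in IHtail fin_lim.
pose psi := cutoff o delta.
have psi0 y : 0 <= psi y by exact: cutoff_ge0.
have psi1 y : 0 <= 1 - psi y by rewrite subr_ge0 cutoff_le1.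
have mpsi : measurable_fun setT (psi : borel X -> R).
  by apply: continuous_borel_measurable; exact: cutoff_continuous.
have [Cf Cf0 bCf] := far_mass_bound m_far blaw d0.
pose r j y := riter (law j) n (fun ys => Gn j (y :: ys)).
(* In [H1] one factor [b j] is held back for the vague limit in the first coordinate; in [H2] all
   [K.+1] factors are absorbed by the tail. *)
pose H1 j y := psi y * (b j ^+ K * r j y).
pose H2 j y := b j ^+ K.+1 * ((1 - psi y) * r j y).
pose CB := M * 'C(n, K)%:R * Cf ^+ K.
pose CB' := M * 'C(n, K.+1)%:R * Cf ^+ K.+1.
have CB0 : 0 <= CB by rewrite !mulr_ge0// exprn_ge0.
have vtail j y : vanishes_below o delta K n (fun ys => Gn j (y :: ys)).
  move=> ys sys c; apply: vG => /=; first by rewrite sys.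
  by case: (_ <= _)%R; rewrite ?add1n ?add0n ?ltnS// ltnW.
have rB j y : 0 <= b j ^+ K * r j y <= CB.
  exact: (scaled_riter_bound M_ge0 (b0 j) (bCf j) (GyM j y) (mGy j y) (vtail j y)).
have mH1 j : measurable_fun setT (H1 j : borel X -> R).
  by apply: measurable_funM => //; apply: measurable_funM => //; exact: mtail.
have mH2 j : measurable_fun setT (H2 j : borel X -> R).
  apply: measurable_funM => //; apply: measurable_funM; last exact: mtail.
  exact: measurable_funB.
have H1E j y : 0 <= H1 j y <= CB * psi y.
  have /andP[h1 h2] := rB j y; rewrite /H1 (mulrC CB) mulr_ge0//=; exact: ler_wpM2l.
have H2E j y : H2 j y = b j ^+ K.+1 * riter (law j) n (fun ys => (1 - psi y) * Gn j (y :: ys)).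
  by rewrite riterZ.
have IHdamp u y_ y : u @ \oo --> \oo -> y_ @ \oo --> y ->
    lim_iter m o K.+1 n (fun ys => (1 - psi y) * g (y :: ys)) \is a fin_num /\
    H2 (u j) (y_ j) @[j --> \oo] -->
    fine (lim_iter m o K.+1 n (fun ys => (1 - psi y) * g (y :: ys))).
  move=> uoo yy.
  have [? c] := IH _ _ _ _ _ (vague_cvg_sub uoo blaw) (admissible_damped_tail uoo yy adm).
  by split => //; rewrite (_ : (fun j => _) = (fun j => H2 (u j) (y_ j))) in c => //;
    apply/funext => j; rewrite H2E.
have H2B j y : 0 <= H2 j y <= CB'.
  have [Dm Dv Dp] := damped_tail y (GM j) (vG j) (mG j).
  by rewrite H2E; exact: (scaled_riter_bound M_ge0 (b0 j) (bCf j) Dm Dp Dv).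
have psio : psi o = 0 by rewrite /psi cutoff_eq0// mdistxx divr_gt0.
have cvg2 := cvg_concentrated m_far blaw H2B mH2 (fun u y_ y uoo yy => (IHdamp u y_ y uoo yy).2).
have fin2 := (IHdamp id (fun=> o) o (@cvg_id _ _) (cvg_cst _)).1.
have gE : (fun ys => (1 - psi o) * g (o :: ys)) = (fun ys => g (o :: ys)).
  by apply/funext => ys; rewrite psio subr0 mul1r.
rewrite /= gE in cvg2 fin2.
pose H1lim y := psi y * fine (lim_iter m o K n (fun ys => g (y :: ys))).
have H1cvg : continuously_converges H1 H1lim.
  move=> u y_ y uoo yy; apply: cvgM; last exact: (IHtail _ _ _ uoo yy).2.
  exact: (cvg_comp _ _ yy (@cutoff_continuous _ _ o delta y)).
have [fin1 cvg1] := vague_cvg_dominated m_far blaw (fun j y => (andP (H1E j y)).1) mH1 H1cvg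
  (cutoff_test o d0 CB0) (fun j y => (andP (H1E j y)).2).
(* [psi] disappears from the limit. Where it is not 1 the head is closer than [delta], the tail
   needs [K.+1] far entries, and the tail integral scaled by only [b j ^+ K] is at most [CB' / b j],
   which tends to 0. *)
have lim1 x : (H1lim x)%:E = lim_iter m o K n (fun ys => g (x :: ys)).
  rewrite -[RHS]fineK//; congr EFin; rewrite /H1lim /psi.
  have [xd|xd] := leP delta (mdist o x); first by rewrite cutoff_eq1// mul1r.
  suff -> : fine (lim_iter m o K n (fun ys => g (x :: ys))) = 0 by rewrite mulr0.
  have [_ c] := IHtail id (fun=> x) x (@cvg_id _ _) (cvg_cst _).
  have vx j : vanishes_below o delta K.+1 n (fun ys => Gn j (x :: ys)).
    move=> ys sys cnt; apply: vG => /=; first by rewrite sys.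
    by rewrite leNgt xd add0n.
  have rx j := scaled_riter_bound M_ge0 (b0 j) (bCf j) (GyM j x) (mGy j x) (vx j).
  apply/eqP; rewrite eq_le; apply/andP; split; last first.
    by apply: (cvgr_to_ge c); apply: nearW => j; case/andP: (rB j x).
  apply/ler_addgt0Pl => e e0; rewrite addr0; apply: (cvgr_to_le c).
  have CB'0 : 0 <= CB' by case/andP: (H2B 0%N o); exact: le_trans.
  near=> j.
  have bj : (CB' + 1) / e <= b j by near: j; move/cvgryPge : boo; exact.
  have bj0 : 0 < b j by rewrite (lt_le_trans _ bj)// divr_gt0// ltr_wpDl.
  rewrite -(ler_pM2l bj0) mulrA -exprS.
  have /andP[_ /le_trans] := rx j; apply.
  by rewrite (@le_trans _ _ (CB' + 1))// ?lerDl// -ler_pdivrMr.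
have int1 : (\int[m]_x (H1lim x)%:E = \int[m]_x lim_iter m o K n (fun ys => g (x :: ys)))%E.
  by apply: eq_integral => x _; exact: lim1.
rewrite /= -int1; split; first by rewrite fin_numD fin1 fin2.
suff decomp j : b j ^+ K.+1 * riter (law j) n.+1 (Gn j) =
    b j * fine (\int[law j]_y (H1 j y)%:E)%E + fine (\int[law j]_y (H2 j y)%:E)%E.
  have c : b j ^+ K.+1 * riter (law j) n.+1 (Gn j) @[j --> \oo] -->
      fine (\int[m]_x (H1lim x)%:E)%E + fine (lim_iter m o K.+1 n (fun ys => g (o :: ys))).
    by under eq_fun do rewrite decomp; exact: cvgD cvg1 cvg2.
  by rewrite fineD//; exact: fin2.
rewrite -[RHS](fine_integral_lin (law j) (b0 j) (A := CB) _ (H2B j) (mH1 j) (mH2 j)); last first.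
  move=> y; have /andP[-> /=] := H1E j y => /le_trans; apply.
  by rewrite ler_piMr// cutoff_le1.
rewrite (riterS _ (GM _) (mG _)).
have -> : (fun y => (b j * H1 j y + H2 j y)%:E) = (fun y => (b j ^+ K.+1 * r j y)%:E).
  by apply/funext => y; congr EFin; rewrite /H1 /H2 exprS; ring.
under [in RHS]eq_integral do rewrite EFinM.
rewrite ge0_integralZl_EFin ?exprn_ge0// ?fineM//.
- apply: (prob_integral_fin (M := M) (law j) _ (mtail j)).2 => y.
  by have [_ -> ->] := riter_bounds (law j) (GyM j y) (mGy j y).
- by move=> y _; rewrite lee_fin; have [_ -> _] := riter_bounds (law j) (GyM j y) (mGy j y).
- by apply/measurable_EFinP; exact: mtail.
Unshelve. all: by end_near. Qed.

End limit_theorem.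

(** * The distance between point measures *)

Section le_integral_nonneg.
Import HBNNSimple.

(** The integral of a nonnegative function is a supremum over the simple functions below it, so
    monotonicity holds without measurability. The integrand defining [rho] is compared in this
    way. *)
Lemma le_integral_nonneg d (T : measurableType d) (R : realType)
    (mu : {measure set T -> \bar R}) (D : set T) (f g : T -> \bar R) :
  (forall x, D x -> 0 <= f x)%E -> (forall x, D x -> f x <= g x)%E ->
  (\int[mu]_(x in D) f x <= \int[mu]_(x in D) g x)%E.
Proof.
move=> f0 fg.
rewrite !ge0_integralE//; last by move=> x Dx; exact: le_trans (f0 x Dx) (fg x Dx).
apply: ereal_sup_le => _ [h hf <-]; exists h => //= x.
apply: (le_trans (hf x)); rewrite /patch; case: ifPn => // /set_mem; exact: fg.
Qed.

End le_integral_nonneg.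

Lemma integral_expRN (R : realType) :
  (\int[lebesgue_measure]_(r in `[0%R, +oo[) (expR (- r))%:E = 1 :> \bar R)%E.
Proof.
rewrite integral_mkcond -[RHS](@integral_exponential_pdf R 1 ltr01).
apply: eq_integral => x _; rewrite /exponential_pdf !patchE.
by case: ifP => // _; rewrite mul1r mulN1r.
Qed.

Section point_measures.
Context {R : realType} {S : ptopologicalType}.
Variables (d : S -> S -> R) (F : set S).

Lemma sum_dirac_count (zs : seq S) (A : set (borel S)) :
  sum_dirac F zs A = (count (fun z => (z \notin F) && (z \in (A : set S))) zs)%:R%:E :> \bar R.
Proof.
rewrite /sum_dirac; elim: zs => [|z zs IH]; first by rewrite big_nil.
rewrite big_cons IH /= natrD EFinD; case: (z \notin F) => /=; last by rewrite add0e.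
by rewrite diracE.
Qed.

Lemma pm_eq (p q : pointMeasure d F) : (forall A, p A = q A) -> p = q.
Proof.
case: p q => [p pP] [q qP] /= /funext pq; move: pP qP; rewrite pq => pP qP.
by congr PointMeasure; exact: Prop_irrelevance.
Qed.

Lemma pm_of_seq_perm (zs zs' : seq S) : perm_eq zs zs' ->
  pm_of_seq d F zs = pm_of_seq d F zs'.
Proof.
move=> zz'; apply: pm_eq => A /=; rewrite !sum_dirac_count.
by rewrite (permP zz').
Qed.

Lemma pm_of_seq_skip (pre post : seq S) (z : S) : F z ->
  pm_of_seq d F (pre ++ z :: post) = pm_of_seq d F (pre ++ post).
Proof.
move=> Fz; apply: pm_eq => A /=; rewrite !sum_dirac_count !count_cat /=.
by rewrite mem_set.
Qed.

Lemma prohorov_ge0 (D : set S) (m1 m2 : set (borel S) -> \bar R) :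
  0 <= prohorov d D m1 m2.
Proof.
rewrite /prohorov; set E := [set _ | _].
(* If no radius qualifies, the infimum is that of the empty set, which is 0 by convention. *)
have [->|/set0P E0] := eqVneq E set0; first by rewrite inf0.
by apply: lb_le_inf => // e [/ltW].
Qed.

Lemma prohorov_le (D : set S) (m1 m2 : set (borel S) -> \bar R) e : 0 < e ->
  (forall A : set (borel S), measurable A -> A `<=` D ->
      (m1 A <= m2 (fattening d A e `&` D) + e%:E)%E /\
      (m2 A <= m1 (fattening d A e `&` D) + e%:E)%E) ->
  prohorov d D m1 m2 <= e.
Proof.
by move=> e0 He; apply: ge_inf => //; exists 0 => r [/ltW].
Qed.

Let rho_integrand (m1 m2 : set (borel S) -> \bar R) r :=
  Num.min (prohorov d (~` fattening d F r) m1 m2) 1 * expR (- r).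

Let rho_integrand_ge0 m1 m2 r : 0 <= rho_integrand m1 m2 r.
Proof. by rewrite mulr_ge0 ?expR_ge0// le_min prohorov_ge0 ler01. Qed.

Let rho_integral_le1 m1 m2 :
  (\int[lebesgue_measure]_(r in `[0%R, +oo[) (rho_integrand m1 m2 r)%:E <= 1 :> \bar R)%E.
Proof.
rewrite -(integral_expRN R); apply: le_integral_nonneg => r _; rewrite lee_fin//.
by rewrite ler_piMl ?expR_ge0// ge_min lexx orbT.
Qed.

Let rho_integral_ge0 m1 m2 :
  (0 <= \int[lebesgue_measure]_(r in `[0%R, +oo[) (rho_integrand m1 m2 r)%:E :> \bar R)%E.
Proof. by apply: integral_ge0 => r _; rewrite lee_fin. Qed.

Lemma rho_EFin m1 m2 : (rho d F m1 m2)%:E =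
  (\int[lebesgue_measure]_(r in `[0%R, +oo[)
     (Num.min (prohorov d (~` fattening d F r) m1 m2) 1 * expR (- r))%:E)%E.
Proof.
rewrite /rho /Rintegral fineK// ge0_fin_numE; last exact: rho_integral_ge0.
by rewrite (le_lt_trans (rho_integral_le1 _ _))// ltry.
Qed.

(** Radii outside [B] contribute at most [e] in total, since the exponential weight has mass 1; on
    [B] the truncated integrand is at most 1 and contributes at most the length of [B]. *)
Lemma rho_le m1 m2 (B : set R) e c : measurable B -> 0 <= e ->
  (lebesgue_measure B <= c%:E)%E ->
  (forall r, 0 <= r -> ~ B r -> prohorov d (~` fattening d F r) m1 m2 <= e) ->
  rho d F m1 m2 <= e + c.
Proof.
move=> mB e0 Bc He; rewrite -lee_fin rho_EFin.
apply: (@le_trans _ _ (\int[lebesgue_measure]_(r in `[0%R, +oo[)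
    (e%:E * (expR (- r))%:E + (\1_B r)%:E))%E).
  apply: le_integral_nonneg => [r _|r /=]; first by rewrite lee_fin; exact: rho_integrand_ge0.
  rewrite in_itv/= andbT => r0; rewrite -EFinM -EFinD lee_fin.
  have er0 := expR_ge0 (- r).
  rewrite indicE; have [Br|Br] := pselect (B r).
    rewrite mem_set//= -[leLHS]add0r lerD ?mulr_ge0//.
    apply: (@le_trans _ _ (1 * 1)); last by rewrite mulr1.
    apply: ler_pM => //; first by rewrite le_min prohorov_ge0 ler01.
      by rewrite ge_min lexx orbT.
    by rewrite expR_le1 oppr_le0.
  rewrite memNset//= addr0 ler_wpM2r// ge_min; apply/orP; left; exact: He.
rewrite ge0_integralD//; last 3 first.
- by move=> r _; rewrite -EFinM lee_fin mulr_ge0// expR_ge0.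
- apply: measurable_funeM; apply/measurable_EFinP.
  by apply: measurable_funTS; apply: measurableT_comp.
- by apply/measurable_EFinP; exact: measurable_indic.
rewrite ge0_integralZl_EFin//; last first.
  by apply/measurable_EFinP; apply: measurable_funTS; apply: measurableT_comp.
rewrite integral_expRN mule1 EFinD leeD2l// integral_indic//.
apply: le_trans Bc; apply: le_measure; rewrite ?inE//.
exact: measurableI.
Qed.

End point_measures.

Section marked_point_measures.
Context {R : realType} {T X : completeMetricType R}.
Variable s : scaling X.
Notation o := (origin s).
Notation d := (@dE R T X).
Notation F := (axis (T := T) s).
Notation pm := (pm_of_seq d F).

Lemma axisP (z : T * X) : F z <-> z.2 = o.
Proof. by split => [[_]//|zo]; split. Qed.

Lemma fattening_axis r (z : T * X) : fattening d F r z <-> mdist o z.2 < r.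
Proof.
split=> [[[t x] /axisP/= ->]|zr].
  by apply: le_lt_trans; rewrite /dE/= metric_sym lerDr mdist_ge0.
by exists (z.1, o); [exact/axisP|rewrite /dE/= mdistxx add0r metric_sym].
Qed.

Lemma not_fattening_axis r (z : T * X) : (~` fattening d F r) z <-> r <= mdist o z.2.
Proof.
by rewrite leNgt; split => [h|/negP h]; [apply/negP => /fattening_axis|move=> /fattening_axis].
Qed.

Definition bigger (delta : R) (z : T * X) : bool := delta <= mdist o z.2.

(** For radii above [delta] both measures have the same restriction, so only the interval from 0 to
    [delta] contributes: [rho_le] is used with [e = 0] and [c = delta]. *)
Lemma pm_dist_filter (zs : seq (T * X)) delta : 0 < delta ->
  pm_dist (pm zs) (pm [seq z <- zs | bigger delta z]) <= delta.
Proof.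
move=> d0; rewrite -[leRHS]add0r; apply: (@rho_le _ _ _ _ _ _ `[0, delta]%classic) => //.
  by rewrite lebesgue_measure_itv/= lte_fin d0 -EFinD subr0.
move=> r r0 /= /negP; rewrite in_itv/= r0/= -ltNge => dr.
apply/ler_addgt0Pl => e e0; rewrite addr0; apply: prohorov_le => // A mA AD.
have AE : (pm zs) A = (pm [seq z <- zs | bigger delta z]) A.
  rewrite /= !sum_dirac_count count_filter; congr (_%:R%:E).
  apply: eq_count => z /=; have [zA|] := boolP (z \in (A : set (T * X))); last by rewrite !andbF.
  have /AD/not_fattening_axis/(le_trans (ltW dr)) := set_mem zA.
  by rewrite /bigger => ->; rewrite !andbT.
have sub : A `<=` fattening d A e `&` ~` fattening d F r.
  by move=> z Az; split; [exists z; rewrite // /dE !mdistxx addr0|exact: AD].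
have mono zs' : (pm zs' A <= pm zs' (fattening d A e `&` ~` fattening d F r) + e%:E)%E.
  apply: (@le_trans _ _ (pm zs' (fattening d A e `&` ~` fattening d F r))); last first.
    by rewrite leeDl// lee_fin ltW.
  rewrite /= !sum_dirac_count lee_fin ler_nat; apply: sub_count => z /= /andP[-> zA].
  by apply/mem_set/sub; exact: set_mem zA.
split.
  by have := mono [seq z <- zs | bigger delta z]; rewrite -AE.
by have := mono zs; rewrite AE.
Qed.

Lemma at_most_size (zs : seq (T * X)) k : (size zs <= k)%N -> at_most k (pm zs).
Proof.
move=> zk; rewrite /at_most/= sum_dirac_count lee_fin ler_nat.
by rewrite (leq_trans (count_size _ _)).
Qed.

Lemma pm_near_at_most (zs : seq (T * X)) k delta r : 0 < delta < r ->
  (count (bigger delta) zs <= k)%N -> fattening (@pm_dist R _ d F) (at_most k) r (pm zs).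
Proof.
move=> /andP[d0 dr] c; exists (pm [seq z <- zs | bigger delta z]).
  by apply: at_most_size; rewrite size_filter.
exact: le_lt_trans (pm_dist_filter _ d0) dr.
Qed.

(** The exceptional radii [B] are those within [eta] of 0 or of the distance of some point of [zs]
    from the axis. For any other radius, corresponding points are both kept or both removed, and
    matching them gives Prohorov distance at most [eta]. The length of [B] is at most [eta] plus
    [2 eta] for each point. *)
Lemma pm_dist_close (n : nat) (zs zs' : seq (T * X)) eta : 0 < eta ->
  size zs = n -> size zs' = n ->
  (forall i, (i < n)%N -> d (nth point zs i) (nth point zs' i) < eta) ->
  pm_dist (pm zs) (pm zs') <= eta + (eta + (eta * 2) *+ n).
Proof.
move=> eta0 sz sz' zz'.
pose D i := mdist o (nth point zs i).2.
pose J i : set R := `[D i - eta, D i + eta]%classic.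
pose U : set R := \big[setU/set0]_(i < n) J i.
pose B := `[0, eta]%classic `|` U.
have mU : measurable U by apply: bigsetU_measurable => i _; exact: measurable_itv.
apply: (@rho_le _ _ _ _ _ _ B) => //.
- exact: measurableU.
- exact: ltW.
- apply: (@le_trans _ _ (lebesgue_measure `[0%R, eta]%classic + lebesgue_measure U)%E).
    exact: measureU2.
  rewrite EFinD; apply: leeD.
    by rewrite lebesgue_measure_itv/= lte_fin eta0 -EFinD subr0.
  apply: (@le_trans _ _ (\sum_(i < n) lebesgue_measure (J i))%E).
    by apply: (@Boole_inequality _ _ _ lebesgue_measure J n) => i _; exact: measurable_itv.
  rewrite (eq_bigr (fun=> (eta * 2)%:E)).
    by rewrite sumEFin sumr_const card_ord.
  move=> i _; rewrite /J lebesgue_measure_itv/= lte_fin ifT; last by lra.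
  by rewrite -EFinD; congr EFin; ring.
move=> r r0 nB; apply: prohorov_le => // A mA AD.
(* The interval from 0 to [eta] in [B] excludes [r = 0]; for positive [r], a point outside the
   [r]-fattening is off the axis and is counted by [sum_dirac]. *)
have rpos : 0 < r.
  rewrite ltNge; apply/negP => rle0; apply: nB; left => /=; rewrite in_itv/= r0.
  by rewrite (le_trans rle0)// ltW.
have same i : (i < n)%N ->
    (r <= mdist o (nth point zs i).2) = (r <= mdist o (nth point zs' i).2).
  move=> ilt; have nBi : ~ (D i - eta <= r <= D i + eta).
    move=> h; apply: nB; right; rewrite /U -bigcup_mkord; exists i => //.
  have dx : mdist (nth point zs i).2 (nth point zs' i).2 < eta.
    by apply: le_lt_trans (zz' i ilt); rewrite /dE lerDr mdist_ge0.
  have t1 := metric_triangle o (nth point zs i).2 (nth point zs' i).2.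
  have t2 := metric_triangle o (nth point zs' i).2 (nth point zs i).2.
  rewrite [mdist (nth point zs' i).2 _]metric_sym in t2.
  apply/idP/idP => h; rewrite leNgt; apply/negP => h'; apply: nBi; rewrite /D; apply/andP; split; lra.
have notF (z : T * X) : r <= mdist o z.2 -> z \notin F.
  move=> rz; rewrite notin_setE => /axisP zo.
  by move: rz; rewrite zo mdistxx leNgt rpos.
have count_le (ws ws' : seq (T * X)) : size ws = n -> size ws' = n ->
    (forall i, (i < n)%N -> d (nth point ws' i) (nth point ws i) < eta) ->
    (forall i, (i < n)%N ->
      (r <= mdist o (nth point ws i).2) = (r <= mdist o (nth point ws' i).2)) ->
    (pm ws A <= pm ws' (fattening d A eta `&` ~` fattening d F r) + eta%:E)%E.
  move=> sw sw' ww' sm.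
  apply: (@le_trans _ _ (pm ws' (fattening d A eta `&` ~` fattening d F r))); last first.
    by rewrite leeDl// lee_fin ltW.
  rewrite /= !sum_dirac_count lee_fin ler_nat.
  rewrite -[ws](mkseq_nth point) -[ws'](mkseq_nth point) sw sw' /mkseq !count_map.
  (* Positions are compared rather than points, because repeated points count with multiplicity. *)
  rewrite -!size_filter; apply: uniq_leq_size; first by rewrite filter_uniq// iota_uniq.
  move=> i; rewrite !mem_filter mem_iota add0n /= => /andP[/andP[_ zA] ilt].
  have Ai := set_mem zA.
  rewrite ilt andbT.
  have rw : r <= mdist o (nth point ws' i).2 by rewrite -sm//; exact/not_fattening_axis/AD.
  rewrite notF//=; apply/mem_set; split; last exact/not_fattening_axis.
  by exists (nth point ws i) => //; exact: ww'.
split; apply: count_le => // i ilt.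
- by rewrite /dE (metric_sym (_.1)) (metric_sym (_.2)); exact: zz'.
- by rewrite same.
Qed.

End marked_point_measures.

Lemma filter_forall_lt (I : Type) (G : set_system I) (P : nat -> I -> Prop) n :
  Filter G -> (forall i, (i < n)%N -> \forall j \near G, P i j) ->
  \forall j \near G, forall i, (i < n)%N -> P i j.
Proof.
move=> FG; elim: n => [|n IH] GP; first exact: nearW.
have h1 : \forall j \near G, P n j by exact: GP.
have h2 : \forall j \near G, forall i, (i < n)%N -> P i j.
  by apply: IH => i ilt; apply: GP; exact: ltnW.
near=> j => i; rewrite ltnS leq_eqVlt => /predU1P[->|ilt]; first by near: j.
by move: i ilt; near: j.
Unshelve. all: by end_near. Qed.

Lemma separable_dense_seq (R : realType) (S : completeMetricType R) :
  separable_space S ->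
  exists c : nat -> S, forall x e, 0 < e -> exists k, mdist x (c k) < e.
Proof.
move=> [D cD dD].
have /pfcard_geP[D0|[f]] := cD.
  have [x []] := dD setT (ex_intro _ point I) openT.
  by rewrite D0.
exists f => x e e0.
have [y [xy Dy]] : ball x e `&` D !=set0.
  have [y [By Dy]] := dD _ (ex_intro _ x (nbhsx_ballx x e e0)) (open_interior (ball x e)).
  by exists y; split => //; exact: interior_subset.
have [k _ fk] := 'surj_f Dy.
by exists k; rewrite fk; move: xy; rewrite ballEmdist.
Qed.

(** * Continuity and measurability of a point measure as a function of its atoms *)

Section pm_topology.
Context {R : realType} {T X : completeMetricType R}.
Variable s : scaling X.
Notation o := (origin s).
Notation d := (@dE R T X).
Notation F := (axis (T := T) s).
Notation pm := (pm_of_seq d F).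

(** Turns the metric bound of [pm_dist_close] into a statement on open sets; both [pm_cvg] and
    [measurable_pm] are derived from it. *)
Lemma pm_open_close (U : set (pointMeasureE T s)) n (zs : seq (T * X)) : size zs = n ->
  open U -> U (pm zs) ->
  exists2 eta, 0 < eta & forall zs', size zs' = n ->
    (forall i, (i < n)%N -> mdist (nth point zs i).1 (nth point zs' i).1 < eta /\
       mdist (nth point zs i).2 (nth point zs' i).2 < eta) -> U (pm zs').
Proof.
move=> sz oU Uz; have [e e0 eU] : exists2 e : R, 0 < e & forall q, pm_dist (pm zs) q < e -> U q.
  exact: (oU (pm zs) Uz).
(* [pm_dist_close] costs [eta * (2 n + 2)], strictly less than [e = eta * (2 n + 4)]. Each of the
   two components is allowed [eta / 2], since [dE] adds them. *)
pose eta := e / (n.+2.*2)%:R.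
have eta0 : 0 < eta by rewrite divr_gt0.
exists (eta / 2); first by rewrite divr_gt0.
move=> zs' sz' zz'; apply: eU.
apply: (@le_lt_trans _ _ (eta + (eta + (eta * 2) *+ n))).
  apply: pm_dist_close => // i ilt; rewrite /dE.
  have [h1 h2] := zz' i ilt; rewrite (splitr eta); exact: ltrD.
have -> : e = eta * (n.+2.*2)%:R by rewrite /eta divfK// pnatr_eq0.
have -> : eta + (eta + (eta * 2) *+ n) = eta * (2 + 2 * n%:R) by rewrite -mulr_natr; ring.
rewrite ltr_pM2l// -muln2 natrM -addn2 natrD.
have : (0 <= n%:R :> R) by [].
lra.
Qed.

Lemma pm_cvg (f : pointMeasureE T s -> R) n (zs_ : nat -> seq (T * X)) zs :
  continuous f -> (forall j, size (zs_ j) = n) -> size zs = n ->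
  (forall i, (i < n)%N -> (nth point (zs_ j) i).1 @[j --> \oo] --> (nth point zs i).1) ->
  (forall i, (i < n)%N -> (nth point (zs_ j) i).2 @[j --> \oo] --> (nth point zs i).2) ->
  f (pm (zs_ j)) @[j --> \oo] --> f (pm zs).
Proof.
move=> cf sz_ sz c1 c2.
suff c : pm (zs_ j) @[j --> \oo] --> pm zs by exact: (cvg_comp _ _ c (cf _)).
move=> A; rewrite nbhsE => -[U [oU Uz] UA].
have [eta eta0 etaU] := pm_open_close sz oU Uz.
have n1 : \forall j \near \oo, forall i, (i < n)%N ->
    mdist (nth point zs i).1 (nth point (zs_ j) i).1 < eta.
  apply: filter_forall_lt => i ilt.
  exact: (metricType_numDomainType.cvgr_dist_lt (c1 i ilt)).
have n2 : \forall j \near \oo, forall i, (i < n)%N ->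
    mdist (nth point zs i).2 (nth point (zs_ j) i).2 < eta.
  apply: filter_forall_lt => i ilt.
  exact: (metricType_numDomainType.cvgr_dist_lt (c2 i ilt)).
have : \forall j \near \oo, A (pm (zs_ j)); last by [].
near=> j; apply: UA; apply: (etaU (zs_ j) (sz_ j)) => i ilt; split.
  by move: i ilt; near: j.
by move: i ilt; near: j.
Unshelve. all: by end_near. Qed.

(** By separability the preimage of an open set is a countable union of boxes centred at points of
    dense sequences with radii [1 / (q + 1)]: those boxes all of whose configurations fall in the
    open set. *)
Lemma measurable_pm (sepT : separable_space T) (sepX : separable_space X)
    d' (Z : measurableType d') n (u : nat -> Z -> borel T) (v : nat -> Z -> borel X) :
  (forall i, measurable_fun setT (u i)) -> (forall i, measurable_fun setT (v i)) ->
  measurable_fun setT (fun z => pm (mkseq (fun i => (u i z : T, v i z : X)) n)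
    : borel (pointMeasureE T s)).
Proof.
move=> mu mv.
have [cT cTP] := separable_dense_seq sepT.
have [cX cXP] := separable_dense_seq sepX.
have mE : @measurable _ (borel (pointMeasureE T s)) = <<s @open (pointMeasureE T s) >> by [].
apply: (measurability _ mE) => _ [U oU <-]; rewrite setTI.
pose near_code (l : seq (nat * nat)) (q : nat) (z : nat -> T * X) := forall i, (i < n)%N ->
  mdist (cT (nth (0%N, 0%N) l i).1) (z i).1 < q.+1%:R^-1 /\
  mdist (cX (nth (0%N, 0%N) l i).2) (z i).2 < q.+1%:R^-1.
pose good l q := forall z : nat -> T * X, near_code l q z -> U (pm (mkseq z n)).
pose box l q := [set z | near_code l q (fun i => (u i z : T, v i z : X))].
have -> : (fun z => pm (mkseq (fun i => (u i z : T, v i z : X)) n)) @^-1` U =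
    \bigcup_k (if unpickle k is Some (l, q) then
      (if pselect (good l q) then box l q else set0) else set0).
  apply/seteqP; split => z /=; last first.
    move=> [k _]; case: (unpickle k) => // -[l q].
    by case: pselect => // g; exact: g.
  move=> Uz; have [eta eta0 etaU] := pm_open_close (size_mkseq _ _) oU Uz.
  (* Two configurations in the same box are compared through its centre, so a radius below [eta / 2]
     keeps them within [eta]. *)
  have [q qeta] : exists q : nat, q.+1%:R^-1 < eta / 2.
    have e2 : 0 < eta / 2 by rewrite divr_gt0.
    by have [q _ /(_ q (leqnn _))] := near_infty_natSinv_lt (PosNum e2); exists q.
  have q0 : 0 < (q.+1%:R^-1 : R) by rewrite invr_gt0.
  have [kT kTP] := choice (fun i => cTP (u i z : T) _ q0).
  have [kX kXP] := choice (fun i => cXP (v i z : X) _ q0).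
  pose l := mkseq (fun i => (kT i, kX i)) n.
  have lz : near_code l q (fun i => (u i z : T, v i z : X)).
    by move=> i ilt; rewrite nth_mkseq//= metric_sym (metric_sym (cX _)).
  exists (pickle (l, q)) => //; rewrite pickleK.
  case: pselect => // ng; exfalso; apply: ng => w wl; apply: etaU; first by rewrite size_mkseq.
  move=> i ilt; rewrite !nth_mkseq//=.
  have [h1 h2] := lz i ilt; have [h3 h4] := wl i ilt.
  have t1 := metric_triangle (u i z : T) (cT (nth (0%N, 0%N) l i).1) (w i).1.
  have t2 := metric_triangle (v i z : X) (cX (nth (0%N, 0%N) l i).2) (w i).2.
  have h1' : mdist (u i z : T) (cT (nth (0%N, 0%N) l i).1) < q.+1%:R^-1 by rewrite metric_sym.
  have h2' : mdist (v i z : X) (cX (nth (0%N, 0%N) l i).2) < q.+1%:R^-1 by rewrite metric_sym.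
  split; [apply: (le_lt_trans t1)|apply: (le_lt_trans t2)]; rewrite (splitr eta);
    apply: ltrD; exact: lt_trans qeta.
apply: bigcupT_measurable => k; case: (unpickle k) => [[l q]|]; last exact: measurable0.
case: (pselect (good l q)) => [g|ng] /=; last exact: measurable0.
have mball (S : completeMetricType R) (w : Z -> borel S) (c : S) (e : R) : measurable_fun setT w ->
    measurable [set z | mdist c (w z : S) < e].
  move=> mw; rewrite (_ : [set z | _] = setT `&` w @^-1` [set x | mdist c (x : S) < e]); last by rewrite setTI.
  apply: mw => //; apply: sub_sigma_algebra.
  have -> : [set x : S | mdist c x < e] = mdist c @^-1` [set r | r < e] by [].
  by apply: open_comp; [move=> x _; exact: mdist_continuous|exact: open_lt].
have -> : box l q = \bigcap_(i in [set i | (i < n)%N])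
    ([set z | mdist (cT (nth (0%N, 0%N) l i).1) (u i z : T) < q.+1%:R^-1] `&`
     [set z | mdist (cX (nth (0%N, 0%N) l i).2) (v i z : X) < q.+1%:R^-1]).
  by apply/seteqP; split => z h i /=; exact: h.
apply: fin_bigcap_measurable; first exact: finite_II.
by move=> i _; apply: measurableI; exact: mball.
Qed.

End pm_topology.

Lemma sume_seq1 (R : realType) (I : Type) (l : seq I) :
  (\sum_(i <- l) 1 = (size l)%:R%:E :> \bar R)%E.
Proof.
by elim: l => [|i l IH]; rewrite ?big_nil ?big_cons//= IH -EFinD -nat1r.
Qed.

Lemma pm_mono (R : realType) (S : ptopologicalType) (d : S -> S -> R) (F : set S)
    (p : pointMeasure d F) (A B : set (borel S)) :
  A `<=` B -> (p A <= p B)%E.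
Proof.
have [_ [I [z [_ pE]]]] := pm_funP p => AB.
rewrite !pE; apply: le_esum => i _; rewrite !diracE lee_fin ler_nat.
by case: (boolP (z i \in A)) => // /set_mem/AB ?; rewrite mem_set.
Qed.

(** * Independent families *)

Lemma iter_integral_box (R : realType) (X : completeMetricType R)
    (nu : {sigma_finite_measure set (borel X) -> \bar R}) n (A : nat -> set (borel X)) :
  (forall i, measurable (A i)) -> (forall i, (nu (A i) < +oo)%E) ->
  iter_integral nu setT n (fun xs => (\prod_(i < n) \1_(A i) (nth point xs i : borel X))%:E) =
  (\prod_(i < n) nu (A i))%E.
Proof.
elim: n A => [|n IH] A mA finA; first by rewrite /= !big_ord0.
have mprod k (B : nat -> set (borel X)) : (forall i, measurable (B i)) ->
    plot_measurable k (fun (_ : unit) xs => (\prod_(i < k) \1_(B i) (nth point xs i : borel X))%:E : \bar R).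
  move=> mB d' Z' p v mp mv; apply/measurable_EFinP; apply: measurable_prod => i _.
  apply: (measurableT_comp (measurable_indic (mB i))).
  rewrite (_ : (fun z => _) = v i)//; apply/funext => z.
  by rewrite nth_mkseq.
rewrite /= big_ord_recl.
have -> : (\int[nu]_y iter_integral nu setT n
    (fun xs => (\prod_(i < n.+1) \1_(A i) (nth point ((y : X) :: xs) i : borel X))%:E) =
    \int[nu]_y ((\1_(A 0%N) y)%:E * \prod_(i < n) nu (A i.+1)))%E.
  apply: eq_integral => y _; rewrite -(IH (fun i => A i.+1))//.
  rewrite -(@iter_integralZ _ _ nu _ unit n (fun _ xs => (\prod_(i < n) \1_(A i.+1) (nth point xs i : borel X))%:E) tt)//.
  - by congr iter_integral; apply/funext => xs; rewrite big_ord_recl EFinM.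
  - by move=> _ xs; rewrite lee_fin; apply: prodr_ge0.
  - by apply: (mprod n (fun i => A i.+1)) => i; exact: mA.
have pfin : (\prod_(i < n) nu (A i.+1))%E \is a fin_num.
  by apply: prode_fin_num => i _; rewrite ge0_fin_numE.
have p0 : (0 <= \prod_(i < n) nu (A i.+1))%E by apply: prode_ge0.
rewrite -(fineK pfin); under eq_integral do rewrite muleC.
rewrite ge0_integralZl_EFin//.
- by rewrite integral_indic// setIT muleC.
- by apply/measurable_EFinP/measurable_indic.
- exact: fine_ge0.
Qed.

Section iid_law.
Context {R : realType} {X : completeMetricType R}.
Context {d : measure_display} {Omega : measurableType d} (P : probability Omega R).
Variables (x : nat -> Omega -> X) (nu : probability (borel X) R).
Hypothesis x_iid : iid P x nu.

(** Passes to the product sigma-algebra of [n.-tuple]; missing entries are filled with [point], and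
    only sequences of length [n] matter. *)
Definition tuple_of (n : nat) (xs : seq X) : n.-tuple (borel X) :=
  [tuple (nth point xs i : borel X) | i < n].

Lemma tuple_ofK n xs : size xs = n -> tuple_of n xs = xs :> seq X.
Proof.
move=> sxs; apply: (@eq_from_nth _ point); first by rewrite size_tuple sxs.
move=> i; rewrite size_tuple => ilt.
by rewrite -(tnth_nth point _ (Ordinal ilt)) tnth_mktuple.
Qed.

Lemma plot_measurable_tuple_of n :
  plot_measurable n (fun _ : unit => tuple_of n).
Proof.
move=> d' Z' p v mp mv; apply/measurable_fun_tnthP => i.
rewrite (_ : _ \o _ = v i)//; apply/funext => z /=.
by rewrite tnth_mktuple nth_mkseq.
Qed.

Lemma measurable_plot_tuple n d2 (Y : measurableType d2) (G : seq X -> Y) :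
  plot_measurable n (fun _ : unit => G) ->
  measurable_fun setT (fun t : n.-tuple (borel X) => G (t : seq X)).
Proof.
move=> mG.
have := mG _ (n.-tuple (borel X)) (fun=> tt) (fun i t => nth point t i) (measurable_cst _) _.
rewrite (_ : (fun z => _) = (fun t : n.-tuple (borel X) => G (t : seq X))).
  apply => i; have [ilt|ilt] := ltnP i n.
    rewrite (_ : (fun t => _) = (@tnth n (borel X)^~ (Ordinal ilt))).
      exact: measurable_tnth.
    by apply/funext => t; rewrite (tnth_nth point).
  rewrite (_ : (fun t => _) = cst point); first exact: measurable_cst.
  by apply/funext => t; rewrite nth_default// size_tuple.
by apply/funext => t; congr G; rewrite -[in RHS](mkseq_nth (point : borel X) t) size_tuple.
Qed.

(** The law of the selected variables and the measure represented by the iterated integral are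
    finite and agree on boxes, a pi-system generating the product sigma-algebra. Allowing any
    duplicate-free list [J], in any order, is what later gives the symmetry of [block_limit]. *)
Lemma iid_joint_law (J : seq nat) (F : seq X -> \bar R) : uniq J ->
  (forall xs, 0 <= F xs)%E -> plot_measurable (size J) (fun _ : unit => F) ->
  (\int[P]_w F [seq x j w | j <- J] = iter_integral nu setT (size J) F)%E.
Proof.
move=> uJ F0 mF; set n := size J.
have [mx lawx indx] := x_iid.
have [m2 [m2E m2int]] := measure_functional_rep
  (iter_integral_measure_functional nu tt (@plot_measurable_tuple_of n)).
pose phi w : n.-tuple (borel X) := map_tuple (fun j => x j w : borel X) (in_tuple J).
have mphi : measurable_fun setT phi.
  apply/measurable_fun_tnthP => i.
  rewrite (_ : _ \o _ = (fun w => x (tnth (in_tuple J) i) w : borel X)); first exact: mx.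
  by apply/funext => w /=; rewrite tnth_map.
pose G : set (set (n.-tuple (borel X))) := [set B | exists A : nat -> set (borel X),
  (forall i, measurable (A i)) /\ B = [set t | forall i : 'I_n, A i (tnth t i)]].
have lawE B : measurable B -> pushforward P phi B = m2 B.
  move=> mB.
  apply: (@g_sigma_algebra_measure_unique _ R _ G _ (fun=> setT) _ _
    (pushforward P phi) m2).
  - move=> _ [A [mA ->]].
    rewrite (_ : [set t | _] = \big[setI/setT]_(i < n) ((@tnth _ (borel X))^~ i @^-1` A i)).
      apply: bigsetI_measurable => i _; rewrite -[X in measurable X]setTI.
      exact: measurable_tnth.
    apply/seteqP; split => t /=.
      by move=> h; rewrite -bigcap_seq => i _ /=.
    by rewrite -bigcap_seq => h i; apply: h; rewrite /= mem_index_enum.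
  - by move=> _; exists (fun=> setT); split => //; apply/seteqP; split.
  - by apply/seteqP; split => // t _; exists 0%N.
  - move=> B1 B2 [A1 [mA1 ->]] [A2 [mA2 ->]].
    exists (fun i => A1 i `&` A2 i); split; first by move=> i; exact: measurableI.
    apply/seteqP; split => t /=; first by move=> [h1 h2] i; split.
    by move=> h; split => i; have [] := h i.
  - move=> _ [A [mA ->]].
    rewrite m2E.
    rewrite (_ : iter_integral _ _ _ _ = iter_integral nu setT n
        (fun xs => (\prod_(i < n) \1_(A i) (nth point xs i : borel X))%:E)); last first.
      apply: eq_iter_integral => xs sxs _; congr EFin.
      have [h|h] := pselect (forall i : 'I_n, A i (nth point xs i)).
        rewrite indicE mem_set/=; last by move=> i; rewrite tnth_mktuple.
        by rewrite big1// => i _; rewrite indicE mem_set.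
      have /existsNP[i Ai] := h.
      rewrite indicE memNset/=; last by move=> h'; apply: h => j; have := h' j; rewrite tnth_mktuple.
      by rewrite (bigD1 i)//= indicE memNset// mul0r.
    rewrite iter_integral_box//; last first.
      by move=> i; rewrite (le_lt_trans (probability_le1 nu (mA i)))// ltry.
    (* Independence is stated by variable, the box by position; as [J] has no duplicates, [index]
       translates between them. *)
    pose A' j := A (index j J).
    transitivity (P (\bigcap_(j in [set` J]) (x j @^-1` A' j))).
      change (P (phi @^-1` [set t | forall i : 'I_n, A i (tnth t i)]) = P (\bigcap_(j in [set` J]) (x j @^-1` A' j))).
      congr (P _); apply/seteqP; split => w /=.
        move=> h j /= jJ; have jn : (index j J < n)%N by rewrite index_mem.
        by have := h (Ordinal jn); rewrite tnth_map (tnth_nth 0%N)/= nth_index.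
      move=> h i; rewrite tnth_map (tnth_nth 0%N)/=.
      by have := h (nth 0%N J i) (mem_nth _ (ltn_ord i)); rewrite /A' index_uniq.
    rewrite (indx J A' uJ (fun j => mA _)).
    rewrite (eq_bigr (fun j => nu (A' j))); last by move=> j _; exact: (lawx j (A' j) (mA _)).
    rewrite (big_nth 0%N) big_mkord; apply: eq_bigr => i _.
    by rewrite /A' index_uniq.
  - move=> _; apply: (@le_lt_trans _ _ 1%E); last exact: ltry.
    by change (P setT <= 1)%E; rewrite probability_setT.
  - move: mB; apply: smallest_sub; first exact: smallest_sigma_algebra.
    move=> B'; rewrite -bigcup_seq => -[i _ [A mA <-]].
    apply: sub_sigma_algebra.
    exists (fun j : nat => if j == (i : nat) then A else setT); split; first by move=> j; case: ifP.
    rewrite setTI; apply/seteqP; split => t /=.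
      by move=> At j; case: ifP => // /eqP/val_inj ->.
    by move=> /(_ i); rewrite eqxx.
have mF' := measurable_plot_tuple mF.
transitivity (\int[P]_w ((fun t : n.-tuple (borel X) => F (t : seq X)) \o phi) w)%E; first by [].
rewrite -[LHS](@ge0_integral_pushforward _ _ _ _ _ _ mphi P setT)//.
rewrite (eq_measure_integral m2); last by move=> B mB _; exact: lawE.
rewrite m2int//.
by apply: eq_iter_integral => xs sxs _; rewrite tuple_ofK.
Qed.

End iid_law.

Section independence.
Local Open Scope ereal_scope.
Context {d : measure_display} {Omega : measurableType d} {R : realType}.
Variable P : probability Omega R.

Lemma probability_pushforward d' (Z : measurableType d') (phi : Omega -> Z) :
  measurable_fun setT phi ->
  exists Q : probability Z R, (forall A, Q A = P (phi @^-1` A)) /\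
    forall f : Z -> \bar R, (forall z, 0 <= f z) -> measurable_fun setT f ->
      \int[Q]_z f z = \int[P]_w f (phi w).
Proof.
move=> mphi.
pose X : {mfun Omega >-> Z} := HB.pack phi (@isMeasurableFun.Build _ _ _ _ phi mphi).
exists (distribution P X); split => // f f0 mf.
by rewrite (@ge0_integral_pushforward _ _ _ _ _ _ mphi P setT).
Qed.

(** Independence says that the diagonal map [w] to [(w, w)] sends [P] to the product of its
    restrictions to the two generated sigma-algebras. Tonelli's theorem on that product then freezes
    the first argument. *)
Lemma integral_independent (G H : set (set Omega)) (F : Omega -> Omega -> \bar R) :
  <<s G >> `<=` measurable -> <<s H >> `<=` measurable ->
  independent_systems P <<s G >> <<s H >> ->
  (forall w w', 0 <= F w w') ->
  measurable_fun setT
    (fun p : g_sigma_algebraType G * g_sigma_algebraType H => F p.1 p.2) ->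
  measurable_fun setT (fun w => \int[P]_w' F w w') /\
  \int[P]_w F w w = \int[P]_w \int[P]_w' F w w'.
Proof.
move=> Gm Hm indep F0 mF.
have mid1 : measurable_fun setT (id : Omega -> g_sigma_algebraType G).
  by move=> _ A GA; rewrite setTI; exact: Gm.
have mid2 : measurable_fun setT (id : Omega -> g_sigma_algebraType H).
  by move=> _ A HA; rewrite setTI; exact: Hm.
have [PG [PGE PGint]] := probability_pushforward mid1.
have [PH [PHE PHint]] := probability_pushforward mid2.
have mdiag := measurable_fun_pair mid1 mid2.
have [PD [PDE PDint]] := probability_pushforward mdiag.
have prodE A : measurable A -> (PG \x PH)%E A = PD A.
  apply: product_measure_unique => A1 A2 mA1 mA2.
  refine (etrans (PDE _) (etrans (indep A1 A2 mA1 mA2) _)).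
  by congr (_ * _); [exact/esym/PGE|exact/esym/PHE].
have mFw w : measurable_fun setT (fun w' : g_sigma_algebraType H => F w w').
  exact: (measurableT_comp mF (measurable_pair1 (w : g_sigma_algebraType G))).
have inner w : \int[P]_w' F w w' = \int[PH]_w' F w w'.
  by rewrite (PHint (F w)).
have mI : measurable_fun setT (fun w : g_sigma_algebraType G => \int[PH]_w' F w w').
  have := @measurable_fun_fubini_tonelli_F _ _ (g_sigma_algebraType G)
    (g_sigma_algebraType H) R PH (fun p => F p.1 p.2) mF (fun p => F0 p.1 p.2).
  by apply.
have mI' : measurable_fun setT (fun w => \int[P]_w' F w w').
  under eq_fun do rewrite inner.
  exact: (measurableT_comp mI mid1).
split => //.
transitivity (\int[PD]_p F p.1 p.2).
  exact/esym/(PDint (fun p => F p.1 p.2) (fun p => F0 p.1 p.2) mF).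
transitivity (\int[PG \x PH]_p F p.1 p.2).
  by apply: eq_measure_integral => A mA _; exact/esym/prodE.
rewrite (@fubini_tonelli1 _ _ _ _ _ PG PH _ mF (fun p => F0 p.1 p.2)).
rewrite /fubini_F/= (PGint (fun w => \int[PH]_w' F w w'))//; last first.
  by move=> w; exact: integral_ge0.
by apply: eq_integral => w _; rewrite inner.
Qed.

End independence.

(** * Subsequences of a given length *)

(** Entries are chosen by position, so equal entries of [s] give separate sublists; multiple points
    of the process are thereby counted with multiplicity. *)
Fixpoint comb (T : Type) (k : nat) (s : seq T) : seq (seq T) :=
  match k, s with
  | 0%N, _ => [:: [::]]
  | _.+1, [::] => [::]
  | k'.+1, x :: s' => [seq x :: u | u <- comb k' s'] ++ comb k s'
  end.

Lemma comb0 (T : Type) (s : seq T) : comb 0 s = [:: [::]].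
Proof. by case: s. Qed.

Lemma map_comb (T U : Type) (f : T -> U) k s :
  comb k (map f s) = map (map f) (comb k s).
Proof.
elim: s k => [|x s IH] [|k] //=.
by rewrite map_cat !IH -!map_comp.
Qed.

Lemma mem_comb (T : eqType) k (s u : seq T) :
  (u \in comb k s) = (subseq u s && (size u == k)).
Proof.
elim: s k u => [|x s IH] [|k] u.
- by rewrite inE subseq0; case: u.
- by rewrite in_nil subseq0; case: u.
- by rewrite comb0 inE; case: u => [|y u]; rewrite ?sub0seq ?andbF.
rewrite [comb _ _]/= mem_cat IH; case: u => [|y u] /=.
  by rewrite andbF orbF; apply/mapP => -[].
have [->|yx] := eqVneq y x.
  rewrite mem_map; last by move=> ? ? [].
  rewrite IH eqSS; case: (boolP (subseq u s)) => //= us.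
    by case: (size u == k) => //=; rewrite andbF.
  by rewrite (_ : subseq (x :: u) s = false)//; apply: contraNF us => /cons_subseq.
rewrite eqSS (_ : (y :: u \in _) = false)//.
by apply/mapP => -[v _ [yx' _]]; rewrite yx' eqxx in yx.
Qed.

Lemma uniq_comb (T : eqType) k (s : seq T) : uniq s -> uniq (comb k s).
Proof.
elim: s k => [|x s IH] [|k] //= /andP[xs us].
rewrite cat_uniq map_inj_uniq ?IH//; last by move=> ? ? [].
rewrite andbT; apply/hasPn => v; rewrite mem_comb => /andP[vs _].
apply/mapP => -[u _ vE]; move/negP: xs; apply.
by apply: (mem_subseq vs); rewrite vE mem_head.
Qed.

Lemma uniq_flatten_map (T U : eqType) (s : seq T) (t : T -> seq U) :
  uniq s -> (forall x, x \in s -> uniq (t x)) ->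
  (forall x y v, x \in s -> y \in s -> v \in t x -> v \in t y -> x = y) ->
  uniq (flatten (map t s)).
Proof.
elim: s => [|x s IH] //= /andP[xs us] ut inj.
rewrite cat_uniq ut ?mem_head//= IH//; last 2 first.
- by move=> y ys; apply: ut; rewrite inE ys orbT.
- by move=> y z v ys zs; apply: inj; rewrite inE ?ys ?zs orbT.
rewrite andbT; apply/hasPn => v /flatten_mapP[y ys vy]; apply/negP => vx.
move: xs; rewrite (inj x y v) ?mem_head ?ys//.
by rewrite inE ys orbT.
Qed.

(** The duplicate-free tuples are the permutations of the [k]-element sublists of the enumeration,
    each sublist having [k!] of them. *)
Lemma sum_uniq_tuples_comb (R : realType) m k (h : seq 'I_m -> \bar R) :
  (forall u v, size u = k -> perm_eq u v -> h u = h v) -> (forall u, 0 <= h u)%E ->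
  (\sum_(i : k.-tuple 'I_m | uniq i) h i =
   k`!%:R%:E * \sum_(u <- comb k (enum 'I_m)) h u)%E.
Proof.
move=> hsym h0.
have us := enum_uniq 'I_m.
have perm : perm_eq [seq tval i | i : k.-tuple 'I_m in [pred i : k.-tuple 'I_m | uniq i]]
    (flatten [seq permutations u | u <- comb k (enum 'I_m)]).
  apply: uniq_perm.
  - by rewrite map_inj_uniq ?enum_uniq//; exact: val_inj.
  - apply: uniq_flatten_map; first exact: uniq_comb.
      by move=> u _; exact: permutations_uniq.
    move=> u v w; rewrite !mem_comb !mem_permutations => /andP[su _] /andP[sv _] pu pv.
    (* A sublist of a duplicate-free list is its filter by membership, so two sublists with a common
       permutation coincide. *)
    have /(subseq_uniqP us) -> := su; have /(subseq_uniqP us) -> := sv.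
    by apply: eq_filter => i; rewrite -(perm_mem pu) -(perm_mem pv).
  move=> v; apply/mapP/flatten_mapP => [[i]|[u]].
    rewrite mem_enum inE => ui ->.
    have pf : perm_eq i [seq j <- enum 'I_m | j \in tval i].
      apply: uniq_perm => //; first exact: filter_uniq.
      by move=> j; rewrite mem_filter mem_enum andbT.
    exists [seq j <- enum 'I_m | j \in tval i]; last by rewrite mem_permutations.
    by rewrite mem_comb filter_subseq/= -(perm_size pf) size_tuple.
  rewrite mem_comb mem_permutations => /andP[su /eqP szu] pv.
  have szv : size v == k by rewrite (perm_size pv) szu.
  exists (Tuple szv) => //; rewrite mem_enum inE/= (perm_uniq pv).
  exact: subseq_uniq su us.
have -> : (\sum_(i : k.-tuple 'I_m | uniq i) h i =
    \sum_(v <- [seq tval i | i : k.-tuple 'I_m in [pred i : k.-tuple 'I_m | uniq i]]) h v)%E.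
  by rewrite big_image.
rewrite (perm_big _ perm) big_flatten/= big_map ge0_sume_distrr//.
rewrite big_seq [RHS]big_seq; apply: eq_bigr => u; rewrite mem_comb => /andP[su /eqP szu].
rewrite big_seq (eq_bigr (fun=> h u)); last first.
  by move=> v; rewrite mem_permutations perm_sym => uv; rewrite (hsym u v).
rewrite -big_seq big_const_seq count_predT size_permutations ?szu; last exact: subseq_uniq su us.
rewrite -[RHS]muleC; elim: (k`!) => [|q IH] /=; first by rewrite mule0.
by rewrite IH -natr1 EFinD ge0_muleDr ?lee_fin// mule1 addeC.
Qed.

Lemma size_comb (T : Type) k (s : seq T) : size (comb k s) = 'C(size s, k).
Proof.
elim: s k => [|x s IH] [|k] //=.
by rewrite size_cat size_map !IH binS addnC.
Qed.

Lemma comb_size (T : Type) (s : seq T) : comb (size s) s = [:: s].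
Proof.
elim: s => [|x s IH] //=; rewrite IH /=.
suff -> : comb (size s).+1 s = [::] by [].
by apply: size0nil; rewrite size_comb bin_small.
Qed.

Lemma size_mem_comb (T : Type) k (s : seq T) :
  all (fun u => size u == k) (comb k s).
Proof.
elim: s k => [|x s IH] [|k] //=.
by rewrite all_cat all_map IH andbT; exact: IH.
Qed.

(** * Regular variation *)

Section restriction.
Context {R : realType} {X : completeMetricType R}.
Variable (o : X).

Lemma far_fattening r : far o r = ~` fattening mdist [set o] r.
Proof.
apply/seteqP; split => y /=.
  by move=> ry [_ /= ->]; rewrite metric_sym ltNge ry.
by move=> h; rewrite /far/= leNgt; apply/negP => yr; apply: h; exists o => //; rewrite metric_sym.
Qed.

Lemma not_origin_bigcup : ~` [set o] = \bigcup_n (far o n.+1%:R^-1).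
Proof.
apply/seteqP; split => y /=.
  move=> yo; have d0 : 0 < mdist o y by rewrite mdist_gt0; apply/eqP => oy; exact: yo.
  have [n _ /(_ n (leqnn _)) nd] := near_infty_natSinv_lt (PosNum d0).
  by exists n => //=; exact: ltW.
move=> [n _ ny] yo; have : (0 : R) < 0; last by rewrite ltxx.
by rewrite -{2}(mdistxx o) -{2}yo (lt_le_trans _ ny)// invr_gt0.
Qed.

Lemma measurable_not_origin : measurable (~` [set o] : set (borel X)).
Proof.
rewrite not_origin_bigcup.
by apply: bigcupT_measurable => n; exact: measurable_far.
Qed.

(** [mu] may have any mass at [o]. Removing that mass leaves a measure that is finite on each
    [far o n.+1%:R^-1], and these sets exhaust the complement of [o]. *)
Lemma restriction_sigma_finite (mu : {measure set (borel X) -> \bar R}) :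
  away_finite mdist [set o] mu ->
  exists m : {sigma_finite_measure set (borel X) -> \bar R},
    (forall f : borel X -> \bar R, (forall x, 0 <= f x)%E -> measurable_fun setT f ->
      (\int[mu]_(x in ~` [set o]) f x = \int[m]_x f x)%E) /\
    (forall delta, 0 < delta -> (m (far o delta) < +oo)%E).
Proof.
move=> mufin.
have mD := measurable_not_origin.
pose Phi (f : borel X -> \bar R) := (\int[mu]_x ((\1_(~` [set o] : set (borel X)) x)%:E * f x))%E.
have mind : measurable_fun setT (fun x : borel X => (\1_(~` [set o] : set (borel X)) x)%:E : \bar R).
  by apply/measurable_EFinP; exact: measurable_indic.
have PhiE f : Phi f = (\int[mu]_(x in ~` [set o]) f x)%E.
  rewrite [RHS]integral_mkcond; apply: eq_integral => y _.
  by rewrite patchE indicE; case: ifP => _; rewrite ?mul1e ?mul0e.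
have Phimf : measure_functional Phi.
  apply: (@integral_measure_functional _ _ (borel X) mu _ (borel X)
    (fun x f => ((\1_(~` [set o] : set (borel X)) x)%:E * f x)%E)).
    move=> x; case: (boolP (x \in (~` [set o] : set (borel X)))) => xo.
      rewrite (_ : (fun f => _) = (fun f : borel X -> \bar R => f x)).
        split => // g _ _ ndg; exact: ereal_nondecreasing_is_cvgn.
      by apply/funext => f; rewrite indicE xo mul1e.
    rewrite (_ : (fun f => _) = (fun f : borel X -> \bar R => 0%E)).
      by split => // *; rewrite ?adde0 ?mule0//; exact: cvg_cst.
    by apply/funext => f; rewrite indicE (negbTE xo) mul0e.
  by move=> f f0 mf; exact: emeasurable_funM.
have [mr [mrE mrint]] := measure_functional_rep Phimf.
have mrM A : measurable A -> mr A = mu (A `&` ~` [set o]).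
  by move=> mA; rewrite mrE PhiE integral_indic.
have mr_far r : 0 < r -> (mr (far o r) < +oo)%E.
  move=> r0; have mf := measurable_far o r.
  rewrite mrM//; apply: le_lt_trans (mufin r r0).
  rewrite -far_fattening; apply: le_measure; rewrite ?inE//.
  exact: measurableI.
have sf : sigma_finite setT mr.
  (* Adding [o] to each set yields a cover of the whole space at no cost, since [mr] does not charge
     [o]. *)
  exists (fun n => [set o] `|` far o n.+1%:R^-1).
    apply/seteqP; split => // y _.
    have [->|yo] := pselect (y = o); first by exists 0%N => //; left.
    have : (~` [set o] : set X) y by [].
    by rewrite not_origin_bigcup => -[n _ h]; exists n => //; right.
  move=> n; have mU : measurable ([set o] `|` far o n.+1%:R^-1 : set (borel X)).
    apply: measurableU; last exact: measurable_far.
    by rewrite -[X in measurable X]setCK; exact: measurableC.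
  split => //; apply: le_lt_trans (mr_far n.+1%:R^-1 _); last by rewrite invr_gt0.
  have mf := measurable_far o n.+1%:R^-1.
  rewrite !mrM//; apply: le_measure; rewrite ?inE; try exact: measurableI.
  by move=> y /= [[->|//] //].
pose H1 := @isSFinite.Build _ _ _ mr (sfinite_measure_sigma_finite sf).
pose H2 := @isSigmaFinite.Build _ _ _ mr sf.
exists (HB.pack_for {sigma_finite_measure set (borel X) -> \bar R} (Measure.sort mr) H1 H2).
split => //= f f0 mf.
by rewrite mrint// PhiE.
Qed.
End restriction.

Lemma borel_continuous_measurable (S S' : ptopologicalType) (g : S -> S') :
  continuous g -> measurable_fun setT (g : borel S -> borel S').
Proof.
move=> /continuousP cg.
have mE : @measurable _ (borel S') = <<s @open S' >> by [].
apply: (measurability _ mE) => _ [U oU <-]; rewrite setTI.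
by apply: sub_sigma_algebra; exact: cg.
Qed.

Section scaling.
Context {R : realType} {X : completeMetricType R}.
Variable s : scaling X.
Notation o := (origin s).

Lemma act_cont u : 0 < u -> continuous (act s u).
Proof.
move=> u0 x.
have := @act_continuous _ _ s.
rewrite continuous_open_subspace; last first.
  have -> : [set q : R * X | 0 < q.1] = fst @^-1` [set x : R | 0 < x] by [].
  by apply: open_comp; [move=> q _; exact: cvg_fst|exact: open_gt].
move=> /(_ (u, x)); rewrite inE => /(_ u0) c.
have cp : (fun y : X => (u, y)) y @[y --> x] --> (u, x).
  by move=> A [[B C] /= [nB nC] BC]; apply: filterS nC => y Cy; apply: BC; split => //=;
    exact: nbhs_singleton.
exact: (cvg_comp _ _ cp c).
Qed.

Lemma actVK u x : 0 < u -> act s u^-1 (act s u x) = x.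
Proof. by move=> u0; rewrite actM ?invr_gt0// mulVf ?gt_eqF// act1. Qed.

Lemma actKV u x : 0 < u -> act s u (act s u^-1 x) = x.
Proof. by move=> u0; rewrite actM ?invr_gt0// divff ?gt_eqF// act1. Qed.

Lemma act_image u (A : set X) : 0 < u -> act s u @` A = act s u^-1 @^-1` A.
Proof.
move=> u0; apply/seteqP; split => [_ [y Ay <-]|y Ay] /=; first by rewrite actVK.
by exists (act s u^-1 y) => //; rewrite actKV.
Qed.

(** The law of the rescaled mark is the image of [nu] under [act s (a n)%:num^-1]; since that map
    inverts [act s (a n)%:num], its preimages are the images used in [regularly_varying]. *)
Lemma regularly_varying_vague (nu : probability (borel X) R) (a : nat -> {posnum R})
    (mu m : {measure set (borel X) -> \bar R}) :
  (forall f : borel X -> \bar R, (forall x, 0 <= f x)%E -> measurable_fun setT f ->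
      (\int[mu]_(x in ~` [set o]) f x = \int[m]_x f x)%E) ->
  regularly_varying s nu a mu ->
  exists law : nat -> probability (borel X) R,
    (forall n A, law n A = nu (act s (a n)%:num^-1 @^-1` A)) /\
    vague_cvg o m (fun n => n%:R) law.
Proof.
move=> muE [_ _ _ RV].
have mact n : measurable_fun setT (act s (a n)%:num^-1 : borel X -> borel X).
  by apply: borel_continuous_measurable; apply: act_cont; rewrite invr_gt0.
have [law lawP] := choice (fun n => probability_pushforward nu (mact n)).
exists law; split; first by move=> n A; have [] := lawP n.
split; [by []|exact: cvgr_idn|].
move=> E tE; have mE := test_measurable tE; have [cE [M EM] [delta d0 Ed]] := tE.
have E0 y : (0 <= (E y)%:E)%E by rewrite lee_fin; case/andP: (EM y).
have Eo : E o = 0 by apply: Ed; rewrite mdistxx.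
rewrite -muE//; have := RV E cE.
have -> : (fun n => (\int[fun A : set (borel X) => n%:R%:E * nu (act s (a n)%:num @` (A : set X))]_(x in ~` [set o]) (E x)%:E)%E) =
    (fun n => (n%:R%:E * \int[law n]_y (E y)%:E)%E).
  apply/funext => n; pose rn : {nonneg R} := NngNum (ler0n R n).
  rewrite (_ : (fun A => _) = mscale rn (law n)); last first.
    apply/funext => A; rewrite /mscale/=; congr (_ * _)%E.
    by have [-> _] := lawP n; rewrite act_image.
  rewrite integral_mkcond (_ : _ \_ _ = (fun y : borel X => (E y)%:E)); last first.
    apply/funext => y; rewrite patchE; case: ifPn => //; rewrite notin_setE /= => /contrapT ->.
    by rewrite Eo.
  exact: ge0_integral_mscale.
apply.
- by exists M => y; rewrite ger0_norm; case/andP: (EM y).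
- exists delta => //; apply/seteqP; split => // y [/= cy [_ /= -> yd]].
  (* A support point closer than [delta] to [o] would have a ball around it on which [E]
     vanishes. *)
  have := cy (ball y (delta - mdist y o)).
  case; first by apply: nbhsx_ballx; rewrite subr_gt0.
  move=> z [/= /eqP Ez yz]; apply: Ez; apply: Ed.
  move: yz; rewrite ballEmdist/= => yz.
  apply: (le_lt_trans (metric_triangle o y z)); rewrite metric_sym.
  by rewrite -ltrBrDl.
Qed.

End scaling.

(** * The limit for fixed points *)

Section test_on_point_measures.
Context {R : realType} {T X : completeMetricType R}.
Hypotheses (sepT : separable_space T) (sepX : separable_space X).
Variable s : scaling X.
Notation o := (origin s).
Notation d := (@dE R T X).
Notation F := (axis (T := T) s).
Notation pm := (pm_of_seq d F).

Lemma plot_measurable_pm d' (Z : measurableType d') n (u : nat -> Z -> borel T) :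
  (forall i, measurable_fun setT (u i)) ->
  plot_measurable n (fun z xs =>
    (pm (zip (mkseq (fun i => u i z : T) n) xs) : borel (pointMeasureE T s))).
Proof.
move=> mu d2 Z2 p v mp mv.
have := @measurable_pm _ _ _ s sepT sepX _ _ n _ _ (fun i => measurableT_comp (mu i) mp) mv.
rewrite (_ : (fun z => _) = (fun z => pm (zip (mkseq (fun i => u i (p z) : T) n) (mkseq (fun i => v i z : X) n)))).
  by apply.
apply/funext => z; congr pm; rewrite /mkseq.
by elim: (iota 0 n) => //= i l ->.
Qed.

Lemma plot_measurable_pm_cat (pre : seq (T * X)) (ts : seq T) :
  plot_measurable (size ts) (fun (_ : unit) xs =>
    (pm (pre ++ zip ts xs) : borel (pointMeasureE T s))).
Proof.
move=> d2 Z2 p v mp mv.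
pose ts' := map fst pre ++ ts.
pose w i : Z2 -> borel X := if (i < size pre)%N then cst (nth point pre i).2
  else v (i - size pre)%N.
have mw i : measurable_fun setT (w i) by rewrite /w; case: ifP.
have := @measurable_pm _ _ _ s sepT sepX _ _ (size pre + size ts) _ _
  (fun i => @measurable_cst _ _ Z2 (borel T) setT (nth point ts' i)) mw.
rewrite (_ : (fun z => _) = (fun z => pm (pre ++ zip ts (mkseq (fun i => v i z : X) (size ts))))).
  by apply.
apply/funext => z; congr pm.
apply: (@eq_from_nth _ point).
  by rewrite size_mkseq size_cat size_zip size_mkseq minnn.
move=> i; rewrite size_mkseq => ilt; rewrite nth_mkseq// nth_cat /ts' nth_cat size_map.
rewrite /w; case: ltnP => ip /=.
  by rewrite (nth_map point)//; case: (nth point pre i).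
have ilt' : (i - size pre < size ts)%N by rewrite ltn_subLR.
by rewrite (nth_zip point point) ?size_mkseq// nth_mkseq.
Qed.

Variables (k : nat) (M r0 : R).
Variable f : pointMeasureE T s -> R.
Hypotheses (cf : continuous f) (fM : forall p, 0 <= f p <= M) (r00 : 0 < r0).
Hypothesis f0 : forall p, fattening (@pm_dist R _ d F) (at_most k) r0 p -> f p = 0.

Lemma test_borel_measurable : measurable_fun setT (f : borel (pointMeasureE T s) -> R).
Proof. exact: continuous_borel_measurable. Qed.

(** The threshold [r0 / 2] meets the strict inequality asked by [pm_near_at_most]. *)
Lemma test_vanish (zs : seq (T * X)) :
  (count (bigger s (r0 / 2)) zs <= k)%N -> f (pm zs) = 0.
Proof.
move=> c; apply: f0; apply: (pm_near_at_most _ c).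
by rewrite divr_gt0//= ltr_pdivrMr// mulr2n mulrDr mulr1 ltrDl.
Qed.

Lemma zip_admissible (ts : seq T) :
  admissible o (r0 / 2) M k.+1 (size ts) (fun _ ys => f (pm (zip ts ys)))
    (fun ys => f (pm (zip ts ys))).
Proof.
split.
- by move=> _ ys.
- move=> _ ys sys c; apply: test_vanish; rewrite -ltnS; apply: leq_trans c.
  rewrite ltnS -(count_map snd (fun y : X => (r0 / 2 <= mdist o y)%R)) -/unzip2.
  by rewrite unzip2_zip// sys.
- move=> _; have h := plot_measurable_pm_cat [::] ts.
  exact: (plot_measurable_post test_borel_measurable h).
- move=> u ys_ ys uoo sys_ sys cys.
  apply: (@pm_cvg _ _ _ s f (size ts)) => //.
  + by move=> j; rewrite size_zip sys_ minnn.
  + by rewrite size_zip sys minnn.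
  + move=> i ilt; rewrite (nth_zip point point) ?sys//=.
    under eq_fun do rewrite (nth_zip point point) ?sys_//.
    exact: cvg_cst.
  + move=> i ilt; rewrite (nth_zip point point) ?sys//=.
    under eq_fun do rewrite (nth_zip point point) ?sys_//.
    exact: cys.
Qed.

Variable m : {sigma_finite_measure set (borel X) -> \bar R}.

(** For [ts] of length [k.+1] this is the limit when the process consists of exactly the points
    [ts], as [comb] then has a single term. *)
Definition block_limit (ts : seq T) : \bar R :=
  iter_integral m setT k.+1 (fun xs => (f (pm (zip ts xs)))%:E).

Lemma fE_ge0 p : (0 <= (f p)%:E)%E.
Proof. by rewrite lee_fin; case/andP: (fM p). Qed.

Lemma plot_measurable_f_cat (pre : seq (T * X)) (ts : seq T) :
  plot_measurable (size ts) (fun (_ : unit) xs => (f (pm (pre ++ zip ts xs)))%:E : \bar R).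
Proof.
have mf : measurable_fun setT (fun p : borel (pointMeasureE T s) => (f p)%:E : \bar R).
  by apply/measurable_EFinP; exact: test_borel_measurable.
exact: (plot_measurable_post mf (plot_measurable_pm_cat pre ts)).
Qed.

(** [lim_iter] and [comb] branch alike: a coordinate integrated against [m] is a selected point, and
    a coordinate set to [o] is an atom on the axis, which [pm] discards. The prefix [pre] collects
    the points already selected. *)
Lemma lim_iter_comb_cat K (pre : seq (T * X)) (ts : seq T) :
  lim_iter m o K (size ts) (fun ys => f (pm (pre ++ zip ts ys))) =
  (\sum_(u <- comb K ts) iter_integral m setT K (fun xs => (f (pm (pre ++ zip u xs)))%:E))%E.
Proof.
elim: ts K pre => [|t ts IH] K pre.
  by case: K => [|K] /=; rewrite ?big_nil ?big_seq1.
have skip ys : f (pm (pre ++ (t, o) :: zip ts ys)) = f (pm (pre ++ zip ts ys)).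
  by rewrite pm_of_seq_skip//; exact/axisP.
case: K => [|K].
  rewrite /= (_ : (fun ys => _) = (fun ys => f (pm (pre ++ zip ts ys)))); last first.
    by apply/funext => ys; exact: skip.
  by rewrite IH !comb0.
rewrite [comb _ _]/= big_cat big_map /=; congr (_ + _)%E; last first.
  rewrite (_ : (fun ys => f (pm (pre ++ (t, o) :: zip ts ys))) = (fun ys => f (pm (pre ++ zip ts ys)))).
    by rewrite IH.
  by apply/funext => ys; exact: skip.
(* Exchanging sum and integral asks for measurability and sign for every [u]; the guard on the size
   provides them outside the list as well. *)
pose G u x := if size u == K then
  iter_integral m setT K (fun xs => (f (pm (pre ++ zip (t :: u) (x :: xs))))%:E) else 0%E.
have GE x : (\sum_(u <- comb K ts) iter_integral m setT K
    (fun xs => (f (pm (pre ++ zip (t :: u) (x :: xs))))%:E) = \sum_(u <- comb K ts) G u x)%E.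
  rewrite big_seq [RHS]big_seq; apply: eq_bigr => u uK.
  by rewrite /G (allP (size_mem_comb K ts) u uK).
transitivity (\int[m]_x (\sum_(u <- comb K ts) G u x))%E.
  apply: eq_integral => x _; rewrite -GE.
  rewrite (_ : (fun ys => _) = (fun ys => f (pm (rcons pre (t, x) ++ zip ts ys)))); last first.
    by apply/funext => ys; rewrite cat_rcons.
  rewrite IH; apply: eq_bigr => u _; apply: eq_iter_integral => xs _ _.
  by rewrite cat_rcons.
rewrite ge0_integral_sum//.
- rewrite big_seq [RHS]big_seq; apply: eq_bigr => u uK; apply: eq_integral => x _.
  by rewrite /G (allP (size_mem_comb K ts) u uK).
- move=> u; rewrite /G; case: eqP => // uK.
  apply: (@measurable_iter_section _ _ m _ unit K (fun _ xs => (f (pm (pre ++ zip (t :: u) xs)))%:E) tt).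
    by move=> _ xs; exact: fE_ge0.
  by rewrite -uK; exact: (plot_measurable_f_cat pre (t :: u)).
- move=> u x _; rewrite /G; case: eqP => // uK.
  by apply: iter_integral_ge0 => xs; exact: fE_ge0.
Qed.

Lemma lim_iter_blocks (ts : seq T) :
  lim_iter m o k.+1 (size ts) (fun ys => f (pm (zip ts ys))) =
  (\sum_(u <- comb k.+1 ts) block_limit u)%E.
Proof. exact: (lim_iter_comb_cat k.+1 [::] ts). Qed.

Hypothesis m_far : forall delta, 0 < delta -> (m (far o delta) < +oo)%E.
Variables (law : nat -> probability (borel X) R).
Hypothesis law_m : vague_cvg o m (fun n => n%:R) law.

Lemma scaled_riter_cvg (ts : seq T) :
  (\sum_(u <- comb k.+1 ts) block_limit u)%E \is a fin_num /\
  n%:R ^+ k.+1 * riter (law n) (size ts) (fun ys => f (pm (zip ts ys))) @[n --> \oo] -->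
  fine (\sum_(u <- comb k.+1 ts) block_limit u)%E.
Proof.
have r20 : 0 < r0 / 2 by rewrite divr_gt0.
by have := riter_cvg m_far r20 law_m (zip_admissible ts); rewrite lim_iter_blocks.
Qed.

Context {dO : measure_display} {Omega : measurableType dO} (P : probability Omega R).
Variable y : nat -> nat -> Omega -> X.
Hypothesis y_iid : forall n, iid P (y n) (law n).

Lemma riter_integral n (ts : seq T) (J : seq nat) : uniq J -> size J = size ts ->
  (riter (law n) (size ts) (fun ys => f (pm (zip ts ys))))%:E =
  (\int[P]_w (f (pm (zip ts [seq y n j w | j <- J])))%:E)%E.
Proof.
move=> uJ sJ.
have mF := plot_measurable_f_cat [::] ts; rewrite /= in mF.
have [rE _ _] := riter_bounds (law n) (fun ys => fM (pm (zip ts ys)))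
  (plot_measurable_post test_borel_measurable (plot_measurable_pm_cat [::] ts)).
rewrite rE -sJ.
rewrite -(@iid_joint_law _ _ _ _ _ _ _ (y_iid n) J (fun ys => (f (pm (zip ts ys)))%:E))// ?sJ//.
by move=> xs; exact: fE_ge0.
Qed.

(** Relabelling i.i.d. marks does not change the expectation of a function of the point measure, so
    both sides are limits of the same sequence. *)
Lemma block_limit_perm (us vs : seq T) : size us = k.+1 -> perm_eq us vs ->
  block_limit us = block_limit vs.
Proof.
move=> su uv; have sv : size vs = k.+1 by rewrite -(perm_size uv).
have [fu cu] := scaled_riter_cvg us; have [fv cv] := scaled_riter_cvg vs.
have cu' : n%:R ^+ k.+1 * riter (law n) (size us) (fun ys => f (pm (zip us ys))) @[n --> \oo] -->
    fine (block_limit us).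
  by move: cu; rewrite -{2}su comb_size big_seq1.
have cv' : n%:R ^+ k.+1 * riter (law n) (size vs) (fun ys => f (pm (zip vs ys))) @[n --> \oo] -->
    fine (block_limit vs).
  by move: cv; rewrite -{2}sv comb_size big_seq1.
rewrite -su comb_size big_seq1 in fu; rewrite -sv comb_size big_seq1 in fv.
rewrite -(fineK fu) -(fineK fv); congr EFin.
suff E n : riter (law n) (size us) (fun ys => f (pm (zip us ys))) =
    riter (law n) (size vs) (fun ys => f (pm (zip vs ys))).
  move: cu'; under eq_fun do rewrite E; move=> cu'.
  by rewrite -(cvg_lim (@Rhausdorff R) cu') -(cvg_lim (@Rhausdorff R) cv').
apply: EFin_inj.
(* The points [us] receive the marks with indices [Is], so each point carries the same mark as in
   [vs] and the two point measures coincide. *)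
have /(perm_iotaP point) [Is pIs usE] := uv.
have uIs : uniq Is by rewrite (perm_uniq pIs) iota_uniq.
rewrite (@riter_integral n us Is)//; last by rewrite usE size_map.
rewrite (@riter_integral n vs (iota 0 (size vs)) (iota_uniq _ _)) ?size_iota//.
apply: eq_integral => w _; congr (f _)%:E; apply: pm_of_seq_perm.
rewrite usE zip_map -[in X in perm_eq _ (zip X _)](mkseq_nth point vs) /mkseq zip_map.
exact: perm_map.
Qed.

End test_on_point_measures.

(** * Randomly many points *)

Lemma measurable_pieces d (Z : measurableType d) d2 (Y : measurableType d2)
    (N : Z -> nat) (Fn : nat -> Z -> Y) :
  (forall n, measurable [set z | N z = n]) -> (forall n, measurable_fun setT (Fn n)) ->
  measurable_fun setT (fun z => Fn (N z) z).
Proof.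
move=> mN mF _ A mA; rewrite setTI.
rewrite (_ : _ @^-1` A = \bigcup_n ([set z | N z = n] `&` (Fn n @^-1` A))).
  apply: bigcupT_measurable => n; apply: measurableI => //.
  by rewrite -[X in measurable X]setTI; exact: mF.
apply/seteqP; split => z /=; first by exists (N z).
by move=> [n _ [/= ->]].
Qed.

Lemma zip_mkseq (A B : Type) (a : nat -> A) (b : nat -> B) n :
  zip (mkseq a n) (mkseq b n) = mkseq (fun i => (a i, b i)) n.
Proof. by rewrite /mkseq zip_map. Qed.

Section marked_process.
Context {R : realType} {T X : completeMetricType R}.
Hypotheses (sepT : separable_space T) (sepX : separable_space X).
Variable s : scaling X.
Notation o := (origin s).
Notation d := (@dE R T X).
Notation F := (axis (T := T) s).
Notation pm := (pm_of_seq d F).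
Context {dO : measure_display} {Omega : measurableType dO} (P : probability Omega R).
Variables (N : Omega -> nat) (t : nat -> Omega -> T).
Hypothesis t_random : point_events N t `<=` measurable.
Variables (x : nat -> Omega -> X).
Hypothesis x_neq0 : forall i w, x i w <> o.
Variable nu : probability (borel X) R.
Hypothesis x_iid : iid P x nu.
Hypothesis x_indep : independent_systems P
       <<s point_events N t >> <<s sequence_events x >>.

Let OG := g_sigma_algebraType (point_events N t).
Let OH := g_sigma_algebraType (sequence_events x).

Definition points (w : Omega) : seq T := mkseq (t^~ w) (N w).

(** [t i] is only measurable where [i < N]. *)
Let t' i w := if (i < N w)%N then t i w else point.

Let pointsE w : points w = mkseq (t'^~ w) (N w).
Proof.
rewrite /points; apply/eq_in_map => i; rewrite mem_iota add0n => /= ilt.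
by rewrite /t' ilt.
Qed.

Lemma point_events_measurable : <<s point_events N t >> `<=` measurable.
Proof. by apply: smallest_sub => //; exact: sigma_algebra_measurable. Qed.

Lemma sequence_events_measurable : <<s sequence_events x >> `<=` measurable.
Proof.
apply: smallest_sub; first exact: sigma_algebra_measurable.
move=> _ [j [A [mA ->]]]; have [mx _ _] := x_iid.
by rewrite -[X in measurable X]setTI; exact: mx.
Qed.

Let mN n : measurable ([set w | N w = n] : set OG).
Proof. by apply: sub_sigma_algebra; left; exists n. Qed.

Let mt' i : measurable_fun setT (t' i : OG -> borel T).
Proof.
move=> _ A mA; rewrite setTI.
have mlt (B : set (borel T)) : measurable B -> measurable ([set w | (i < N w)%N /\ B (t i w)] : set OG).
  by move=> mB; apply: sub_sigma_algebra; right; exists i, B.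
rewrite (_ : t' i @^-1` A = [set w | (i < N w)%N /\ A (t i w)] `|`
    (~` [set w | (i < N w)%N /\ setT (t i w)] `&` [set w | A (point : T)])).
  apply: measurableU; first exact: mlt.
  apply: measurableI; first by apply: measurableC; exact: mlt.
  have [Ap|Ap] := pselect (A (point : T)).
    by rewrite (_ : [set w | _] = setT)//; apply/seteqP; split.
  by rewrite (_ : [set w | _] = set0)//; apply/seteqP; split.
apply/seteqP; split => w /=; rewrite /t'; case: ifPn => ilt.
- by left.
- by move=> Ap; right; split => // -[].
- by case=> [[]//|[h _]]; exfalso; apply: h.
- by case=> [[]|[]].
Qed.

Lemma measurable_total_point i :
  measurable_fun setT (fun w => (if (i < N w)%N then t i w else point) : borel T).
Proof.
have mid1 : measurable_fun setT (id : Omega -> OG).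
  by move=> _ A GA; rewrite setTI; exact: point_events_measurable.
exact: (measurableT_comp (mt' i) mid1).
Qed.

Let mx j : measurable_fun setT (x j : OH -> borel X).
Proof.
by move=> _ A mA; rewrite setTI; apply: sub_sigma_algebra; exists j, A.
Qed.

Variable a : {posnum R}.
Definition scaled_mark j w : X := act s a%:num^-1 (x j w).

Let mact : measurable_fun setT (act s a%:num^-1 : borel X -> borel X).
Proof.
by apply: borel_continuous_measurable; apply: act_cont; rewrite invr_gt0.
Qed.

Lemma scaled_mark_iid (law : probability (borel X) R) :
  (forall A, law A = nu (act s a%:num^-1 @^-1` A)) -> iid P scaled_mark law.
Proof.
move=> lawE; have [mx0 lx ix] := x_iid; split.
- by move=> j; exact: (measurableT_comp mact (mx0 j)).
- move=> j A mA; rewrite lawE -(lx j)//.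
  by rewrite -[X in measurable X]setTI; exact: mact.
- move=> J A uJ mA; apply: (ix J (fun j => act s a%:num^-1 @^-1` A j)) => // j.
  by rewrite -[X in measurable X]setTI; exact: mact.
Qed.

(** Scaling can be done mark by mark because no atom is discarded on either side: neither [x i w]
    nor its rescaling is the origin. *)
Lemma pm_scale_marked w : pm_scale a%:num^-1%:pos (marked_pm s N t x w) =
  pm (zip (points w) [seq scaled_mark j w | j <- iota 0 (N w)]).
Proof.
apply: pm_eq => A /=; rewrite !sum_dirac_count; congr (_%:R%:E).
rewrite zip_mkseq /mkseq !count_map; apply: eq_count => i /=.
have a0 : 0 < a%:num^-1 by rewrite invr_gt0.
have -> : (t i w, x i w) \notin F.
  by rewrite notin_setE => /axisP/=; exact: x_neq0.
have -> : (t i w, scaled_mark i w) \notin F.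
  rewrite notin_setE => /axisP/= h; apply: (x_neq0 (i := i) (w := w)).
  rewrite -(act_origin s (u := a%:num))// -h /scaled_mark actKV//.
by [].
Qed.

(** Points and marks are evaluated at separate outcomes, each with its own generated sigma-algebra:
    the form that [integral_independent] requires. *)
Lemma measurable_marked_joint : measurable_fun setT (fun p : OG * OH =>
  pm (zip (points p.1) [seq scaled_mark j p.2 | j <- iota 0 (N p.1)]) : borel (pointMeasureE T s)).
Proof.
rewrite (_ : (fun p => _) = (fun p : OG * OH =>
    (fun n p => pm (mkseq (fun i => (t' i p.1, scaled_mark i p.2)) n)) (N p.1) p)); last first.
  by apply/funext => p /=; rewrite pointsE -zip_mkseq.
apply: (@measurable_pieces _ _ _ (borel (pointMeasureE T s)) (fun p : OG * OH => N p.1)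
  (fun n (p : OG * OH) => pm (mkseq (fun i => (t' i p.1, scaled_mark i p.2)) n))).
  move=> n; rewrite (_ : [set z | _] = fst @^-1` [set w : OG | N w = n]) //.
  by rewrite -[X in measurable X]setTI; exact: measurable_fst.
move=> n; apply: (@measurable_pm _ _ _ s sepT sepX _ _ n
  (fun i (p : OG * OH) => t' i p.1) (fun i (p : OG * OH) => scaled_mark i p.2)).
  by move=> i; exact: (measurableT_comp (mt' i) measurable_fst).
move=> i; apply: (measurableT_comp mact).
exact: (measurableT_comp (mx i) measurable_snd).
Qed.

Lemma measurable_marked : measurable_fun setT (fun w =>
  pm (zip (points w) [seq scaled_mark j w | j <- iota 0 (N w)]) : borel (pointMeasureE T s)).
Proof.
have mid1 : measurable_fun setT (id : Omega -> OG).
  by move=> _ A GA; rewrite setTI; exact: point_events_measurable.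
have mid2 : measurable_fun setT (id : Omega -> OH).
  by move=> _ A HA; rewrite setTI; exact: sequence_events_measurable.
exact: (measurableT_comp measurable_marked_joint (measurable_fun_pair mid1 mid2)).
Qed.

End marked_process.

Lemma factorial_power_setT (R : realType) d (Omega : measurableType d) (S : ptopologicalType)
    (N : Omega -> nat) (t : nat -> Omega -> S) k w :
  factorial_power N t w [set: k.-tuple (borel S)] = (k`! * 'C(N w, k))%:R%:E :> \bar R.
Proof.
rewrite /factorial_power (eq_bigr (fun=> 1%E)); last by move=> i _; rewrite diracT.
rewrite (@sum_uniq_tuples_comb R (N w) k (fun=> 1%E))//.
have -> : (\sum_(u <- comb k (enum 'I_(N w))) 1 = ('C(N w, k))%:R%:E :> \bar R)%E.
  by rewrite sume_seq1 size_comb size_enum_ord.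
by rewrite natrM EFinM.
Qed.

Section limit_of_laws.
Context {R : realType} {T X : completeMetricType R}.
Hypotheses (sepT : separable_space T) (sepX : separable_space X).
Variable s : scaling X.
Notation o := (origin s).
Notation d := (@dE R T X).
Notation F := (axis (T := T) s).
Notation pm := (pm_of_seq d F).
Context {dO : measure_display} {Omega : measurableType dO} (P : probability Omega R).
Variables (N : Omega -> nat) (t : nat -> Omega -> T).
Hypothesis t_random : point_events N t `<=` measurable.
Variables (x : nat -> Omega -> X).
Hypothesis x_neq0 : forall i w, x i w <> o.
Variable nu : probability (borel X) R.
Hypothesis x_iid : iid P x nu.
Hypothesis x_indep : independent_systems P
       <<s point_events N t >> <<s sequence_events x >>.
Variables (a : nat -> {posnum R}) (law : nat -> probability (borel X) R).
Hypothesis lawE : forall n A, law n A = nu (act s (a n)%:num^-1 @^-1` A).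
Variable m : {sigma_finite_measure set (borel X) -> \bar R}.
Hypothesis m_far : forall delta, 0 < delta -> (m (far o delta) < +oo)%E.
Hypothesis law_m : vague_cvg o m (fun n => n%:R) law.
Variables (k : nat) (M r0 : R).
Variable f : pointMeasureE T s -> R.
Hypotheses (cf : continuous f) (fM : forall p, 0 <= f p <= M) (r00 : 0 < r0).
Hypothesis f0 : forall p, fattening (@pm_dist R _ d F) (at_most k) r0 p -> f p = 0.
Hypothesis M_finite : (factorial_moment P N t k.+1 setT < +oo)%E.

Let ts := points N t.
Let y n := scaled_mark s x (a n).
Let y_iid n : iid P (y n) (law n).
Proof. by apply: (scaled_mark_iid x_iid); exact: lawE. Qed.

(** The expectation over the rescaled marks with the points of [w] frozen. *)
Definition mean_given_points n w : R :=
  riter (law n) (N w) (fun ys => f (pm (zip (ts w) ys))).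

Lemma size_points w : size (ts w) = N w.
Proof. exact: size_mkseq. Qed.

Lemma law_integral n :
  measurable_fun setT (mean_given_points n) /\
  (\int[P]_w (f (pm (zip (ts w) [seq y n j w | j <- iota 0 (N w)])))%:E =
   \int[P]_w (mean_given_points n w)%:E)%E.
Proof.
have mf : measurable_fun setT (fun p : borel (pointMeasureE T s) => (f p)%:E : \bar R).
  by apply/measurable_EFinP; exact: test_borel_measurable.
have mjoint := measurable_marked_joint sepT sepX (N := N) (t := t) (x := x) (a n).
have mF : measurable_fun setT (fun p : g_sigma_algebraType (point_events N t) *
    g_sigma_algebraType (sequence_events x) =>
    (f (pm (zip (ts p.1) [seq y n j p.2 | j <- iota 0 (N p.1)])))%:E : \bar R).
  by apply: (measurableT_comp mf); exact: mjoint.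
have [m1 e1] := @integral_independent _ _ R P (point_events N t) (sequence_events x)
  (fun w w' => (f (pm (zip (ts w) [seq y n j w' | j <- iota 0 (N w)])))%:E)
  (point_events_measurable t_random) (sequence_events_measurable x_iid) x_indep
  (fun _ _ => fE_ge0 fM _) mF.
have inner w : (\int[P]_w' (f (pm (zip (ts w) [seq y n j w' | j <- iota 0 (N w)])))%:E =
    (mean_given_points n w)%:E)%E.
  rewrite -(riter_integral sepT sepX cf fM y_iid n (ts := ts w) (iota_uniq 0 (N w))).
    by rewrite size_points.
  by rewrite size_iota size_points.
split; first by apply/measurable_EFinP; move: m1; under eq_fun do rewrite inner.
by rewrite e1; apply: eq_integral => w _; rewrite inner.
Qed.

Let mN n : measurable [set w | N w = n].
Proof. by apply: t_random; left; exists n. Qed.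

Lemma integrable_binomial :
  P.-integrable setT (fun w => ('C(N w, k.+1)%:R)%:E : \bar R).
Proof.
have mC : measurable_fun setT (fun w => ('C(N w, k.+1)%:R)%:E : \bar R).
  by apply: (@measurable_pieces _ _ _ _ N (fun n _ => ('C(n, k.+1)%:R)%:E)).
apply/integrableP; split => //.
apply: le_lt_trans M_finite; rewrite /factorial_moment.
under [leRHS]eq_integral do rewrite factorial_power_setT.
apply: le_integral_nonneg => w _; first exact: abse_ge0.
by rewrite gee0_abs ?lee_fin// ler_nat leq_pmull// fact_gt0.
Qed.

Lemma mean_cvg : [/\ measurable_fun setT
      (fun w => (\sum_(u <- comb k.+1 (ts w)) block_limit k f m u)%E),
  (\int[P]_w \sum_(u <- comb k.+1 (ts w)) block_limit k f m u)%E \is a fin_num &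
  ((n%:R ^+ k.+1)%:E * \int[P]_w (mean_given_points n w)%:E)%E @[n --> \oo] -->
  (\int[P]_w \sum_(u <- comb k.+1 (ts w)) block_limit k f m u)%E].
Proof.
have r20 : 0 < r0 / 2 by rewrite divr_gt0.
have M0 : 0 <= M by have /andP[+ ] := fM point; exact: le_trans.
(* [C] bounds [n] times the far mass of [law n] for every [n], which makes the dominating function
   independent of [n]. *)
have [C C0 bC] := far_mass_bound m_far law_m r20.
have mg n := (law_integral n).1.
have bound n w : 0 <= n%:R ^+ k.+1 * mean_given_points n w <=
    M * 'C(N w, k.+1)%:R * C ^+ k.+1.
  have [Am Av Ap _] := zip_admissible sepT sepX cf fM r00 f0 (ts w).
  rewrite -(size_points w).
  have := scaled_riter_bound (delta := r0 / 2) (o := o) M0 (ler0n R n) (bC n) (Am 0%N) (Ap 0%N) (Av 0%N).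
  by rewrite /mean_given_points size_points.
rewrite (_ : (fun n => _) = (fun n => \int[P]_w (n%:R ^+ k.+1 * mean_given_points n w)%:E)%E); last first.
  apply/funext => n; under [RHS]eq_integral do rewrite EFinM.
  rewrite ge0_integralZl_EFin//.
  - move=> w _; rewrite lee_fin.
    have [Am Av Ap _] := zip_admissible sepT sepX cf fM r00 f0 (ts w).
    rewrite /mean_given_points -(size_points w).
    by have [_ + _] := riter_bounds (law n) (Am 0%N) (Ap 0%N).
  - by apply/measurable_EFinP; exact: mg.
have dom n w : (`|(n%:R ^+ k.+1 * mean_given_points n w)%:E| <=
    (M * C ^+ k.+1)%:E * ('C(N w, k.+1)%:R)%:E)%E.
  have /andP[h1 h2] := bound n w.
  by rewrite gee0_abs -?EFinM lee_fin// mulrAC.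
have mfn n : measurable_fun setT (fun w => (n%:R ^+ k.+1 * mean_given_points n w)%:E : \bar R).
  by apply/measurable_EFinP; exact: measurable_funM.
have cvg_w w : (n%:R ^+ k.+1 * mean_given_points n w)%:E @[n --> \oo] -->
    (\sum_(u <- comb k.+1 (ts w)) block_limit k f m u)%E.
  have [fin c] := scaled_riter_cvg sepT sepX cf fM r00 f0 m_far law_m (ts w).
  rewrite -(fineK fin); apply: cvg_EFin; first exact: nearW.
  by move: c; rewrite size_points.
have mlim : measurable_fun setT
    (fun w => (\sum_(u <- comb k.+1 (ts w)) block_limit k f m u)%E).
  exact: (emeasurable_fun_cvg (fun n w => (n%:R ^+ k.+1 * mean_given_points n w)%:E)).
have [int _ c] := @dominated_convergence _ _ _ P setT measurableT
  (fun n w => (n%:R ^+ k.+1 * mean_given_points n w)%:E) _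
  (fun w => ((M * C ^+ k.+1)%:E * ('C(N w, k.+1)%:R)%:E)%E) mfn mlim
  (aeW P (fun w _ => cvg_w w))
  (integrableZl measurableT _ integrable_binomial)
  (aeW P (fun w n _ => dom n w)).
by split; [exact: mlim|exact: integrable_fin_num int|exact: c].
Qed.

End limit_of_laws.

(** * Factorial moments and the limit measure *)

Lemma sum_evaluations_measure_functional (R : realType) d (Y : measurableType d)
    (I : finType) (Q : pred I) (c : I -> Y) :
  measure_functional (fun g : Y -> \bar R => \sum_(i | Q i) g (c i))%E.
Proof.
split.
- by move=> g g0; apply: sume_ge0 => i _.
- by move=> g h g0 gh _ _; apply: lee_sum => i _.
- by move=> g h g0 h0 _ _; rewrite big_split.
- by move=> r g r0 g0 _; rewrite ge0_sume_distrr.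
- move=> g g0 _ ndg; apply: cvg_nnesum => i _; first exact: nearW.
  exact: ereal_nondecreasing_is_cvgn.
Qed.

Section factorial_moment_measure.
Context {R : realType} {S : completeMetricType R}.
Context {dO : measure_display} {Omega : measurableType dO} (P : probability Omega R).
Variables (N : Omega -> nat) (t : nat -> Omega -> S).
Hypothesis t_random : point_events N t `<=` measurable.

Let mN n : measurable [set w | N w = n].
Proof. by apply: t_random; left; exists n. Qed.

Definition factorial_sum K (w : Omega) (g : K.-tuple (borel S) -> \bar R) : \bar R :=
  (\sum_(i : K.-tuple 'I_(N w) | uniq i) g [tuple (t (tnth i j) w : borel S) | j < K])%E.

Lemma measurable_factorial_sum K (g : K.-tuple (borel S) -> \bar R) :
  measurable_fun setT g -> measurable_fun setT (fun w => factorial_sum w g).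
Proof.
move=> mg.
(* On the event [N w = n] the tuples only use indices below [n], where [t'] agrees with [t]; unlike
   [t], it is measurable everywhere. *)
pose t' i w : borel S := if (i < N w)%N then t i w else point.
rewrite (_ : (fun w => _) = (fun w => (fun n w =>
    \sum_(i : K.-tuple 'I_n | uniq i) g [tuple t' (tnth i j) w | j < K])%E (N w) w)); last first.
  apply/funext => w; apply: eq_bigr => i _; congr g; apply: eq_mktuple => j.
  by rewrite /t' ltn_ord.
apply: (measurable_pieces (Fn := fun n w =>
    \sum_(i : K.-tuple 'I_n | uniq i) g [tuple t' (tnth i j) w | j < K])%E) => // n.
under eq_fun do rewrite big_mkcond /=.
apply: emeasurable_sum => i; case: (uniq i) => //; apply: (measurableT_comp mg).
apply/measurable_fun_tnthP => j.
rewrite (_ : _ \o _ = t' (tnth i j)); first exact: measurable_total_point.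
by apply/funext => w /=; rewrite tnth_mktuple.
Qed.

(** A Campbell formula: a finite sum of evaluations satisfies [measure_functional], and integrating
    it over [Omega] preserves this. *)
Lemma factorial_moment_measure K :
  exists MM : {measure set (K.-tuple (borel S)) -> \bar R},
    (forall A, MM A = factorial_moment P N t K A) /\
    forall g, (forall v, 0 <= g v)%E -> measurable_fun setT g ->
      (\int[MM]_v g v = \int[P]_w factorial_sum w g)%E.
Proof.
have mf : measure_functional (fun g : K.-tuple (borel S) -> \bar R =>
    \int[P]_w factorial_sum w g)%E.
  apply: (@integral_measure_functional _ _ Omega P _ (K.-tuple (borel S))
    (fun w g => factorial_sum w g)).
    by move=> w; exact: sum_evaluations_measure_functional.
  by move=> g _; exact: measurable_factorial_sum.
have [MM [MME MMint]] := measure_functional_rep mf.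
by exists MM; split => // A; rewrite MME.
Qed.

Lemma factorial_sum_comb K (h : seq S -> \bar R) w : (forall u, 0 <= h u)%E ->
  (forall u v, size u = K -> perm_eq u v -> h u = h v) ->
  factorial_sum w (fun v : K.-tuple (borel S) => h (v : seq S)) =
  (K`!%:R%:E * \sum_(u <- comb K (points N t w)) h u)%E.
Proof.
move=> h0 hsym.
rewrite /factorial_sum.
rewrite (eq_bigr (fun i : K.-tuple 'I_(N w) => h [seq t (val j) w | j <- tval i])); last first.
  move=> i _; congr h.
  by rewrite /= -[in RHS](map_tnth_enum i) -map_comp; apply: eq_map => j.
rewrite (sum_uniq_tuples_comb (h := fun u => h [seq t (val j) w | j <- u]))//; last first.
  by move=> u v su uv; apply: hsym; rewrite ?size_map//; exact: perm_map.
congr (_ * _)%E.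
rewrite /points /mkseq -val_enum_ord -map_comp map_comb big_map.
by [].
Qed.

End factorial_moment_measure.

(** Places every element of [at_most k] in each of its fattenings of positive radius, so that test
    functions vanish on [at_most k] itself. *)
Lemma pm_distxx_le0 (R : realType) (S : ptopologicalType) (F : set S)
    (d : S -> S -> R) (dxx : forall z, d z z = 0) (p : pointMeasure d F) :
  pm_dist p p <= 0.
Proof.
rewrite -[leRHS]addr0; apply: (@rho_le _ _ _ _ _ _ set0) => //.
  by rewrite measure0.
move=> r r0 _; apply/ler_addgt0Pl => e e0; rewrite addr0; apply: prohorov_le => // A mA AD.
have : (p A <= p (fattening d A e `&` ~` fattening d F r) + e%:E)%E; last by [].
apply: (@le_trans _ _ (p (fattening d A e `&` ~` fattening d F r))).
  by apply: pm_mono => z Az; split; [exists z; rewrite ?dxx|exact: AD].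
by rewrite leeDl// lee_fin ltW.
Qed.

(** * Convergence against test functions on point measures *)

Section convergence.
Context {R : realType} {T X : completeMetricType R}.
Hypotheses (sepT : separable_space T) (sepX : separable_space X).
Variable s : scaling X.
Notation o := (origin s).
Notation d := (@dE R T X).
Notation F := (axis (T := T) s).
Notation pm := (pm_of_seq d F).
Context {dO : measure_display} {Omega : measurableType dO} (P : probability Omega R).
Variables (N : Omega -> nat) (t : nat -> Omega -> T).
Hypothesis t_random : point_events N t `<=` measurable.
Variables (x : nat -> Omega -> X).
Hypothesis x_neq0 : forall i w, x i w <> o.
Variable nu : probability (borel X) R.
Hypothesis x_iid : iid P x nu.
Hypothesis x_indep : independent_systems P
       <<s point_events N t >> <<s sequence_events x >>.
Variables (a : nat -> {posnum R}) (law : nat -> probability (borel X) R).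
Hypothesis lawE : forall n A, law n A = nu (act s (a n)%:num^-1 @^-1` A).
Variable m : {sigma_finite_measure set (borel X) -> \bar R}.
Hypothesis m_far : forall delta, 0 < delta -> (m (far o delta) < +oo)%E.
Hypothesis law_m : vague_cvg o m (fun n => n%:R) law.
Variable k : nat.
Hypothesis M_finite : (factorial_moment P N t k.+1 setT < +oo)%E.
Variable MM : {measure set (k.+1.-tuple (borel T)) -> \bar R}.
Hypothesis MM_int : forall g, (forall v, 0 <= g v)%E -> measurable_fun setT g ->
      (\int[MM]_v g v = \int[P]_w factorial_sum N t w g)%E.

Lemma tuple_pm_plot : plot_measurable k.+1
  (fun (v : k.+1.-tuple (borel T)) xs => pm (zip (v : seq T) xs) : borel (pointMeasureE T s)).
Proof.
have mnth i : measurable_fun setT (fun v : k.+1.-tuple (borel T) => nth point v i).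
  have [ilt|ilt] := ltnP i k.+1.
    rewrite (_ : (fun v => _) = (@tnth k.+1 (borel T)^~ (Ordinal ilt))).
      exact: measurable_tnth.
    by apply/funext => v; rewrite (tnth_nth point).
  rewrite (_ : (fun v => _) = cst point); first exact: measurable_cst.
  by apply/funext => v; rewrite nth_default// size_tuple.
have := plot_measurable_pm sepT sepX (s := s) k.+1 mnth.
rewrite (_ : (fun v xs => _) = (fun (v : k.+1.-tuple (borel T)) xs =>
  pm (zip (v : seq T) xs) : borel (pointMeasureE T s)))//.
apply/funext => v; apply/funext => xs; congr (pm (zip _ _)).
by rewrite -[RHS](mkseq_nth (point : borel T)) size_tuple.
Qed.

Variable mus0 : {measure set (borel (pointMeasureE T s)) -> \bar R}.
Hypothesis mus0_int : forall g, (forall p, 0 <= g p)%E -> measurable_fun setT g ->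
  (\int[mus0]_p g p = \int[MM]_v iter_integral m setT k.+1 (fun xs => g (pm (zip (v : seq T) xs))))%E.

Hypothesis cK_ge0 : 0 <= (k.+1`!%:R : R)^-1.
Let cK : {nonneg R} := NngNum cK_ge0.

Lemma scaled_law_measure n : exists q : {measure set (borel (pointMeasureE T s)) -> \bar R},
  (q : set _ -> \bar R) = (fun B => (n%:R ^+ k.+1)%:E * scaled_law P N t x (a n) B)%E.
Proof.
have nK0 : 0 <= (n%:R : R) ^+ k.+1 by rewrite exprn_ge0.
have [Q [QE _]] := probability_pushforward P (measurable_marked sepT sepX (s := s) t_random x_iid (a n)).
exists (mscale (NngNum nK0) Q); apply/funext => B.
rewrite /= /mscale /= QE /scaled_law; congr (_ * P _)%E.
by apply/funext => w /=; rewrite pm_scale_marked.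
Qed.

Lemma nonneg_test_cvg (f : pointMeasureE T s -> R) : continuous f ->
  (exists M, forall p, 0 <= f p <= M) ->
  bounded_away (@pm_dist R _ d F) (at_most k) (closure [set p | f p != 0]) ->
  (\int[mscale cK mus0]_(p in ~` at_most k) (f p)%:E)%E \is a fin_num /\
  (\int[fun B => ((n%:R ^+ k.+1)%:E * scaled_law P N t x (a n) B)%E]_(p in ~` at_most k) (f p)%:E)%E
    @[n --> \oo] --> (\int[mscale cK mus0]_(p in ~` at_most k) (f p)%:E)%E.
Proof.
move=> cf [M fM] [r0 r00 away].
have f0 p : fattening (@pm_dist R _ d F) (at_most k) r0 p -> f p = 0.
  move=> pr; apply: contrapT => /eqP fp.
  have : (closure [set p | f p != 0] `&` fattening (@pm_dist R _ d F) (at_most k) r0) p.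
    by split => //; exact: subset_closure.
  by rewrite away.
have f_at_most p : at_most k p -> f p = 0.
  move=> pk; apply: f0; exists p => //; apply: le_lt_trans r00.
  by apply: pm_distxx_le0 => z; rewrite /dE !mdistxx addr0.
have mf : measurable_fun setT (fun p : borel (pointMeasureE T s) => (f p)%:E : \bar R).
  by apply/measurable_EFinP; exact: test_borel_measurable.
have fE0 p : (0 <= (f p)%:E)%E by rewrite lee_fin; case/andP: (fM p).
(* [f] vanishes on [at_most k], so the two extended integrands are equal; unfolding [integral] lets
   this apply to set functions [q] that are not yet known to be measures. *)
have restr (q : set (borel (pointMeasureE T s)) -> \bar R) :
    (\int[q]_(p in ~` at_most k) (f p)%:E = \int[q]_p (f p)%:E)%E.
  rewrite /integral; suff -> : (fun p : borel (pointMeasureE T s) => (f p)%:E) \_ (~` at_most k) =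
    (fun p => (f p)%:E) \_ setT by [].
  apply/funext => p; rewrite !patchE in_setT.
  case: ifPn => //; rewrite notin_setE /= => /contrapT pk.
  by rewrite f_at_most.
have fM' := fM.
have [msum fin c] := mean_cvg sepT sepX t_random x_iid x_indep lawE m_far law_m cf fM r00 f0 M_finite.
have lim_eq : (\int[mscale cK mus0]_p (f p)%:E =
    \int[P]_w \sum_(u <- comb k.+1 (points N t w)) block_limit k f m u)%E.
  rewrite ge0_integral_mscale// mus0_int// MM_int; last 2 first.
  - by move=> v; apply: iter_integral_ge0 => xs; exact: fE0.
  - apply: (@measurable_iter_integral _ _ m _ _ k.+1 (fun (v : k.+1.-tuple (borel T)) xs =>
      (f (pm (zip (v : seq T) xs)))%:E)) => //.
    exact: (plot_measurable_post mf tuple_pm_plot).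
  (* Each selection of [k.+1] points occurs once per ordering in the factorial sum; the resulting
     [(k+1)!] cancels [cK]. *)
  rewrite (eq_integral (fun w => ((k.+1`!%:R)%:E *
      \sum_(u <- comb k.+1 (points N t w)) block_limit k f m u)%E)); last first.
    move=> w _; apply: (@factorial_sum_comb _ _ _ _ N t k.+1 (block_limit k f m)).
      by move=> u; apply: iter_integral_ge0 => xs; exact: fE0.
    move=> u v su uv.
    exact: (block_limit_perm sepT sepX cf fM r00 f0 m_far law_m
      (fun n => scaled_mark_iid x_iid (lawE n)) su uv).
  have sum0 w : (0 <= \sum_(u <- comb k.+1 (points N t w)) block_limit k f m u)%E.
    by apply: sume_ge0 => u _; apply: iter_integral_ge0 => xs; exact: fE0.
  have fact0 : (k.+1`!%:R : R) != 0 by rewrite pnatr_eq0 -lt0n fact_gt0.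
  by rewrite ge0_integralZl_EFin// muleA -EFinM/= mulVf// mul1e.
split; first by rewrite restr lim_eq.
rewrite (restr (mscale cK mus0)) lim_eq.
have mmarked n := measurable_marked sepT sepX (s := s) t_random x_iid (a n).
rewrite (_ : (fun n => _) = (fun n => ((n%:R ^+ k.+1)%:E *
    \int[P]_w (mean_given_points N t law f n w)%:E)%E)) //.
apply/funext => n.
have [Q [QE Qint]] := probability_pushforward P (mmarked n).
have nK0 : 0 <= (n%:R : R) ^+ k.+1 by rewrite exprn_ge0.
rewrite restr (_ : (fun B => _) = mscale (NngNum nK0) Q); last first.
  apply/funext => B; rewrite /mscale /= QE /scaled_law; congr (_ * P _)%E.
  by apply/funext => w /=; rewrite pm_scale_marked.
rewrite ge0_integral_mscale// Qint//.
by rewrite (law_integral sepT sepX t_random x_iid x_indep lawE cf fM n).2.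
Qed.

Lemma test_cvg : away_cvg (@pm_dist R _ d F) (at_most k)
  (fun n B => ((n%:R ^+ k.+1)%:E * scaled_law P N t x (a n) B)%E) (mscale cK mus0).
Proof.
move=> f cf [M fM] [r0 r00 away].
(* [fp false] and [fp true] are the positive and negative parts of [f]; each is covered by the
   nonnegative case, and finiteness of their limits permits the subtraction. *)
pose fp (b : bool) p := Num.max ((-1) ^+ b * f p) 0.
have part b := nonneg_test_cvg (f := fp b).
have {}part b : (\int[mscale cK mus0]_(p in ~` at_most k) (fp b p)%:E)%E \is a fin_num /\
  (\int[fun B => ((n%:R ^+ k.+1)%:E * scaled_law P N t x (a n) B)%E]_(p in ~` at_most k) (fp b p)%:E)%E
    @[n --> \oo] --> (\int[mscale cK mus0]_(p in ~` at_most k) (fp b p)%:E)%E.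
  apply: part.
  - move=> p; apply: (@continuous_max R _ (fun p => (-1) ^+ b * f p) (cst 0)).
      exact: (cvgM (cvg_cst ((-1) ^+ b : R)) (cf p)).
    exact: cst_continuous.
  - exists M => p; rewrite le_max lexx orbT ge_max (le_trans _ (fM p))//=.
      by rewrite (le_trans (normr_ge0 (f p))).
    by rewrite (le_trans (ler_norm _))// normrM normr_sign mul1r.
  - exists r0 => //; apply/seteqP; split => // p [pc pr].
    rewrite -away; split => //; apply: closure_subset pc => q /= fq.
    by apply: contra_neq fq => fq0; rewrite /fp fq0 mulr0 maxxx.
have split_int (q : {measure set (borel (pointMeasureE T s)) -> \bar R}) :
    (\int[q]_(p in ~` at_most k) (f p)%:E =
     \int[q]_(p in ~` at_most k) (fp false p)%:E - \int[q]_(p in ~` at_most k) (fp true p)%:E)%E.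
  rewrite integralE; congr (_ - _)%E; apply: eq_integral => p _.
    by rewrite funeposE /fp expr0 mul1r EFin_max.
  by rewrite funenegE /fp expr1 mulN1r EFin_max.
rewrite split_int.
rewrite (_ : (fun n => _) = (fun n =>
   \int[fun B => ((n%:R ^+ k.+1)%:E * scaled_law P N t x (a n) B)]_(p in ~` at_most k) (fp false p)%:E
  - \int[fun B => ((n%:R ^+ k.+1)%:E * scaled_law P N t x (a n) B)]_(p in ~` at_most k) (fp true p)%:E)%E).
  apply: cvgeB; [|exact: (part false).2|exact: (part true).2].
  by apply: fin_num_adde_defr; exact: (part false).1.
apply/funext => n.
have [q qE] := scaled_law_measure n.
by rewrite -qE split_int.
Qed.

End convergence.

(** The indicators compared below belong to sets not shown to be Borel, so measurability is kept out
    of this comparison. *)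
Lemma le_iter_integral_nonneg (R : realType) (S : ptopologicalType)
    (m : {measure set (borel S) -> \bar R}) (D : set S) n (f g : seq S -> \bar R) :
  (forall xs, 0 <= f xs)%E -> (forall xs, size xs = n -> f xs <= g xs)%E ->
  (iter_integral m D n f <= iter_integral m D n g)%E.
Proof.
elim: n f g => [|n IH] f g f0 fg /=; first exact: fg.
apply: le_integral_nonneg => x _; first exact: iter_integral_ge0.
by apply: IH => // xs sxs; apply: fg; rewrite /= sxs.
Qed.

(** * Finiteness away from [at_most k] and non-nullity of the limit measure *)

Section limit_measure_bounds.
Context {R : realType} {T X : completeMetricType R}.
Variable s : scaling X.
Notation o := (origin s).
Notation d := (@dE R T X).
Notation F := (axis (T := T) s).
Notation pm := (pm_of_seq d F).
Variables (m : {sigma_finite_measure set (borel X) -> \bar R}) (k : nat).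
Hypothesis m_far : forall delta, 0 < delta -> (m (far o delta) < +oo)%E.

(** Written as a product so that [iter_integral_box] evaluates its integral; [all_farE] gives the
    logical form. *)
Definition all_far delta (xs : seq X) : R :=
  \prod_(i < k.+1) \1_(far o delta) (nth point xs i : borel X).

Lemma all_far_ge0 delta xs : 0 <= all_far delta xs.
Proof. exact: prodr_ge0. Qed.

Lemma all_farE delta xs : size xs = k.+1 ->
  all_far delta xs = (all (fun y : X => delta <= mdist o y) xs)%:R.
Proof.
move=> sxs; rewrite /all_far; case: (boolP (all _ _)) => [/allP h|/allPn[y yxs yd]].
  rewrite big1// => i _; rewrite indicE mem_set//=; apply: h.
  by apply: mem_nth; rewrite sxs.
have ilt : (index y xs < k.+1)%N by rewrite -sxs index_mem.
rewrite (bigD1 (Ordinal ilt))//= nth_index// indicE memNset ?mul0r//=.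
exact/negP.
Qed.

Lemma iter_all_far delta : 0 < delta ->
  iter_integral m setT k.+1 (fun xs => (all_far delta xs)%:E) =
  (fine (m (far o delta)) ^+ k.+1)%:E.
Proof.
move=> d0; have fin : m (far o delta) \is a fin_num by rewrite ge0_fin_numE ?m_far.
have := iter_integral_box (nu := m) k.+1 (fun=> measurable_far o delta) (fun=> m_far d0).
move=> ->; rewrite -(fineK fin); elim: k.+1 => [|n IH]; first by rewrite big_ord0.
by rewrite big_ord_recr IH exprSr EFinM.
Qed.

(** Among [k.+1] points, one closer than [r / 2] to the axis leaves at most [k] others, and
    [pm_near_at_most] then puts the measure in the fattening. *)
Lemma not_fattening_all_far r (ts : seq T) (xs : seq X) : 0 < r ->
  size ts = k.+1 -> size xs = k.+1 ->
  ((\1_(~` fattening (@pm_dist R _ d F) (at_most k) r) (pm (zip ts xs)))%:E <=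
   (all_far (r / 2) xs)%:E)%E.
Proof.
move=> r0 sts sxs; rewrite lee_fin indicE all_farE//; case: (boolP (_ \in _)) => // /set_mem nf.
case: (boolP (all _ _)) => // nall; exfalso; apply: nf.
apply: (pm_near_at_most (delta := r / 2)).
  by rewrite divr_gt0//= ltr_pdivrMr// mulr2n mulrDr mulr1 ltrDl.
rewrite -ltnS -sxs ltnNge; apply: contra nall => c.
rewrite all_count eqn_leq count_size/=.
rewrite -(count_map snd (fun y : X => (r / 2 <= mdist o y)%R)) -/unzip2 in c.
by rewrite unzip2_zip ?sts ?sxs// in c; rewrite sxs.
Qed.

Lemma all_far_not_at_most delta (ts : seq T) (xs : seq X) : 0 < delta ->
  size ts = k.+1 -> size xs = k.+1 ->
  ((all_far delta xs)%:E <= (\1_(~` at_most k) (pm (zip ts xs)))%:E)%E.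
Proof.
move=> d0 sts sxs; rewrite lee_fin all_farE//; case: (boolP (all _ _)) => // h.
rewrite indicE mem_set//= => /=; rewrite /at_most/= sum_dirac_count lee_fin ler_nat.
rewrite (_ : count _ _ = k.+1) ?ltnn//.
have szz : size (zip ts xs) = k.+1 by rewrite size_zip sts sxs minnn.
rewrite -szz; apply/eqP; rewrite -all_count; apply/allP => z zin.
rewrite in_setT andbT; apply/negP => /set_mem/axisP zo.
have zx : z.2 \in xs.
  by rewrite -[xs](@unzip2_zip _ _ ts) ?sts ?sxs//; exact: map_f.
by move/allP: h => /(_ _ zx); rewrite zo mdistxx leNgt d0.
Qed.

Variable MM : {measure set (k.+1.-tuple (borel T)) -> \bar R}.
Hypothesis MM_finite : (MM setT < +oo)%E.
Hypotheses (sepT : separable_space T) (sepX : separable_space X).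

Lemma limit_measure_exists :
  exists M : {measure set (borel (pointMeasureE T s)) -> \bar R},
    (forall B, M B = \int[MM]_v iter_integral m setT k.+1
       (fun xs => (\1_B (pm (zip (v : seq T) xs)))%:E))%E /\
    (forall g, (forall p, 0 <= g p)%E -> measurable_fun setT g ->
      (\int[M]_p g p = \int[MM]_v iter_integral m setT k.+1
         (fun xs => g (pm (zip (v : seq T) xs))))%E).
Proof.
apply: (@measure_functional_rep _ (borel (pointMeasureE T s)) R (fun g =>
  \int[MM]_v iter_integral m setT k.+1 (fun xs => g (pm (zip (v : seq T) xs))))%E).
apply: (@integral_measure_functional _ _ (k.+1.-tuple (borel T)) MM _ (borel (pointMeasureE T s))
  (fun v g => iter_integral m setT k.+1 (fun xs => g (pm (zip (v : seq T) xs))))) => [v|g g0 mg].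
  exact: (@iter_integral_measure_functional _ _ m _ _ _ _ k.+1 _ v (@tuple_pm_plot _ _ _ sepT sepX s k)).
apply: (@measurable_iter_integral _ _ m _ _ k.+1 (fun (v : k.+1.-tuple (borel T)) xs =>
    g (pm (zip (v : seq T) xs)))) => //.
exact: (plot_measurable_post mg (@tuple_pm_plot _ _ _ sepT sepX s k)).
Qed.

Lemma limit_measure_away_finite (M : set (borel (pointMeasureE T s)) -> \bar R) :
  (forall B, M B = \int[MM]_v iter_integral m setT k.+1
       (fun xs => (\1_B (pm (zip (v : seq T) xs)))%:E))%E ->
  away_finite (@pm_dist R _ d F) (at_most k) M.
Proof.
move=> ME r r0; rewrite ME.
apply: (@le_lt_trans _ _ (\int[MM]_v (fine (m (far o (r / 2))) ^+ k.+1)%:E)%E); last first.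
  by rewrite integral_cst// lte_mul_pinfty// ?lee_fin ?exprn_ge0// fine_ge0.
apply: le_integral_nonneg => v _.
  by apply: iter_integral_ge0 => xs; rewrite lee_fin.
rewrite -iter_all_far ?divr_gt0//; apply: le_iter_integral_nonneg => [xs|xs sxs].
  by rewrite lee_fin.
by apply: not_fattening_all_far; rewrite ?size_tuple.
Qed.

(** If all [k.+1] marks are far, the point measure has [k.+1] atoms. Hence the mass is at least
    [MM setT] times a power of the [m]-mass of a far set, and some far set has positive mass by
    countable subadditivity. *)
Lemma limit_measure_away_nonnull (M : set (borel (pointMeasureE T s)) -> \bar R) :
  (forall B, M B = \int[MM]_v iter_integral m setT k.+1
       (fun xs => (\1_B (pm (zip (v : seq T) xs)))%:E))%E ->
  MM setT <> 0%E -> m (~` [set o]) <> 0%E -> M (~` at_most k) <> 0%E.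
Proof.
move=> ME MM0 m0.
have [n mn] : exists n, m (far o n.+1%:R^-1) != 0%E.
  apply: contrapT => h; apply: m0.
  have mfar n := measurable_far o (n.+1%:R^-1 : R).
  have := @measure_sigma_subadditive _ _ _ m _ _ mfar (bigcup_measurable (fun n _ => mfar n)) (@subset_refl _ _).
  rewrite -not_origin_bigcup eseries0; last first.
    by move=> n _ _; apply: contrapT => /eqP nz; apply: h; exists n.
  by move=> m_le0; apply/eqP; rewrite eq_le m_le0 measure_ge0.
have d0 : 0 < n.+1%:R^-1 :> R by rewrite invr_gt0.
apply/eqP; rewrite gt_eqF// ME.
apply: (@lt_le_trans _ _ (\int[MM]_v (fine (m (far o n.+1%:R^-1)) ^+ k.+1)%:E)%E).
  rewrite integral_cst// mule_gt0// ?lte_fin ?exprn_gt0//.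
    by rewrite fine_gt0// m_far// andbT lt_neqAle eq_sym mn measure_ge0.
  by rewrite lt_neqAle measure_ge0 andbT eq_sym; apply/eqP.
apply: le_integral_nonneg => v _.
  by rewrite lee_fin exprn_ge0// fine_ge0.
rewrite -iter_all_far //; apply: le_iter_integral_nonneg => [xs|xs sxs].
  by rewrite lee_fin all_far_ge0.
by apply: all_far_not_at_most; rewrite ?size_tuple.
Qed.

End limit_measure_bounds.

Theorem theorem3p2 (R : realType) (T X : completeMetricType R)
    (sepT : separable_space T) (sepX : separable_space X) (s : scaling X)
    (d : measure_display) (Omega : measurableType d) (P : probability Omega R)
    (N : Omega -> nat) (t : nat -> Omega -> T)
    (t_random : point_events N t `<=` measurable)
    (x : nat -> Omega -> X) (x_neq0 : forall i w, x i w <> origin s)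
    (nu : probability (borel X) R) (x_iid : iid P x nu)
    (x_indep : independent_systems P
       <<s point_events N t >> <<s sequence_events x >>)
    (a : nat -> {posnum R}) (mu : {measure set (borel X) -> \bar R})
    (nu_RV : regularly_varying s nu a mu)
    (k : nat)
    (M_finite : (factorial_moment P N t k.+1 setT < +oo)%E)
    (M_nonnull : factorial_moment P N t k.+1 setT <> 0%E) :
  exists mustar : {measure set (borel (pointMeasureE T s)) -> \bar R},
    [/\ forall B : set (borel (pointMeasureE T s)),
          measurable B -> B `<=` ~` at_most k ->
          mustar B = limit_measure (factorial_moment P N t k.+1) mu B,
        away_finite (@pm_dist R _ (@dE R T X) (axis s)) (at_most k) mustar,
        away_nonnull (at_most k) mustar &
        away_cvg (@pm_dist R _ (@dE R T X) (axis s)) (at_most k)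
          (fun n B =>
            ((n%:R ^+ k.+1)%:E * scaled_law P N t x (a n) B)%E)
          mustar].
Proof.
pose o := origin s.
have [_ mu_fin mu_nonnull _] := nu_RV.
(* From here on [m], the part of [mu] off the origin, replaces [mu]; [muE] translates back in the
   formula for the limit and in its non-nullity. *)
have [m [muE m_far]] := restriction_sigma_finite mu_fin.
have [law [lawE law_m]] := regularly_varying_vague muE nu_RV.
have [MM [MME MM_int]] := factorial_moment_measure P t_random k.+1.
have MM_finite : (MM setT < +oo)%E by rewrite MME.
have MM_nonnull : MM setT <> 0%E by rewrite MME.
have [mus0 [mus0E mus0_int]] := limit_measure_exists s m MM sepT sepX.
have fact_ge0 : 0 <= (k.+1`!%:R : R)^-1 by rewrite invr_ge0.
exists (mscale (NngNum fact_ge0) mus0); split.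
- move=> B mB _; rewrite /= /mscale /limit_measure /= mus0E.
  rewrite -(funext MME : MM = factorial_moment P N t k.+1 :> (set _ -> \bar R)).
  congr (_ * _)%E; apply: eq_integral => v _.
  have mB1 : measurable_fun setT (fun p : borel (pointMeasureE T s) => (\1_B p)%:E : \bar R).
    by apply/measurable_EFinP; exact: measurable_indic.
  apply/esym/(@iter_integral_setT _ _ mu _ m _ _ k.+1 (fun (v : k.+1.-tuple (borel T)) xs =>
    (\1_B (pm_of_seq (@dE R T X) (axis s) (zip (v : seq T) xs)))%:E) v muE) => //.
  exact: (plot_measurable_post mB1 (@tuple_pm_plot _ _ _ sepT sepX s k)).
- move=> r r0; rewrite /= /mscale/= lte_mul_pinfty ?lee_fin//.
  exact: limit_measure_away_finite m_far _ MM_finite _ mus0E _ r0.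
- rewrite /away_nonnull /= /mscale/=; apply/eqP; rewrite mule_eq0 negb_or; apply/andP; split.
    by rewrite eqe invr_eq0 pnatr_eq0 -lt0n fact_gt0.
  apply/eqP; apply: (limit_measure_away_nonnull m_far mus0E MM_nonnull).
  have mo : measurable (~` [set o] : set (borel X)) by exact: measurable_not_origin.
  have := muE (fun y => (\1_(~` [set o] : set (borel X)) y)%:E).
  rewrite !integral_indic// setIid setIT => <- //.
  by apply/measurable_EFinP; exact: measurable_indic.
- exact: (test_cvg sepT sepX t_random x_neq0 x_iid x_indep lawE m_far law_m M_finite MM_int mus0_int).
Qed.
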